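(* Let $(X,\sigma)$ be an irreducible countable Markov shift and let $\mathcal F=\{\log f_n\}_{n=1}^\infty$ be a Bowen sequence on $X$ which is subadditive up to a constant and uniformly quasi-multiplicative along finite subsystems. (i) If $P(\mathcal F)<\infty$, then $$P_G(\mathcal F)=P(\mathcal F)=\sup_{\mu\in M(X,\sigma)}\Big\{h_\mu(\sigma)+\lim_{n\to\infty}\frac1n\int\log f_n\,d\mu:\ \lim_{n\to\infty}\frac1n\int\log f_n\,d\mu>-\infty\Big\}.\qquad( * )$$ In particular, if $\mathcal F$ is quasi-multiplicative with the strong specification, then the $\limsup$ in the definition of $P_G(\mathcal F)$ can be replaced by $\lim$. (ii) If $P(\mathcal F)=\infty$, then $$P_G(\mathcal F)=P(\mathcal F)=\sup_{\mu\in M(X,\sigma)}\Big\{h_\mu(\sigma)+\limsup_{n\to\infty}\frac1n\int\log f_n\,d\mu:\ \limsup_{n\to\infty}\frac1n\int\log f_n\,d\mu>-\infty\Big\}.$$ In particular, if $\sup f_1<\infty$, then $( * )$ also holds in the case $P(\mathcal F)=\infty$.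
   Context: Shifts. $\mathbb N=\{1,2,\dots\}$. A countable Markov shift is $X=\{(x_n)_{n\ge1}\in\mathbb N^{\mathbb N}: t_{x_nx_{n+1}}=1\ \forall n\}$ for a $0$-$1$ matrix $(t_{ij})_{\mathbb N\times\mathbb N}$ with no zero row and no zero column, with the left shift $\sigma$ and the topology generated by cylinders. $B_n(X)$ is the set of allowable words of length $n$ (words $w$ of length $n$ that are the initial word of some $x\in X$), $B_0(X)=\{\varepsilon\}$ (empty word), $B(X)=\bigcup_{n\ge0}B_n(X)$, $[w]=\{x\in X: x \text{ begins with } w\}$. $X$ is irreducible if for all $u,v\in B(X)$ there is $w\in B(X)$ with $uwv\in B(X)$. $M(X,\sigma)$ is the set of $\sigma$-invariant Borel probability measures on $X$ and $h_\mu(\sigma)$ is the measure-theoretic entropy. Sequences. $\mathcal F=\{\log f_n\}_{n\ge1}$ with $f_n:X\to(0,\infty)$ continuous. It is a Bowen sequence if there is $M\in(0,\infty)$ with $f_n(x)/f_n(y)\le M$ for all $n$ and all $x,y\in X$ with $x_i=y_i$ for $1\le i\le n$. It is subadditive up to a constant if there is $C\ge0$ with $f_{n+m}(x)\le e^Cf_n(x)f_m(\sigma^nx)$ for all $n,m\in\mathbb N$, $x\in X$. It is quasi-multiplicative with constants $p\in\mathbb N$, $D>0$ if for all $n,m\in\mathbb N$, $u\in B_n(X)$, $v\in B_m(X)$ there are $0\le k\le p$ and $w\in B_k(X)$ with $uwv\in B(X)$ and $$\sup_{x\in[uwv]}f_{n+m+k}(x)\ge D\,\sup_{x\in[u]}f_n(x)\,\sup_{x\in[v]}f_m(x).$$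 It is quasi-multiplicative with the strong specification if this holds with $|w|=p$ for all $u,v$. Uniform quasi-multiplicativity along finite subsystems. After a rearrangement of the symbols $\mathbb N$, let $A$ be the transition matrix of $X$, and for $l\in\mathbb N$ put $A_l=A|_{\{1,\dots,l\}\times\{1,\dots,l\}}$ and let $X_{A_l}\subset X$ be the finite state Markov shift determined by $A_l$. The condition is: there exist an increasing sequence $\{l_n\}_{n\ge1}$ and constants $D_1,p_1>0$ such that each $A_{l_n}$ is irreducible and $\mathcal F|_{X_{A_{l_n}}}=\{\log f_k|_{X_{A_{l_n}}}\}_k$ is quasi-multiplicative on $X_{A_{l_n}}$ with constants $p_{l_n}\in\mathbb N$, $D_{l_n}$ satisfying $D_{l_n}\ge D_1$ and $p_{l_n}\le p_1$ for all $n$. Pressures. $Z_n(\mathcal F)=\sum_{w\in B_n(X)}\sup_{x\in[w]}f_n(x)\in(0,\infty]$ and $P(\mathcal F)=\limsup_{n\to\infty}\frac1n\log Z_n(\mathcal F)\in[-\infty,\infty]$. For a symbol $a$, $Z_n(\mathcal F,a)=\sum_{x:\sigma^nx=x,\ x_1=a}f_n(x)$, and the Gurevich pressure is $P_G(\mathcal F)=\limsup_{n\to\infty}\frac1n\log Z_n(\mathcal F,a)$ when this is independent of $a$ (an equality involving $P_G(\mathcal F)$ includes the assertion that it is independent of $a$). *)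

(* Defs.v *)
From HB Require Import structures.
From mathcomp Require Import all_boot all_order all_algebra.
From mathcomp Require Import all_classical all_reals all_analysis.
Set Implicit Arguments.
Unset Strict Implicit.
Unset Printing Implicit Defensive.
Import Order.TTheory GRing.Theory Num.Theory.
Import numFieldNormedType.Exports.
Local Open Scope classical_set_scope.
Local Open Scope ring_scope.

(* Conventions.  The alphabet {1, 2, ...} is encoded by nat through the
   bijection a |-> a - 1, and the sequence (x_1, x_2, ...) by i |-> x_{i+1}.
   Times are not shifted: [f n] is f_n for n >= 1, and [f 0] is a junk value
   constrained by no hypothesis.  It enters only the terms of index 0 of the
   sequences below, hence no limit. *)

Record transition_matrix := TransitionMatrix {
  tm :> nat -> nat -> bool;
  tm_row : forall i, exists j, tm i j;
  tm_col : forall j, exists i, tm i j }.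

Definition admissible (t : transition_matrix) : set (nat -> nat) :=
  [set x | forall n, t (x n) (x n.+1)].

Definition markov_shift (t : transition_matrix) : Type :=
  set_type (admissible t).

HB.instance Definition _ t :=
  Choice.copy (markov_shift t) (set_type (admissible t)).

(* The library's measurable types are pointed; the absence of zero rows
   provides a point. *)
Definition greedy (t : transition_matrix) (n : nat) : nat :=
  iter n (fun i => xchoose (tm_row t i)) 0%N.

Lemma greedy_admissible t : greedy t \in admissible t.
Proof. by apply/mem_set => n /=; exact: xchooseP. Qed.

HB.instance Definition _ t :=
  isPointed.Build (markov_shift t) (exist _ (greedy t) (greedy_admissible t)).

Definition coord t (x : markov_shift t) : nat -> nat := \val x.
Coercion coord : markov_shift >-> Funclass.

Lemma shift_admissible t (x : markov_shift t) :
  (fun n => x n.+1) \in admissible t.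
Proof. by apply/mem_set => n; exact: (set_mem (valP x)). Qed.

Definition shift t (x : markov_shift t) : markov_shift t :=
  exist _ (fun n => x n.+1) (shift_admissible x).

Definition cylinder t (w : seq nat) : set (markov_shift t) :=
  [set x | mkseq x (size w) = w].

HB.instance Definition _ t :=
  @isSubBaseTopological.Build (markov_shift t) (set (markov_shift t))
    (range (@cylinder t)) id.

Definition borel_shift t := g_sigma_algebraType (@open (markov_shift t)).

(* Words and suprema are taken relative to a subset Y of X, so that the same
   definitions apply to X itself (Y = setT) and to its finite subsystems. *)
Definition words t (Y : set (markov_shift t)) (n : nat) : set (seq nat) :=
  [set w | size w = n /\ cylinder w `&` Y !=set0].

Definition language t (Y : set (markov_shift t)) : set (seq nat) :=
  [set w | words Y (size w) w].

Definition irreducible_shift t : Prop :=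
  forall u v, language [set: markov_shift t] u -> language [set: markov_shift t] v ->
    exists2 w, language [set: markov_shift t] w &
      language [set: markov_shift t] (u ++ w ++ v).

Definition irreducible_mx l (A : 'M[nat]_l) : Prop :=
  forall i j, exists2 n, (0 < n)%N & (0 < (A ^+ n) i j)%N.

Section Sequences.
Context {R : realType} {t : transition_matrix}.
Local Notation X := (markov_shift t).
Implicit Types (f : nat -> X -> R) (Y : set X).

Definition positive_continuous f : Prop :=
  forall n, (0 < n)%N -> continuous (f n) /\ forall x, 0 < f n x.

Definition bowen f : Prop :=
  exists2 M : R, 0 < M & forall n, (0 < n)%N -> forall x y : X,
    (forall i, (i < n)%N -> x i = y i) -> f n x / f n y <= M.

Definition subadditive_up_to_constant f : Prop :=
  exists2 C : R, 0 <= C & forall n m, (0 < n)%N -> (0 < m)%N -> forall x : X,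
    f (n + m)%N x <= expR C * f n x * f m (iter n (@shift t) x).

Definition sup_on Y f n (w : seq nat) : \bar R :=
  ereal_sup [set (f n x)%:E | x in cylinder w `&` Y].

Definition connects Y f (D : R) n m k (u v w : seq nat) : Prop :=
  [/\ words Y k w, language Y (u ++ w ++ v) &
   (D%:E * sup_on Y f n u * sup_on Y f m v
      <= sup_on Y f (n + m + k)%N (u ++ w ++ v))%E].

Definition quasi_multiplicative Y f (p : nat) (D : R) : Prop :=
  forall n m u v, (0 < n)%N -> (0 < m)%N -> words Y n u -> words Y m v ->
    exists2 k, (k <= p)%N & exists w, connects Y f D n m k u v w.

Definition strong_specification f : Prop :=
  exists p : nat, exists D : R, [/\ (0 < p)%N, 0 < D &
    forall n m u v, (0 < n)%N -> (0 < m)%N ->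
      words [set: X] n u -> words [set: X] m v ->
      exists w, connects [set: X] f D n m p u v w].

(* The rearrangement [pi] lists the symbols of X as pi 0, pi 1, ... *)
Definition corner (pi : nat -> nat) (l : nat) : 'M[nat]_l :=
  \matrix_(i < l, j < l) nat_of_bool (t (pi i) (pi j)).

Definition subsystem (pi : nat -> nat) (l : nat) : set X :=
  [set x | forall n, exists2 i, (i < l)%N & x n = pi i].

Definition uniformly_quasi_multiplicative f : Prop :=
  exists pi : nat -> nat, exists l : nat -> nat, exists D1 p1 : R,
    [/\ bijective pi,
        (forall n, 0 < l n)%N /\ {homo l : m n / (m < n)%N},
        0 < D1, 0 < p1 &
        forall n, irreducible_mx (corner pi (l n)) /\
          exists p : nat, exists D : R,
            [/\ (0 < p)%N, D1 <= D, p%:R <= p1 &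
                quasi_multiplicative (subsystem pi (l n)) f p D]].

Local Open Scope ereal_scope.

Definition log_rate (Z : nat -> \bar R) (n : nat) : \bar R :=
  (n%:R^-1)%:E * lne (Z n).

Definition partition_function f n : \bar R :=
  \esum_(w in words [set: X] n) sup_on [set: X] f n w.

Definition pressure f : \bar R := limn_esup (log_rate (partition_function f)).

Definition periodic_partition_function f (a : nat) n : \bar R :=
  \esum_(x in [set x : X | iter n (@shift t) x = x /\ x 0%N = a]) (f n x)%:E.

Definition gurevich_pressure f (a : nat) : \bar R :=
  limn_esup (log_rate (periodic_partition_function f a)).

End Sequences.

Section Entropy.
Context {R : realType} {d : measure_display} {T : measurableType d}.
Local Open Scope ereal_scope.
Implicit Types (mu : probability T R) (S : T -> T).

Definition invariant mu S : Prop :=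
  forall A, measurable A -> mu (S @^-1` A) = mu A.

(* A finite measurable partition is given by its labelling map
   xi : T -> 'I_k; the atoms of its join xi \/ ... \/ S^{-(n-1)} xi are indexed
   by the words w of length n over 'I_k. *)
Definition join_entropy mu S k (xi : T -> 'I_k) n : R :=
  (\sum_(w : {ffun 'I_n -> 'I_k})
    let q := fine (mu [set x | forall i : 'I_n, xi (iter i S x) = w i]) in
    - (q * ln q))%R.

Definition partition_entropy mu S k (xi : T -> 'I_k) : R :=
  limn (fun n => (n%:R^-1 * join_entropy mu S xi n)%R).

Definition entropy mu S : \bar R :=
  ereal_sup [set h | exists k (xi : T -> 'I_k),
    (forall i, measurable (xi @^-1` [set i])) /\
    h = (partition_entropy mu S xi)%:E].

(* The library gives the integral the value -oo when the integrals of both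
   the positive and the negative part are infinite. *)
Definition integral_defined mu (g : T -> \bar R) : Prop :=
  \int[mu]_x g^\+ x < +oo \/ \int[mu]_x g^\- x < +oo.

End Entropy.

Section Variational.
Context {R : realType} {t : transition_matrix}.
Local Notation X := (borel_shift t).
Local Open Scope ereal_scope.
Implicit Types (f : nat -> markov_shift t -> R) (mu : probability X R).

Definition log_fun f n : X -> \bar R := fun x => (ln (f n x))%:E.

Definition mean_log f mu n : \bar R :=
  (n%:R^-1)%:E * \int[mu]_x log_fun f n x.

Definition integrals_defined f mu : Prop :=
  forall n, (0 < n)%N -> integral_defined mu (log_fun f n).

Definition gurevich_eq_pressure f : Prop :=
  forall a, gurevich_pressure f a = pressure f.

(* The first clause is the existence of the limits used in the second one. *)
Definition variational_principle_lim f : Prop :=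
  (forall mu, invariant mu (@shift t) ->
     integrals_defined f mu /\ cvgn (mean_log f mu)) /\
  pressure f = ereal_sup [set h | exists mu : probability X R,
    [/\ invariant mu (@shift t), -oo < limn (mean_log f mu) &
        h = entropy mu (@shift t) + limn (mean_log f mu)]].

(* Only measures for which all the integrals make sense are considered. *)
Definition variational_principle_limsup f : Prop :=
  pressure f = ereal_sup [set h | exists mu : probability X R,
    [/\ invariant mu (@shift t), integrals_defined f mu,
        -oo < limn_esup (mean_log f mu) &
        h = entropy mu (@shift t) + limn_esup (mean_log f mu)]].

End Variational.

(* Main.v *)
Require Import Defs.
From HB Require Import structures.
From mathcomp Require Import all_boot all_order all_algebra.
From mathcomp Require Import all_classical all_reals all_analysis.
From mathcomp Require Import measurable_realfun.
From mathcomp Require Import ring lra.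
From mathcomp Require Import zify.
Set Implicit Arguments.
Unset Strict Implicit.
Unset Printing Implicit Defensive.
Import Order.TTheory GRing.Theory Num.Theory.
Import numFieldNormedType.Exports.
Local Open Scope classical_set_scope.
Local Open Scope ring_scope.

(* Uniform quasi-multiplicativity lets words be glued inside finite alphabets
   exhausting N with constants independent of the alphabet, hence also in X.
   Gluing a word between two copies of a symbol and closing it up compares Z_n
   with boundedly many Z_{n+j}(a), which gives P_G = P; if P is finite, gluing
   also bounds f_1.

   Upper bound: for an invariant mu, Gibbs' inequality on cylinders of length n
   gives H_n + int log f_n <= log Z_n for the partitions by truncated symbols, and
   these partitions generate the Borel sigma-algebra (Kolmogorov-Sinai).

   Lower bound: if c < P, then some finite alphabet already has weights
   Z_N >= k e^{Nc} for arbitrarily large N.  Give the words of length N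
   probabilities proportional to f_N; their window frequencies converge along an
   ultrafilter to consistent shift-invariant weights on words, hence to an invariant
   measure mu.  The entropy of a law on words is at most that of the Markov measure
   with the same window frequencies, so c <= h_mu + lim (1/n) int log f_n d mu up to
   errors that vanish. *)

(** * Limits and growth rates *)

(** The space is not compact and [log f_n] may be unbounded, so neither weak limits of measures nor
    upper semicontinuity of entropy is at hand. The lower bound avoids both by staying in one finite
    alphabet: the limit measure is built from cylinder weights in [0, 1], and the inequality passed
    to the limit involves finitely many of them, with the conditional block entropy H_{j+1} - H_j in
    the role of the entropy of mu. Summation over j then telescopes.

    The Bowen property lets values at chosen points replace suprema over cylinders at the cost of a
    factor [M], which disappears after division by n. Each gluing loses a constant factor and
    inserts up to p symbols. These losses do not accumulate, because a block length is chosen whose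
    total weight exceeds the target by the factor (M / D) (p + 1), and this surplus survives every
    gluing.

    The upper bound rests on a bound for f_1: it makes every integral of log f_n meaningful in [-oo,
    +oo[ and lets Fekete's lemma produce the limits. *)

Section limits.
Context {R : realType}.
Implicit Types (u v : nat -> \bar R) (c l : \bar R).
Local Open Scope ereal_scope.

Lemma lt_limn_esup_frequently u c : c < limn_esup u ->
  forall N, exists2 n, (N <= n)%N & c < u n.
Proof.
move=> cu N; have : c < ereal_sup (u @` [set n | (N <= n)%N]).
  by apply: lt_le_trans cu _; apply: ereal_inf_lbound; exists [set n | (N <= n)%N];
    [exists N|].
by move=> /ereal_sup_gt[_ [n /= Nn <-] cun]; exists n.
Qed.

Lemma le_limn_esup_frequently u c :
  (forall N, exists2 n, (N <= n)%N & c <= u n) -> c <= limn_esup u.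
Proof.
move=> H; apply: le_ereal_inf_tmp => _ [V [N _ NV] <-].
have [n Nn cun] := H N.
by apply: le_trans cun _; apply: ereal_sup_ubound; exists n => //; exact: NV.
Qed.

Lemma le_limn_esup u v N : (forall n, (N <= n)%N -> u n <= v n) ->
  limn_esup u <= limn_esup v.
Proof.
move=> uv; apply: le_ereal_inf_tmp => _ [V [M _ MV] <-].
apply: (@le_trans _ _ (ereal_sup (u @` [set n | (maxn M N <= n)%N]))).
  by apply: ereal_inf_lbound; exists [set n | (maxn M N <= n)%N] => //; exists (maxn M N).
apply: ge_ereal_sup => _ [n /= + <-]; rewrite geq_max => /andP[Mn Nn].
by apply: le_trans (uv _ Nn) _; apply: ereal_sup_ubound; exists n => //; exact: MV.
Qed.

(** Only real thresholds are tested, so that finite and infinite limits are reached by one and the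
    same argument. *)
Lemma cvg_ereal_squeeze u l :
  (forall c : R, l < c%:E -> \forall n \near \oo, u n <= c%:E) ->
  (forall c : R, c%:E < l -> \forall n \near \oo, c%:E <= u n) ->
  u @ \oo --> l.
Proof.
case: l => [l| |] ule lu.
- apply/fine_cvgP; split.
    have le1 := ule (l + 1)%R; rewrite lte_fin ltrDl ltr01 in le1.
    have ge1 := lu (l - 1)%R; rewrite lte_fin gtrBl ltr01 in ge1.
    move: le1 ge1 => /(_ isT) le1 /(_ isT) ge1.
    near=> n; have h1 : u n <= (l + 1)%:E by near: n.
    have h2 : (l - 1)%:E <= u n by near: n.
    by rewrite fin_numElt (lt_le_trans _ h2) ?ltNyr// (le_lt_trans h1) ?ltry.
  apply/cvgrPdist_le => e e0.
  have le1 := ule (l + e)%R; rewrite lte_fin ltrDl e0 in le1.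
  have ge1 := lu (l - e)%R; rewrite lte_fin gtrBl e0 in ge1.
  move: le1 ge1 => /(_ isT) le1 /(_ isT) ge1.
  near=> n; have h1 : u n <= (l + e)%:E by near: n.
  have h2 : (l - e)%:E <= u n by near: n.
  rewrite /=; move: h1 h2; case: (u n) => //= r; rewrite !lee_fin => h1 h2.
  by rewrite ler_norml; apply/andP; split; lra.
- by apply/cvgeyPge => A; apply: lu; rewrite ltry.
- by apply/cvgeNyPle => A; apply: ule; rewrite ltNyr.
Unshelve. all: by end_near. Qed.

End limits.

(** Subadditivity is asked only from [N0] on because a finite pressure leaves room for finitely many
    infinite partition functions. The limit may be -oo. *)
Lemma fekete (R : realType) (u : nat -> R) N0 : (0 < N0)%N ->
  (forall n m, (N0 <= n)%N -> (N0 <= m)%N -> (u (n + m)%N <= u n + u m)) ->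
  exists l : \bar R, ((u n / n%:R)%:E @[n --> \oo] --> l)%E /\
    forall n, (N0 <= n)%N -> (l <= (u n / n%:R)%:E)%E.
Proof.
move=> N00 usub.
pose l := ereal_inf [set (u n / n%:R)%:E | n in [set n | (N0 <= n)%N]].
have lle n : (N0 <= n)%N -> (l <= (u n / n%:R)%:E)%E.
  by move=> Nn; apply: ereal_inf_lbound; exists n.
exists l; split=> //; apply: cvg_ereal_squeeze => c; last first.
  move=> cl; exists N0 => // n /= Nn.
  by apply: le_trans (lle _ Nn); exact: ltW.
move=> /ereal_inf_lt[_ [k /= Nk <-]]; rewrite lte_fin => kc.
have k0 : (0 < k)%N by exact: leq_trans Nk.
pose B := (\sum_(i < N0 + k) `|u i|).
(* Remainders are taken in [N0, N0 + k) rather than [0, k), which keeps every index at which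
   subadditivity is applied above [N0]. *)
have uB q r : (N0 <= r < N0 + k)%N -> (u (q * k + r)%N <= q%:R * u k + B).
  move=> /andP[Nr rk]; elim: q => [|q IH].
    rewrite mul0n add0n mul0r add0r; apply: le_trans (ler_norm _) _.
    by rewrite /B (bigD1 (Ordinal rk))//= lerDl sumr_ge0.
  rewrite mulSn -addnA; apply: le_trans (usub _ _ Nk _) _.
    by rewrite (leq_trans Nr)// leq_addl.
  by rewrite -natr1 mulrDl mul1r; lra.
set c0 := (u k / k%:R) in kc.
have uk : u k = (c0 * k%:R) by rewrite /c0 divfK// pnatr_eq0 -lt0n.
(* The second term pays for replacing the multiple of k below n by n itself; the two differ by less
   than N0 + k. *)
pose B' := (B + (N0 + k)%:R * `|c0|).
have uB' n : (N0 <= n)%N -> (u n <= n%:R * c0 + B').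
  move=> Nn.
  have /(uB ((n - N0) %/ k)%N) : (N0 <= N0 + (n - N0) %% k < N0 + k)%N.
    by rewrite leq_addr ltn_add2l ltn_mod.
  rewrite addnCA -divn_eq subnKC// => /le_trans; apply.
  rewrite uk /B' mulrCA -natrM.
  have e : n%:R = ((n - N0) %/ k * k)%:R + ((n - N0) %% k + N0)%:R :> R.
    by rewrite -natrD addnA -divn_eq subnK.
  rewrite e; set s := (_ + N0)%N; set a := (_ %/ _ * _)%:R.
  have sk : (s%:R <= (N0 + k)%:R :> R).
    by rewrite ler_nat /s addnC leq_add2l ltnW// ltn_mod.
  have h1 : (- (s%:R * c0) <= s%:R * `|c0|).
    by rewrite -mulrN ler_wpM2l// -normrN ler_norm.
  have h2 : (s%:R * `|c0| <= (N0 + k)%:R * `|c0|) by rewrite ler_wpM2r.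
  rewrite mulrDl; lra.
have [n1 n1P] : exists n1 : nat, (B' / (c - c0) < n1%:R).
  by exists (Num.truncn (B' / (c - c0))).+1; exact: truncnS_gt.
exists (maxn N0 n1) => // n /=; rewrite geq_max => /andP[Nn n1n].
have n0 : (0 < n%:R :> R) by rewrite ltr0n (leq_trans N00).
rewrite lee_fin ler_pdivrMr//.
apply: le_trans (uB' _ Nn) _.
have : (B' / (c - c0) < n%:R) by apply: lt_le_trans n1P _; rewrite ler_nat.
rewrite ltr_pdivrMr ?subr_gt0// mulrBr; lra.
Qed.

Section esum_seq.
Context {R : realType}.
Local Open Scope ereal_scope.

Lemma seq_sum_le_esum (U T : choiceType) (s : seq U) (h : U -> T) (S : set T)
    (g : T -> \bar R) : uniq s -> {in s &, injective h} ->
  (forall u, u \in s -> S (h u)) -> (forall x, S x -> 0 <= g x) ->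
  \sum_(u <- s) g (h u) <= \esum_(x in S) g x.
Proof.
move=> us hinj sS g0; apply: esum_ge.
exists [set` map h s]; first split; first exact: finite_seq.
  by move=> x /= /mapP[u us' ->]; exact: sS.
by rewrite -fsbig_seq ?map_inj_in_uniq// big_map.
Qed.

Lemma esum_le_seq (T : choiceType) (S : set T) (g : T -> \bar R) (b : \bar R) :
  (forall s : seq T, uniq s -> (forall x, x \in s -> S x) ->
     \sum_(x <- s) g x <= b) ->
  \esum_(x in S) g x <= b.
Proof.
move=> H; apply: ge_ereal_sup => _ [A [finA AS] <-].
rewrite fsbig_finite//=; apply: H => [|x]; first exact: finmap.fset_uniq.
by rewrite in_fset_set// inE => /AS.
Qed.

Lemma lt_esum_seq (T : choiceType) (S : set T) (g : T -> \bar R) (b : \bar R) :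
  b < \esum_(x in S) g x ->
  exists s : seq T, [/\ uniq s, forall x, x \in s -> S x &
    b < \sum_(x <- s) g x].
Proof.
move=> /ereal_sup_gt[_ [A [finA AS] <-]]; rewrite fsbig_finite//= => bA.
exists (finmap.enum_fset (fset_set A)); split; [exact: finmap.fset_uniq|move=> x|by []].
by rewrite in_fset_set// inE => /AS.
Qed.

End esum_seq.

Section log_rate.
Context {R : realType}.
Implicit Types (Z : nat -> \bar R) (c : R).
Local Open Scope ereal_scope.

(** Lower bounds on rates become multiplicative bounds. This covers infinite and nonpositive values
    too, since [lne] sends the latter to -oo. *)
Lemma le_log_rate Z n c : (0 < n)%N ->
  (c%:E <= log_rate Z n) = ((expR (n%:R * c))%:E <= Z n).
Proof.
move=> n0; rewrite /log_rate.
have n0' : (0 < n%:R :> R)%R by rewrite ltr0n.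
have -> : (c%:E <= (n%:R^-1)%:E * lne (Z n)) = ((n%:R * c)%:E <= lne (Z n)).
  by rewrite muleC lee_pdivlMr// -EFinM mulrC.
case: (Z n) => [z| |] /=; rewrite ?leey//.
- case: ifPn => [z0|]; last rewrite -ltNge => z0.
    rewrite leNgt ltNyr/= lee_fin; apply/esym/negbTE.
    by rewrite -ltNge (le_lt_trans z0)// expR_gt0.
  by rewrite !lee_fin -ler_expR lnK.
Qed.

Lemma log_rate_homo Z1 Z2 n : Z1 n <= Z2 n -> log_rate Z1 n <= log_rate Z2 n.
Proof.
move=> Z12; rewrite /log_rate; apply: lee_wpmul2l; first by rewrite lee_fin invr_ge0.
move: Z12; case: (Z1 n) => [a| |]; case: (Z2 n) => [b| |] //=; rewrite ?leNye ?leey//.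
- rewrite lee_fin => ab; case: ifPn => [|]; first by rewrite leNye.
  rewrite -ltNge => a0; have b0 := lt_le_trans a0 ab.
  by rewrite (leNgt b 0%R) b0/= lee_fin ler_ln.
Qed.

End log_rate.

(** * Gluing of words and the Gurevich pressure *)

Section points.
Context {t : transition_matrix}.
Local Notation X := (markov_shift t).
Implicit Types (x y z : X) (Y : set X).

Definition mkpoint (g : nat -> nat) (h : forall n, t (g n) (g n.+1)) : X :=
  exist _ g (mem_set (h : admissible t g)).
Arguments mkpoint : clear implicits.

Lemma mkpointE g h n : mkpoint g h n = g n :> nat. Proof. by []. Qed.

Lemma admissibleP x n : t (x n) (x n.+1).
Proof. exact: (set_mem (valP x)). Qed.

Lemma coord_inj x y : x =1 y -> x = y.
Proof. by move=> xy; apply: val_inj; apply/funext. Qed.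

Lemma coord_shift x i : Defs.shift x i = x i.+1.
Proof. by []. Qed.

Lemma coord_iter_shift n x i : iter n (@Defs.shift t) x i = x (n + i)%N.
Proof.
elim: n i => [|n IH] i; first by [].
by rewrite iterS coord_shift IH addnS.
Qed.

Definition agree n x y := forall i, (i < n)%N -> x i = y i.

Lemma agree_sym n x y : agree n x y -> agree n y x.
Proof. by move=> h i /h. Qed.

Lemma agree_trans n x y z : agree n x y -> agree n y z -> agree n x z.
Proof. by move=> xy yz i ni; rewrite xy// yz. Qed.

Lemma agree_le m n x y : (m <= n)%N -> agree n x y -> agree m x y.
Proof. by move=> mn h i im; apply: h; exact: leq_trans mn. Qed.

Lemma eq_mkseqP n x y : mkseq x n = mkseq y n <-> agree n x y.
Proof.
split=> [e i ni|h]; first by rewrite -(nth_mkseq 0%N x ni) e nth_mkseq.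
by apply: (@eq_from_nth _ 0%N); rewrite !size_mkseq// => i ni; rewrite !nth_mkseq// h.
Qed.

Lemma cylinder_mkseq n x : cylinder (mkseq x n) x.
Proof. by rewrite /cylinder/= size_mkseq. Qed.

Lemma cylinderE n x y : cylinder (mkseq x n) y <-> agree n y x.
Proof. by rewrite /cylinder/= size_mkseq eq_mkseqP. Qed.

Lemma wordsP Y n w : words Y n w <-> exists2 x, Y x & w = mkseq x n.
Proof.
split=> [[<- [x [xw Yx]]]|[x Yx ->]]; first by exists x => //; rewrite xw.
by split; rewrite ?size_mkseq//; exists x; split=> //; exact: cylinder_mkseq.
Qed.

Lemma exists_point_from a : exists x, x 0%N = a.
Proof.
pose g n := iter n (fun i => xchoose (tm_row t i)) a.
have h n : t (g n) (g n.+1) by exact: xchooseP.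
by exists (mkpoint g h).
Qed.

Definition over (A : seq nat) : set X := [set x | forall n, x n \in A].

(** A word allowable in X with symbols in [A] need not continue inside [A] as it does in X.
    Following it by chosen successors within [A] makes it a word of the finite subsystem. *)
Lemma over_extend (A : seq nat) n x : (0 < n)%N ->
  (forall a, a \in A -> exists2 b, b \in A & t a b) ->
  (forall i, (i < n)%N -> x i \in A) -> exists2 y, over A y & agree n y x.
Proof.
move=> n0 succA xA.
have /choice[s sP] : forall a, exists b, a \in A -> (b \in A) /\ t a b.
  move=> a; case: (boolP (a \in A)) => [/succA[b bA tab]|]; first by exists b.
  by exists 0%N.
(* The exponent is 0 for i < n, where g copies x; afterwards the successor map is iterated from the
   last copied symbol. *)
pose g i := iter (i.+1 - n) s (x (minn i n.-1)).
have gA i : g i \in A.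
  rewrite /g; elim: (i.+1 - n)%N => [|k IH] /=; last by case: (sP _ IH).
  by apply: xA; rewrite gtn_min prednK// leqnn orbT.
have gt i : t (g i) (g i.+1).
  rewrite /g; have [lt|le] := ltnP i.+1 n.
    have -> : (i.+1 - n = 0)%N by lia.
    have -> : (i.+2 - n = 0)%N by lia.
    have -> : minn i n.-1 = i by lia.
    have -> : minn i.+1 n.-1 = i.+1 by lia.
    exact: admissibleP.
  have e : (i.+2 - n = (i.+1 - n).+1)%N by lia.
  have e1 : minn i n.-1 = n.-1 by lia.
  have e2 : minn i.+1 n.-1 = n.-1 by lia.
  move: (gA i); rewrite /g e e1 e2 /= => gi; by case: (sP _ gi).
exists (mkpoint g gt) => [i|i ni]; rewrite mkpointE//.
rewrite /g; have -> : (i.+1 - n = 0)%N by lia.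
by have -> : minn i n.-1 = i by lia.
Qed.

End points.
Arguments mkpoint {t} g h.

Section gluing.
Context {R : realType} {t : transition_matrix}.
Local Notation X := (markov_shift t).
Implicit Types (f : nat -> X -> R) (x y z : X) (Y : set X).

Definition positive_seq f := forall n x, (0 < n)%N -> 0 < f n x.

Definition distortion f (M : R) := forall n x y, (0 < n)%N -> agree n x y ->
  f n x <= M * f n y.

Definition submultiplicative f (C : R) := forall n m x, (0 < n)%N -> (0 < m)%N ->
  f (n + m)%N x <= C * f n x * f m (iter n (@Defs.shift t) x).

(* Quasi-multiplicativity expressed with points instead of suprema over
   cylinders; [K] lists the allowed lengths of the connecting word. *)
Definition gluing Y f (K : seq nat) (D : R) := forall n m x y,
  (0 < n)%N -> (0 < m)%N -> Y x -> Y y -> exists2 k, k \in K &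
  exists z, [/\ Y z, agree n z x, agree m (iter (n + k) (@Defs.shift t) z) y &
    D * f n x * f m y <= f (n + m + k)%N z].

Lemma bowen_distortion f : positive_seq f -> bowen f ->
  exists2 M, 1 <= M & distortion f M.
Proof.
move=> fp [M M0 fM].
have fM' : distortion f M.
  by move=> n x y n0 xy; rewrite -ler_pdivrMr; [exact: fM|exact: fp].
exists M => //.
(* Comparing a point with itself forces M >= 1, which later gives ln M >= 0. *)
have x := point : X.
have := fM' 1%N x x isT (fun _ _ => erefl).
by rewrite -{1}[f _ _]mul1r ler_pM2r//; exact: fp.
Qed.

Lemma le_sup_on Y f n x : Y x -> ((f n x)%:E <= sup_on Y f n (mkseq x n))%E.
Proof.
by move=> Yx; apply: ereal_sup_ubound; exists x => //; split=> //; exact: cylinder_mkseq.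
Qed.

(** With [le_sup_on], this exchanges a supremum over a cylinder for the value at a point of it, up
    to the factor [M]; here the point may lie outside [Y]. *)
Lemma sup_on_le Y f M n x : distortion f M -> (0 < n)%N ->
  (sup_on Y f n (mkseq x n) <= (M * f n x)%:E)%E.
Proof.
move=> fM n0; apply: ge_ereal_sup => _ [y [/cylinderE yx _] <-].
by rewrite lee_fin fM.
Qed.

(** The constant is divided by [M] only once: the suprema over u and v already dominate the values
    at x and y, and only the supremum over the glued word has to be replaced by a value. *)
Lemma connects_gluing Y f M D n m k w x y : positive_seq f -> 1 <= M ->
  distortion f M -> 0 < D -> (0 < n)%N -> (0 < m)%N -> Y x -> Y y ->
  connects Y f D n m k (mkseq x n) (mkseq y m) w ->
  exists z, [/\ Y z, agree n z x, agree m (iter (n + k) (@Defs.shift t) z) y &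
    D / M * f n x * f m y <= f (n + m + k)%N z].
Proof.
move=> fp M1 fM D0 n0 m0 Yx Yy [[sw _] [_ [z [zw Yz]]] le].
have sz : size (mkseq x n ++ w ++ mkseq y m) = (n + m + k)%N.
  by rewrite !size_cat !size_mkseq sw; lia.
move: zw; rewrite /cylinder/= sz => zw.
exists z; split=> //.
- move=> i ni; rewrite -(nth_mkseq 0%N z (_ : i < n + m + k)%N); last by lia.
  by rewrite zw nth_cat size_mkseq ni nth_mkseq.
- move=> i mi; rewrite coord_iter_shift.
  rewrite -(nth_mkseq 0%N z (_ : n + k + i < n + m + k)%N); last by lia.
  rewrite zw nth_cat size_mkseq ifF; last by apply/negbTE; rewrite -leqNgt; lia.
  rewrite nth_cat sw ifF; last by apply/negbTE; rewrite -leqNgt; lia.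
  by rewrite nth_mkseq; [congr (y _)|]; lia.
- have M0 : 0 < M by apply: lt_le_trans M1.
  rewrite -zw in le.
  have := le_trans le (sup_on_le Y z fM _); rewrite !addn_gt0 n0 => /(_ isT) le1.
  have [fx0 fy0] : 0 < f n x /\ 0 < f m y by split; exact: fp.
  have : ((D * f n x * f m y)%:E <= (M * f (n + m + k)%N z)%:E)%E.
    apply: le_trans le1; rewrite !EFinM; apply: lee_pmul.
    - by rewrite -EFinM lee_fin mulr_ge0// ltW.
    - by rewrite lee_fin ltW.
    - by apply: lee_pmul; [rewrite lee_fin ltW|rewrite lee_fin ltW|
        |exact: le_sup_on].
    - exact: le_sup_on.
  rewrite lee_fin -ler_pdivrMl// => h; apply: le_trans h.
  by rewrite !mulrA [D / M]mulrC.
Qed.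

(** A zero row of the matrix would stay zero in each of its positive powers, contradicting the
    positive diagonal entry that irreducibility provides. *)
Lemma irreducible_mx_successor pi l : irreducible_mx (corner (t := t) pi l) ->
  forall a, a \in map pi (iota 0 l) -> exists2 b, b \in map pi (iota 0 l) & t a b.
Proof.
move=> irr _ /mapP[i + ->]; rewrite mem_iota add0n => /andP[_ il].
have [n n0] := irr (Ordinal il) (Ordinal il).
case: n n0 => // n _; rewrite exprS mxE => pos.
have [/existsP[k tk]|/existsPn tN] := boolP [exists k : 'I_l, t (pi i) (pi k)].
  exists (pi k) => //; apply/mapP; exists (k : nat) => //.
  by rewrite mem_iota add0n ltn_ord.
move: pos; rewrite big1// => k _.
by rewrite mxE /= (negbTE (tN k)) mul0r.
Qed.

Lemma subsystemE pi l : subsystem (t := t) pi l = over (map pi (iota 0 l)).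
Proof.
apply/seteqP; split=> x h n.
  have [i il ->] := h n; apply/mapP; exists i => //.
  by rewrite mem_iota add0n il.
have /mapP[i + ->] := h n; rewrite mem_iota add0n => /andP[_ il].
by exists i.
Qed.

(** The uniform bounds D_{l_n} >= D1 and p_{l_n} <= p1 make [p] and [D] independent of the finite
    set [s] that the alphabet has to contain. *)
Lemma uniform_gluing f M : positive_seq f -> 1 <= M -> distortion f M ->
  uniformly_quasi_multiplicative f ->
  exists p, exists2 D, 0 < D & forall s : seq nat, exists A,
    [/\ uniq A, {subset s <= A},
        forall a, a \in A -> exists2 b, b \in A & t a b &
        gluing (over A) f (iota 0 p.+1) D].
Proof.
move=> fp M1 fM [pi [l [D1 [p1 [pibij [l0 lmono] D10 p10 H]]]]].
have M0 : 0 < M by apply: lt_le_trans M1.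
exists (Num.truncn p1); exists (D1 / M); first by rewrite divr_gt0.
move=> s.
have [pi' piK pi'K] := pibij.
have lge n : (n <= l n)%N.
  by elim: n => // n IH; apply: leq_ltn_trans (lmono _ _ (ltnSn n)).
(* N exceeds the position of each symbol of s in the rearrangement, and l N >= N because l is
   strictly increasing. *)
pose N := (\max_(a <- s) pi' a).+1.
exists (map pi (iota 0 (l N))); split.
- by rewrite map_inj_uniq ?iota_uniq//; exact: can_inj piK.
- move=> a sa; apply/mapP; exists (pi' a); rewrite ?pi'K//.
  rewrite mem_iota add0n /=; apply: leq_trans (lge N).
  by rewrite ltnS; exact: leq_bigmax_seq.
- by have [/irreducible_mx_successor] := H N.
rewrite -subsystemE.
have [_ [p [D [p0 DD pp1 qm]]]] := H N.
have D0 : 0 < D by exact: lt_le_trans DD.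
move=> n m x y n0 m0 Yx Yy.
have [||k kp [w wc]] := qm n m (mkseq x n) (mkseq y m) n0 m0.
- by apply/wordsP; exists x.
- by apply/wordsP; exists y.
exists k.
  rewrite mem_iota add0n ltnS; apply: leq_trans kp _.
  by rewrite truncn_ge_nat// ltW.
have [z [Yz zx zy le]] := connects_gluing fp M1 fM D0 n0 m0 Yx Yy wc.
exists z; split=> //; apply: le_trans le.
by rewrite -!mulrA ler_pM2r ?ler_pM2r ?invr_gt0// !mulr_gt0 ?invr_gt0// fp.
Qed.

(** Two words involve finitely many symbols, so they are glued in an alphabet containing them. The
    factor M^2 pays for replacing x and y by points of that subsystem with the same initial
    words. *)
Lemma gluing_over_full f M p D : positive_seq f -> 1 <= M -> distortion f M ->
  0 < D ->
  (forall s : seq nat, exists A, [/\ uniq A, {subset s <= A},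
        forall a, a \in A -> exists2 b, b \in A & t a b &
        gluing (over A) f (iota 0 p.+1) D]) ->
  gluing setT f (iota 0 p.+1) (D / M ^+ 2).
Proof.
move=> fp M1 fM D0 H n m x y n0 m0 _ _.
have M0 : 0 < M by apply: lt_le_trans M1.
have [A [_ sA succA gA]] := H (mkseq x n ++ mkseq y m).
have [|x' Ax' xx'] := @over_extend _ A n x n0 succA.
  by move=> i ni; apply: sA; rewrite mem_cat; apply/orP; left; apply/mapP; exists i;
    rewrite ?mem_iota.
have [|y' Ay' yy'] := @over_extend _ A m y m0 succA.
  by move=> i ni; apply: sA; rewrite mem_cat; apply/orP; right; apply/mapP; exists i;
    rewrite ?mem_iota.
have [k kp [z [_ zx zy le]]] := gA n m x' y' n0 m0 Ax' Ay'.
exists k => //; exists z; split=> //.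
- exact: agree_trans zx xx'.
- exact: agree_trans zy yy'.
apply: le_trans le.
have h1 := fM _ _ _ n0 (agree_sym xx'); have h2 := fM _ _ _ m0 (agree_sym yy').
have := ler_pM (ltW (fp _ x n0)) (ltW (fp _ y m0)) h1 h2.
rewrite -!mulrA ler_pM2l// ler_pdivrMl ?exprn_gt0// => /le_trans; apply.
by rewrite expr2 mulrACA -!mulrA.
Qed.

End gluing.

(** * Growth rates under bounded shifts of the index *)

Section growth_rates.
Context {R : realType}.
Implicit Types (Z W : nat -> \bar R).

Lemma ereal_between (a b : \bar R) : (a < b)%E ->
  exists r : R, (a < r%:E)%E /\ (r%:E < b)%E.
Proof.
case: a => [a| |]; case: b => [b| |] //.
- by rewrite lte_fin => ab; exists ((a + b) / 2); rewrite !lte_fin; split; lra.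
- by move=> _; exists (a + 1); rewrite lte_fin ltry; split=> //; lra.
- by move=> _; exists (b - 1); rewrite lte_fin ltNyr; split=> //; lra.
- by move=> _; exists 0; rewrite ltNyr ltry.
Qed.

Lemma exists_nat_ge (B : R) : exists n0, forall n, (n0 <= n)%N -> B <= n%:R.
Proof.
exists (Num.truncn B).+1 => n h; apply: le_trans (ltW (truncnS_gt B)) _.
by rewrite ler_nat.
Qed.

Lemma cvg_div_natr (c : R) : c / n%:R @[n --> \oo] --> 0.
Proof.
apply/cvgrPdist_le => e e0; have [N NP] := exists_nat_ge (`|c| / e).
exists N.+1 => // n /= Nn; rewrite sub0r normrN normrM normfV normr_nat.
have n0 : 0 < n%:R :> R by rewrite ltr0n; lia.
by rewrite ler_pdivrMr// mulrC -ler_pdivrMr// NP// ltnW.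
Qed.

(** Multiplicative constants and the lengths of connecting words are paid for by an arbitrarily
    small gap between two rates. *)
Lemma expR_rate_gap (c r r' : R) q : 0 < c -> r < r' -> exists n0,
  forall n j, (n0 <= n)%N -> (j <= q)%N ->
  c * expR ((n + j)%:R * r) <= expR (n%:R * r').
Proof.
move=> c0 rr; have [n0 n0P] := exists_nat_ge ((`|ln c| + q%:R * `|r|) / (r' - r)).
exists n0 => n j /n0P; rewrite ler_pdivrMr ?subr_gt0// mulrBr => h jq.
rewrite -{1}(@lnK _ c)// -expRD ler_expR natrD mulrDl.
have h1 := ler_norm (ln c); have h2 : j%:R * r <= q%:R * `|r|.
  apply: le_trans (_ : j%:R * `|r| <= _); first by rewrite ler_wpM2l// ler_norm.
  by rewrite ler_wpM2r// ler_nat.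
lra.
Qed.

Lemma limn_esup_lt_eventually (u : nat -> \bar R) c : (limn_esup u < c)%E ->
  exists N, forall n, (N <= n)%N -> (u n < c)%E.
Proof.
move=> /ereal_inf_lt[_ [V [N _ NV] <-]] Vc; exists N => n Nn.
by apply: le_lt_trans Vc; apply: ereal_sup_ubound; exists n => //; exact: NV.
Qed.

Local Open Scope ereal_scope.

(** The factor (size J) + 1 in place of size J makes the contradiction strict, even when J is
    empty. *)
Lemma sum_shift_pigeonhole W (J : seq nat) (c : R) (n : nat) (b : R) (a : \bar R) :
  (0 < c)%R -> (0 < b)%R ->
  a <= c%:E * \sum_(j <- J) W (n + j)%N -> (c * (size J).+1%:R * b)%:E <= a ->
  exists2 j, j \in J & b%:E <= W (n + j)%N.
Proof.
move=> c0 b0 aW ba; apply/not_exists2P => H.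
have WJ : \sum_(j <- J) W (n + j)%N <= ((size J)%:R * b)%:E.
  have -> : ((size J)%:R * b)%R = (\sum_(j <- J) b)%R.
    by rewrite big_const_seq count_predT iter_addr_0 mulr_natl.
  rewrite -sumEFin big_seq [leRHS]big_seq; apply: lee_sum => j jJ.
  by have [|/negP] := H j; rewrite // -ltNge => /ltW.
have := le_trans ba (le_trans aW (lee_wpmul2l _ WJ)).
rewrite lee_fin ltW// -EFinM lee_fin => /(_ isT).
by rewrite -mulrA ler_pM2l// ler_pM2r// ler_nat ltnn.
Qed.

(** At each of the infinitely many times n where Z is large, some W (n + j) is large by pigeonhole.
    The good j varies with n, so that only an inequality between upper limits results. *)
Lemma le_limn_esup_log_rate_shift Z W (J : seq nat) (c : R) (N0 : nat) :
  (0 < c)%R ->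
  (forall n, (N0 <= n)%N -> Z n <= c%:E * \sum_(j <- J) W (n + j)%N) ->
  limn_esup (log_rate Z) <= limn_esup (log_rate W).
Proof.
move=> c0 ZW; rewrite leNgt; apply/negP => /ereal_between[r [Wr rZ]].
have [r' [rr' r'Z]] := ereal_between rZ; rewrite lte_fin in rr'.
suff : r%:E <= limn_esup (log_rate W) by rewrite leNgt Wr.
apply: le_limn_esup_frequently => N.
pose q := \max_(j <- J) j.
have c1 : (0 < c * (size J).+1%:R)%R by rewrite mulr_gt0.
have [n0 n0P] := expR_rate_gap q c1 rr'.
have [n nge r'Zn] := lt_limn_esup_frequently r'Z (N + N0 + n0).+1.
have [j jJ h] : exists2 j, j \in J &
    (expR (n%:R * r') / (c * (size J).+1%:R))%:E <= W (n + j)%N.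
  apply: (@sum_shift_pigeonhole W J c n _ (Z n)) => //.
  - by rewrite divr_gt0// expR_gt0.
  - by apply: ZW; lia.
  - rewrite mulrC divfK ?gt_eqF// -le_log_rate; [exact: ltW|lia].
exists (n + j)%N; first by lia.
rewrite le_log_rate; last by lia.
apply: le_trans h; rewrite lee_fin ler_pdivlMr// mulrC.
by apply: n0P; [lia|exact: leq_bigmax_seq].
Qed.

(** With a single shift j every large n has the form k + j, so that the lower bound reaches all
    large times and convergence is inherited. *)
Lemma cvg_log_rate_shift Z W (j : nat) (c : R) (l : \bar R) (N0 : nat) :
  (0 < c)%R ->
  (forall n, (N0 <= n)%N -> Z n <= c%:E * W (n + j)%N) ->
  (forall n, (0 < n)%N -> W n <= Z n) ->
  log_rate Z @ \oo --> l -> log_rate W @ \oo --> l.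
Proof.
move=> c0 ZW WZ Zl.
have [lmin lmax] := cvg_limn_einf_sup Zl.
apply: cvg_ereal_squeeze => r.
  rewrite -lmax => /limn_esup_lt_eventually[N NP].
  exists N.+1 => // n /= Nn; apply: le_trans (ltW (NP n (ltnW Nn))).
  by apply: log_rate_homo; apply: WZ; lia.
move=> /ereal_between[r' [rr']]; rewrite -lmin => r'Z; rewrite lte_fin in rr'.
have [n0 n0P] := expR_rate_gap j c0 rr'.
(* The lower limit is minus the upper limit of the opposite sequence. *)
have [N NP] : exists N, forall n, (N <= n)%N -> r'%:E < log_rate Z n.
  have : limn_esup (fun n => - log_rate Z n) < - r'%:E by rewrite lteNr.
  move=> /limn_esup_lt_eventually[N NP]; exists N => n /NP.
  by rewrite lteN2.
exists (N + N0 + n0 + j).+1 => // n /= nge.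
have [k kE] : exists k, n = (k + j)%N by exists (n - j)%N; lia.
rewrite le_log_rate; last by lia.
have : (expR (k%:R * r'))%:E <= c%:E * W n.
  apply: (@le_trans _ _ (Z k)); last by rewrite kE; apply: ZW; lia.
  rewrite -le_log_rate; [apply: ltW; apply: NP|]; lia.
have h : (c * expR (n%:R * r) <= expR (k%:R * r'))%R by rewrite kE; apply: n0P; lia.
rewrite -lee_pdivrMl//; apply: le_trans.
by rewrite -EFinM lee_fin ler_pdivlMl.
Qed.

End growth_rates.

Lemma ler_sum_uniq_subset (R : realDomainType) (T : eqType) (s r : seq T) (g : T -> R) :
  uniq s -> uniq r -> {subset s <= r} -> (forall x, 0 <= g x) ->
  \sum_(x <- s) g x <= \sum_(x <- r) g x.
Proof.
move=> us ur sr g0; rewrite [leRHS](bigID (mem s))/= -[leLHS]addr0.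
apply: lerD; last by apply: sumr_ge0.
rewrite -[leRHS]big_filter le_eqVlt; apply/orP; left; apply/eqP/perm_big.
apply: uniq_perm; rewrite ?filter_uniq// => x; rewrite mem_filter /=.
by case: (boolP (x \in s)) => // /sr ->.
Qed.

(** Cutting after n letters maps distinct words to distinct pairs, so the left side is a part of the
    expanded product. *)
Lemma sum_take_drop_le (R : realDomainType) (T : eqType) (s : seq (seq T)) n
    (a b : seq T -> R) : uniq s -> (forall x, 0 <= a x) -> (forall x, 0 <= b x) ->
  \sum_(w <- s) a (take n w) * b (drop n w) <=
  (\sum_(u <- undup (map (take n) s)) a u) * (\sum_(v <- undup (map (drop n) s)) b v).
Proof.
move=> us a0 b0; rewrite big_distrl/=.
under [leRHS]eq_bigr do rewrite big_distrr/=.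
have -> : \sum_(u <- undup (map (take n) s)) \sum_(v <- undup (map (drop n) s)) a u * b v =
    \sum_(p <- [seq (u, v) | u <- undup (map (take n) s), v <- undup (map (drop n) s)])
      a p.1 * b p.2 by rewrite big_allpairs.
rewrite -(big_map (fun w => (take n w, drop n w)) predT
  (fun p : seq T * seq T => a p.1 * b p.2)).
apply: ler_sum_uniq_subset; last by move=> p; rewrite mulr_ge0.
- rewrite map_inj_uniq// => u v [e1 e2].
  by rewrite -(cat_take_drop n u) e1 e2 cat_take_drop.
- by apply: allpairs_uniq; rewrite ?undup_uniq// => -[? ?] [? ?].
- move=> _ /mapP[w ws ->]; apply: allpairs_f; rewrite mem_undup; exact: map_f.
Qed.

(** * The partition function *)

Section partition.
Context {R : realType} {t : transition_matrix}.
Local Notation X := (markov_shift t).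
Implicit Types (x y z : X).
Variables (f : nat -> X -> R) (M C : R).
Hypotheses (fp : positive_seq f) (M1 : 1 <= M) (fM : distortion f M)
  (C0 : 0 < C) (fC : submultiplicative f C).

Let M0 : 0 < M. Proof. exact: lt_le_trans M1. Qed.

(** One chosen point per nonempty cylinder: up to the factor [M], Z_n is the sum of f_n over these
    points. *)
Definition point_in (w : seq nat) : X := xget point (cylinder w).

Lemma point_inK n w : words [set: X] n w -> mkseq (point_in w) n = w.
Proof.
case=> <- [x [xw _]]; rewrite /point_in; case: xgetP => [y _ //|].
by move=> /(_ x).
Qed.

Lemma agree_point_in n x : agree n (point_in (mkseq x n)) x.
Proof. by apply/eq_mkseqP; rewrite point_inK//; apply/wordsP; exists x. Qed.

Lemma sup_on_point_in n w : (0 < n)%N -> words [set: X] n w ->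
  (sup_on [set: X] f n w <= (M * f n (point_in w))%:E)%E.
Proof. by move=> n0 wW; rewrite -{1}(point_inK wW); exact: sup_on_le. Qed.

Lemma sum_le_partition (U : choiceType) (s : seq U) (h : U -> X) n : (0 < n)%N ->
  uniq s -> {in s &, injective (fun u => mkseq (h u) n)} ->
  ((\sum_(u <- s) f n (h u))%:E <= partition_function f n)%E.
Proof.
move=> n0 us hinj; rewrite -sumEFin.
apply: (@le_trans _ _ (\sum_(u <- s) sup_on [set: X] f n (mkseq (h u) n))%E).
  by apply: lee_sum => u _; exact: le_sup_on.
apply: seq_sum_le_esum => //; first by move=> u _; apply/wordsP; exists (h u).
move=> _ /wordsP[x _ ->]; apply: le_trans (le_sup_on f n _) => //.
by rewrite lee_fin ltW// fp.
Qed.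

Lemma sum_point_in_le_partition (s : seq (seq nat)) n : (0 < n)%N -> uniq s ->
  (forall w, w \in s -> words [set: X] n w) ->
  ((\sum_(w <- s) f n (point_in w))%:E <= partition_function f n)%E.
Proof.
move=> n0 us sW; apply: sum_le_partition => // u v /sW uW /sW vW.
by rewrite (point_inK uW) (point_inK vW).
Qed.

Lemma partition_le_sum n b : (0 < n)%N ->
  (forall s : seq (seq nat), uniq s -> (forall w, w \in s -> words [set: X] n w) ->
     ((M * \sum_(w <- s) f n (point_in w))%:E <= b)%E) ->
  (partition_function f n <= b)%E.
Proof.
move=> n0 H; apply: esum_le_seq => s us sW; apply: le_trans (H s us sW).
rewrite big_distrr/= -sumEFin big_seq [leRHS]big_seq; apply: lee_sum => w ws.
exact: sup_on_point_in (sW _ ws).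
Qed.

Lemma partition_gt0 n : (0 < n)%N -> (0 < partition_function f n)%E.
Proof.
move=> n0; have x := point : X.
apply: lt_le_trans (@sum_le_partition nat [:: 0%N] (fun=> x) n n0 isT _).
  by rewrite big_seq1 lte_fin fp.
by move=> u v; rewrite !inE => /eqP -> /eqP ->.
Qed.

(** One factor [M] comes from replacing suprema by values, two more from moving to the chosen points
    of the prefix and of the suffix, and [C] from subadditivity. *)
Lemma submultiplicative_partition n m : (0 < n)%N -> (0 < m)%N ->
  (partition_function f (n + m)%N <=
   (M ^+ 3 * C)%:E * (partition_function f n * partition_function f m))%E.
Proof.
move=> n0 m0; apply: partition_le_sum => [|s us sW]; first by rewrite addn_gt0 n0.
have tdW w : w \in s -> words [set: X] n (take n w) /\ words [set: X] m (drop n w).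
  move=> /sW/wordsP[x _ ->]; split; apply/wordsP.
    exists x => //; rewrite -map_take take_iota.
    by have -> : minn n (n + m) = n by lia.
  exists (iter n (@Defs.shift t) x) => //.
  rewrite -map_drop drop_iota addKn add0n.
  apply: (@eq_from_nth _ 0%N); rewrite !size_map !size_iota// => i im.
  by rewrite !(nth_map 0%N) ?size_iota// !nth_iota// coord_iter_shift.
have F0 k w : (0 < k)%N -> 0 <= f k (point_in w) by move=> k0; rewrite ltW// fp.
have le1 w : w \in s -> f (n + m)%N (point_in w) <=
    (C * M ^+ 2) * (f n (point_in (take n w)) * f m (point_in (drop n w))).
  move=> ws; have [tW dW] := tdW _ ws; set x := point_in w.
  have xw : mkseq x (n + m) = w by exact: point_inK (sW _ ws).
  apply: le_trans (fC _ n0 m0) _; rewrite -!mulrA ler_pM2l//.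
  have h1 : f n x <= M * f n (point_in (take n w)).
    apply: fM => //; apply/eq_mkseqP; rewrite (point_inK tW) -xw -map_take take_iota.
    by have -> : minn n (n + m) = n by lia.
  have h2 : f m (iter n (@Defs.shift t) x) <= M * f m (point_in (drop n w)).
    apply: fM => //; apply/eq_mkseqP; rewrite (point_inK dW) -xw.
    rewrite -map_drop drop_iota addKn add0n.
    apply: (@eq_from_nth _ 0%N); rewrite !size_map !size_iota// => i im.
    by rewrite !(nth_map 0%N) ?size_iota// !nth_iota// coord_iter_shift.
  have := ler_pM (ltW (fp x n0)) (ltW (fp (iter n (@Defs.shift t) x) m0)) h1 h2.
  by move=> /le_trans; apply; rewrite mulrACA -!mulrA.
pose a := \sum_(u <- undup (map (take n) s)) f n (point_in u).
pose b := \sum_(v <- undup (map (drop n) s)) f m (point_in v).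
have ale : (a%:E <= partition_function f n)%E.
  apply: sum_point_in_le_partition; rewrite ?undup_uniq// => w.
  by rewrite mem_undup => /mapP[v /tdW[vW _] ->].
have ble : (b%:E <= partition_function f m)%E.
  apply: sum_point_in_le_partition; rewrite ?undup_uniq// => w.
  by rewrite mem_undup => /mapP[v /tdW[_ vW] ->].
have a0 : 0 <= a by apply: sumr_ge0 => *; exact: F0.
have b0 : 0 <= b by apply: sumr_ge0 => *; exact: F0.
apply: (@le_trans _ _ ((M ^+ 3 * C)%:E * (a%:E * b%:E))%E); last first.
  apply: lee_wpmul2l; first by rewrite lee_fin mulr_ge0 ?exprn_ge0// ltW.
  by apply: lee_pmul; rewrite ?lee_fin.
rewrite -!EFinM lee_fin.
have -> : M ^+ 3 * C * (a * b) = M * (C * M ^+ 2 * (a * b)) by ring.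
rewrite ler_pM2l//.
apply: (@le_trans _ _ (\sum_(w <- s) (C * M ^+ 2) *
    (f n (point_in (take n w)) * f m (point_in (drop n w))))).
  by rewrite big_seq [leRHS]big_seq; apply: ler_sum => w /le1.
rewrite -big_distrr/=.
apply: ler_wpM2l; first by rewrite mulr_ge0 ?exprn_ge0// ltW.
exact: (@sum_take_drop_le _ _ s n (fun u => f n (point_in u)) (fun v => f m (point_in v)) us
  (fun u => F0 n u n0) (fun u => F0 m u m0)).
Qed.

(** An infinite Z_n gives an infinite rate, which a finite upper limit excludes for large n only. *)
Lemma finite_partition_function : (pressure f < +oo)%E ->
  exists2 N, (0 < N)%N & forall n, (N <= n)%N -> (partition_function f n < +oo)%E.
Proof.
move=> /ereal_between[c [/limn_esup_lt_eventually[N NP] _]].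
exists N.+1 => // n Nn; rewrite ltey; apply/eqP => Zn.
have := NP n (ltnW Nn); rewrite /log_rate Zn /= gt0_muley; first by rewrite ltNge leey.
by rewrite lte_fin invr_gt0 ltr0n (leq_trans _ Nn).
Qed.

Lemma cvg_log_rate_partition : (pressure f < +oo)%E ->
  log_rate (partition_function f) @ \oo --> pressure f.
Proof.
move=> Pfin; have [N N0 NZ] := finite_partition_function Pfin.
pose c := M ^+ 3 * C; have c0 : 0 < c by rewrite mulr_gt0// exprn_gt0.
pose z n := fine (partition_function f n).
have zE n : (N <= n)%N -> partition_function f n = (z n)%:E.
  move=> Nn; rewrite fineK// fin_numElt NZ// andbT.
  by apply: lt_trans (partition_gt0 (leq_trans N0 Nn)); rewrite ltNyr.
have z0 n : (N <= n)%N -> 0 < z n.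
  by move=> Nn; rewrite -lte_fin -zE// partition_gt0// (leq_trans N0).
(* Multiplying by c makes the sequence genuinely submultiplicative: c Z_{n+m} <= (c Z_n) (c Z_m). *)
have [|l [ul _]] := @fekete R (fun n => ln (c * z n)) N N0.
  move=> n m Nn Nm; have Nnm : (N <= n + m)%N by lia.
  rewrite -lnM ?posrE ?mulr_gt0 ?z0// ler_ln ?posrE ?mulr_gt0 ?z0//.
  have := submultiplicative_partition (leq_trans N0 Nn) (leq_trans N0 Nm).
  rewrite !zE// -!EFinM lee_fin -/c => h.
  by rewrite -mulrA ler_pM2l// mulrCA.
suff lZ : log_rate (partition_function f) @ \oo --> l.
  by rewrite /pressure (cvg_limn_einf_sup lZ).
have h0 : ((- (ln c / n%:R))%:E @[n --> \oo] --> 0)%E.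
  apply: cvg_EFin; first exact: nearW.
  by rewrite -oppr0; apply: cvgN; exact: cvg_div_natr.
have := cvgeD _ ul h0; rewrite adde0 fin_num_adde_defl// => /(_ _ isT) h.
apply: cvg_trans h; apply: near_eq_cvg.
exists N => // n /= Nn; rewrite /log_rate zE//= leNgt z0//=.
rewrite -EFinM -EFinD; congr (_%:E).
by rewrite lnM ?posrE ?z0// mulrDl addrAC subrr add0r mulrC.
Qed.

End partition.

(** * Periodic points and the Gurevich pressure *)

Section gurevich.
Context {R : realType} {t : transition_matrix}.
Local Notation X := (markov_shift t).
Implicit Types (x y z : X).
Variables (f : nat -> X -> R) (M C : R).
Hypotheses (fp : positive_seq f) (M1 : 1 <= M) (fM : distortion f M)
  (C0 : 0 < C) (fC : submultiplicative f C).

Let M0 : 0 < M. Proof. exact: lt_le_trans M1. Qed.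

Lemma periodic_coord n x i : iter n (@Defs.shift t) x = x -> x (i %% n)%N = x i.
Proof.
move=> xn; have H k j : x (k * n + j)%N = x j.
  elim: k => // k IH; rewrite mulSn -addnA addnC.
  by rewrite addnC -coord_iter_shift xn.
by rewrite [in RHS](divn_eq i n) H.
Qed.

(** A point of period n is determined by its first n symbols, so distinct ones lie in distinct
    cylinders of length n. *)
Lemma periodic_le_partition a n : (0 < n)%N ->
  (periodic_partition_function f a n <= partition_function f n)%E.
Proof.
move=> n0; apply: esum_le_seq => s us sP; rewrite sumEFin.
apply: (sum_le_partition fp (h := id)) => // x y /sP[xn _] /sP[yn _] /eq_mkseqP xy.
apply: coord_inj => i; rewrite -(periodic_coord i xn) -(periodic_coord i yn).
by rewrite xy// ltn_pmod.
Qed.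

(* Glue a point of [a], then x, then a point of [a] again, and repeat periodically. *)
Lemma gluing_periodic K D : 0 < D -> gluing setT f K D -> forall a,
  exists2 c, 0 < c & forall n x, (0 < n)%N -> exists k1 k2 y,
    [/\ k1 \in K, k2 \in K,
        iter (n + (1 + k1 + k2)) (@Defs.shift t) y = y /\ y 0%N = a,
        agree n (iter (1 + k1) (@Defs.shift t) y) x &
        c * f n x <= f (n + (1 + k1 + k2))%N y].
Proof.
move=> D0 glue a; have [xa xa0] := @exists_point_from t a.
pose g := f 1%N xa; have g0 : 0 < g by exact: fp.
(* E bounds the quotient of f_{N+1} at the glued point by f_N at its periodic version y: a factor
   [M] for changing the point, [C] for splitting off the last symbol, and M g for f_1 at y. *)
pose E := M ^+ 2 * C * g.
have E0 : 0 < E by rewrite !mulr_gt0// exprn_gt0.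
exists (D ^+ 2 * g ^+ 2 / E); first by rewrite divr_gt0// mulr_gt0// exprn_gt0.
move=> n x n0.
have [k1 k1K [z1 [_ z1a z1x z1f]]] := glue 1%N n xa x isT n0 I I.
have [|//|k2 k2K [z2 [_ z21 z2a z2f]]] :=
  glue (1 + n + k1)%N 1%N z1 xa _ _ I I; first by [].
set N := (1 + n + k1 + k2)%N in z2a.
have NE : (n + (1 + k1 + k2))%N = N by rewrite /N; lia.
have z20 : z2 0%N = a by rewrite z21// z1a.
have z2N : z2 N = a by rewrite -[N]addn0 -coord_iter_shift z2a.
(* The glued point has the symbol a at 0 and at N, so the transition closing the period is one of
   its own. *)
pose h i := z2 (i %% N)%N.
have ht i : t (h i) (h i.+1).
  rewrite /h modnS; case: ifPn => [Ni|_]; last exact: admissibleP.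
  have e : (i %% N).+1 = N.
    have lt := ltn_pmod i (isT : 0 < N)%N.
    have : (N %| (i %% N).+1)%N by rewrite /dvdn -addn1 modnDml addn1.
    by move=> /dvdn_leq/= => /(_ isT); lia.
  by have := admissibleP z2 (i %% N); rewrite e z2N z20.
exists k1, k2, (mkpoint h ht); rewrite NE.
have yz2 : agree N (mkpoint h ht) z2 by move=> i iN; rewrite mkpointE /h modn_small.
have per : iter N (@Defs.shift t) (mkpoint h ht) = mkpoint h ht.
  by apply: coord_inj => i; rewrite coord_iter_shift !mkpointE /h modnDl.
split=> //.
- move=> i ni; rewrite coord_iter_shift yz2; last by rewrite /N; lia.
  rewrite z21; last by lia.
  by rewrite -coord_iter_shift z1x.
set y := mkpoint h ht in yz2 per *.
(* Agreement extends one place beyond the period, because both sequences have a at position N. *)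
have yE : agree N.+1 z2 y.
  move=> i; rewrite ltnS leq_eqVlt => /orP[/eqP ->|iN]; last by rewrite yz2.
  by rewrite z2N mkpointE /h modnn z20.
have N1 : (1 + n + k1 + 1 + k2 = N + 1)%N by rewrite /N; lia.
rewrite N1 in z2f.
have le1 : f (N + 1)%N z2 <= M * (C * f N y * f 1%N y).
  apply: le_trans (fM _ (_ : agree _ z2 y)) _; rewrite ?addn1//.
  rewrite ler_pM2l//.
  by have := fC y (isT : 0 < N)%N (isT : 0 < 1)%N; rewrite per addn1.
have le2 : f 1%N y <= M * g.
  by apply: fM => // -[|//] _; rewrite yz2// z20 xa0.
have fN0 : 0 < f N y by exact: fp.
have le3 : f (N + 1)%N z2 <= E * f N y.
  apply: le_trans le1 _.
  have -> : E * f N y = M * (C * f N y * (M * g)) by rewrite /E; ring.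
  by rewrite !ler_pM2l// ?mulr_gt0.
have le4 : D * (D * g * f n x) * g <= f (N + 1)%N z2.
  apply: le_trans z2f; rewrite ler_pM2r// ler_pM2l//.
have -> : D ^+ 2 * g ^+ 2 / E * f n x = (D * (D * g * f n x) * g) / E.
  by field; rewrite gt_eqF.
by rewrite ler_pdivrMr// [leRHS]mulrC; exact: le_trans le3.
Qed.

(** Each word is sent to a periodic point containing it. The two connecting lengths depend on the
    word, so words are grouped by them; inside a group the word is read off from position 1 + k1 on,
    so the map is injective there. *)
Lemma partition_le_periodic K D : 0 < D -> gluing setT f K D -> forall a,
  exists2 c, 0 < c & forall n, (0 < n)%N ->
  (partition_function f n <= c%:E * \sum_(j <- [seq (1 + k1 + k2)%N | k1 <- K, k2 <- K])
     periodic_partition_function f a (n + j)%N)%E.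
Proof.
move=> D0 glue a; have [c c0 per] := gluing_periodic D0 glue a.
exists (M / c); first by rewrite divr_gt0.
move=> n n0.
have Pge0 k : (0 < k)%N -> (0 <= periodic_partition_function f a k)%E.
  by move=> k0; apply: esum_ge0 => x _; rewrite lee_fin ltW// fp.
have /choice[k1 /choice[k2 /choice[y yP]]] : forall w : seq nat, exists k1 k2 y,
    [/\ k1 \in K, k2 \in K,
        iter (n + (1 + k1 + k2)) (@Defs.shift t) y = y /\ y 0%N = a,
        agree n (iter (1 + k1) (@Defs.shift t) y) (point_in w) &
        c * f n (point_in w) <= f (n + (1 + k1 + k2))%N y].
  by move=> w; have [k1 [k2 [y ?]]] := per n (point_in w) n0; exists k1, k2, y.
apply: (partition_le_sum fM) => // s us sW.
rewrite big_allpairs_dep/=.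
pose F i j w := f (n + (1 + i + j))%N (y w).
apply: (@le_trans _ _ ((M / c)%:E *
    \sum_(i <- K) \sum_(j <- K) (\sum_(w <- s | (k1 w == i) && (k2 w == j)) F i j w)%:E)%E).
  have -> : (\sum_(i <- K) \sum_(j <- K)
       (\sum_(w <- s | (k1 w == i) && (k2 w == j)) F i j w)%:E)%E =
      (\sum_(i <- K) \sum_(j <- K) \sum_(w <- s | (k1 w == i) && (k2 w == j)) F i j w)%:E.
    by rewrite -sumEFin; apply: eq_bigr => i _; rewrite -sumEFin.
  rewrite -EFinM lee_fin -mulrA ler_pM2l// ler_pdivlMl// big_distrr/=.
  under [leRHS]eq_bigr do under eq_bigr do rewrite big_mkcond/=.
  under [leRHS]eq_bigr do rewrite exchange_big/=.
  rewrite exchange_big/=; apply: ler_sum => w _.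
  have [k1K k2K _ _] := yP w; move/le_trans; apply.
  have G0 i j : 0 <= (if (k1 w == i) && (k2 w == j) then F i j w else 0).
    by case: ifP => // _; rewrite ltW// /F fp// addn_gt0 n0.
  rewrite (big_rem (k1 w))//= -[leLHS]addr0 lerD//; last first.
    by apply: sumr_ge0 => i _; apply: sumr_ge0.
  rewrite (big_rem (k2 w))//= !eqxx lerDl; apply: sumr_ge0 => j _.
  by have := G0 (k1 w) j; rewrite eqxx.
apply: lee_wpmul2l; first by rewrite lee_fin divr_ge0// ltW.
apply: lee_sum => i _; apply: lee_sum => j _.
rewrite -big_filter -sumEFin.
apply: (@seq_sum_le_esum _ _ _ _ y _ (fun x => (f (n + (1 + i + j))%N x)%:E)).
- exact: filter_uniq.
- move=> u v; rewrite !mem_filter => /andP[/andP[/eqP u1 _] us'].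
  move=> /andP[/andP[/eqP v1 _] vs'] uv.
  have [_ _ _ + _] := yP u; have [_ _ _ + _] := yP v.
  rewrite u1 v1 uv => /agree_sym + /(agree_trans _) => h /(_ _ (agree_sym _)) _.
  have [_ _ _ au _] := yP u; have [_ _ _ av _] := yP v.
  rewrite u1 uv in au; rewrite v1 in av.
  have /eq_mkseqP := agree_trans (agree_sym au) av.
  by rewrite (point_inK (sW _ us')) (point_inK (sW _ vs')).
- by move=> u; rewrite mem_filter => /andP[/andP[/eqP <- /eqP <-] _]; case: (yP u).
- by move=> x _; rewrite lee_fin ltW// fp// addn_gt0 n0.
Qed.

Lemma gurevich_pressureE K D : 0 < D -> gluing setT f K D -> gurevich_eq_pressure f.
Proof.
move=> D0 glue a; apply/eqP; rewrite eq_le; apply/andP; split.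
  apply: (@le_limn_esup _ _ _ 1) => n n0.
  by apply: log_rate_homo; exact: periodic_le_partition.
have [c c0 cP] := partition_le_periodic D0 glue a.
exact: (le_limn_esup_log_rate_shift c0 cP).
Qed.

(** With one connecting length, the sum in [partition_le_periodic] has the single shift 1 + 2p, and
    the limit for the partition function carries over. *)
Lemma cvg_log_rate_periodic p D : 0 < D -> gluing setT f [:: p] D ->
  (pressure f < +oo)%E -> forall a,
  log_rate (periodic_partition_function f a) n @[n --> \oo] --> gurevich_pressure f a.
Proof.
move=> D0 glue Pfin a; have [c c0 cP] := partition_le_periodic D0 glue a.
rewrite (gurevich_pressureE D0 glue).
apply: (cvg_log_rate_shift c0 (Z := partition_function f) (N0 := 1%N)
  (j := (1 + p + p)%N)).
- by move=> n /cP /=; rewrite big_seq1.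
- exact: periodic_le_partition.
- exact: (cvg_log_rate_partition fp M1 fM C0 fC Pfin).
Qed.

(** Gluing the first symbol of x to a fixed word of length N gives D f_1(x) f_N(y) <= Z_{1+N+k},
    which is finite for N large. The bound sums over all k in [K] because k depends on x. *)
Lemma bounded_first K D : 0 < D -> gluing setT f K D ->
  (pressure f < +oo)%E -> exists B, forall x, f 1%N x <= B.
Proof.
move=> D0 glue Pfin.
have [N N0 NZ] := finite_partition_function Pfin.
pose y := point : X; have fy0 : 0 < D * f N y by rewrite mulr_gt0// fp.
exists (\sum_(k <- K) fine (partition_function f (1 + N + k)%N) / (D * f N y)) => x.
have [k kK [z [_ _ _ zf]]] := glue 1%N N x y isT N0 I I.
have zE j : partition_function f (1 + N + j)%N =
    (fine (partition_function f (1 + N + j)%N))%:E.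
  rewrite fineK// fin_numElt NZ ?andbT; last by lia.
  apply: lt_le_trans (ltW (partition_gt0 fp (_ : 0 < 1 + N + j)%N)); rewrite ?ltNyr//.
have H0 j : 0 <= fine (partition_function f (1 + N + j)%N).
  by rewrite -lee_fin -zE ltW// partition_gt0.
rewrite (big_rem k)//= -[leLHS]addr0 lerD//; last first.
  by apply: sumr_ge0 => j _; rewrite divr_ge0// ltW.
rewrite ler_pdivlMr// mulrCA mulrA; apply: le_trans zf _.
rewrite -lee_fin -zE.
have := @sum_le_partition _ _ f fp nat [:: 0%N] (fun=> z) (1 + N + k)%N isT isT.
by rewrite big_seq1; apply => u v; rewrite !inE => /eqP -> /eqP ->.
Qed.

End gurevich.

(** * The Borel sigma-algebra of the shift *)

Section borel.
Context {t : transition_matrix}.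
Local Notation X := (markov_shift t).
Implicit Types (x y z : X) (U : set X).

Lemma open_cylinder w : open (@cylinder t w).
Proof.
exists [set cylinder w]; last by rewrite bigcup_set1.
by move=> _ ->; apply: finI_from1; exists w.
Qed.

(** A finite intersection of cylinders around x contains the cylinder of x as long as the longest of
    them. *)
Lemma open_contains_cylinder U x : open U -> U x ->
  exists m, cylinder (mkseq x m) `<=` U.
Proof.
move=> [D' sD' <-] [B DB Bx].
have [F FD FB] := sD' _ DB.
pose F' : seq (set X) := finmap.enum_fset F.
have {}FD V : V \in F' -> range (@cylinder t) V by move=> /(FD V); rewrite inE.
have {}FB : B = \bigcap_(V in [set` F']) V by rewrite -FB.
have /choice[s sP] : forall V : set X, exists w, V \in F' -> V = cylinder w.
  move=> V; case: (boolP (V \in F')) => [/FD[w _ <-]|]; last by exists [::].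
  by exists w.
exists (\max_(V <- F') size (s V)) => y /cylinderE yx; exists B => //=.
rewrite FB => V /= VF.
have xV : V x by move: Bx => /=; rewrite FB; exact.
rewrite (sP _ VF) /cylinder/= in xV *; rewrite -[RHS]xV.
apply/eq_mkseqP; apply: agree_le yx.
exact: (@leq_bigmax_seq _ F' predT (fun V => size (s V))).
Qed.

(** There are countably many words, so an open set is a countable union of the cylinders it
    contains; [pickle] supplies the enumeration. *)
Lemma open_bigcup_cylinder U : open U ->
  U = \bigcup_n (if unpickle n is Some w then
                   if `[<cylinder w `<=` U>] then @cylinder t w else set0 else set0).
Proof.
move=> oU; apply/seteqP; split=> x.
  move=> Ux; have [m mU] := open_contains_cylinder oU Ux.
  exists (pickle (mkseq x m)) => //; rewrite pickleK.
  by case: asboolP => // _; exact: cylinder_mkseq.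
move=> [n _]; case: (unpickle n) => [w|//]; case: asboolP => // wU; exact: wU.
Qed.

Lemma measurable_cylinder w : measurable (cylinder w : set (borel_shift t)).
Proof. by apply: sub_sigma_algebra; exact: open_cylinder. Qed.

Lemma borel_sub_sigma_algebra (G : set (set (borel_shift t))) :
  sigma_algebra setT G -> (forall w, G (cylinder w)) ->
  measurable `<=` G.
Proof.
move=> sG Gc; apply: smallest_sub => // U /open_bigcup_cylinder ->.
have [G0 _ GU] := sG.
have GF n : G (if unpickle n is Some w then
    if `[<cylinder w `<=` U>] then @cylinder t w else set0 else set0).
  case: (unpickle n) => [w|]; last exact: G0.
  by case: ifP => _; [exact: Gc|exact: G0].
exact: (GU _ GF).
Qed.

Lemma borel_cylinders : @measurable _ (borel_shift t) =
  <<s [set A | A = set0 \/ exists w, A = cylinder w] >>.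
Proof.
apply/seteqP; split.
  apply: borel_sub_sigma_algebra; first exact: smallest_sigma_algebra.
  by move=> w; apply: sub_sigma_algebra; right; exists w.
apply: smallest_sub; first exact: sigma_algebra_measurable.
by move=> _ [->|[w ->]]; [exact: measurable0|exact: measurable_cylinder].
Qed.

Lemma setI_closed_cylinders :
  setI_closed [set A : set X | A = set0 \/ exists w, A = cylinder w].
Proof.
move=> A B [->|[u ->]]; first by rewrite set0I; left.
move=> [->|[v ->]]; first by rewrite setI0; left.
have [->|/set0P[x [xu xv]]] := eqVneq (cylinder u `&` @cylinder t v) set0; first by left.
right; exists (mkseq x (maxn (size u) (size v))); apply/seteqP; split=> y.
  move=> [yu yv]; apply/cylinderE => i; rewrite leq_max => /orP[] h.
    by move: h; rewrite -xu in yu *; rewrite size_mkseq; move/cylinderE : yu; exact.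
  by move: h; rewrite -xv in yv *; rewrite size_mkseq; move/cylinderE : yv; exact.
move=> /cylinderE yx; split.
  by rewrite -xu; apply/cylinderE; apply: agree_le yx; exact: leq_maxl.
by rewrite -xv; apply/cylinderE; apply: agree_le yx; exact: leq_maxr.
Qed.

Lemma cylinder_nil : cylinder [::] = [set: X].
Proof. by apply/seteqP; split. Qed.

Lemma borel_measure_unique (R : realType) (m1 m2 : {measure set (borel_shift t) -> \bar R}) :
  (m1 setT < +oo)%E -> (forall w, m1 (cylinder w) = m2 (cylinder w)) ->
  forall A, measurable A -> m1 A = m2 A.
Proof.
move=> m1T m12 A mA.
apply: (measure_unique _ (fun=> setT) borel_cylinders setI_closed_cylinders) => //.
- by move=> _; right; exists [::]; rewrite cylinder_nil.
- by rewrite bigcup_const//; exists 0%N.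
- by move=> _ [->|[w ->//]]; rewrite !measure0.
Qed.

Lemma shift_preimage_cylinder w :
  @Defs.shift t @^-1` cylinder w =
  \bigcup_(a in [set: nat]) @cylinder t (a :: w).
Proof.
have mE x n : mkseq x n.+1 = x 0%N :: mkseq (@Defs.shift t x) n.
  by rewrite /mkseq/= -[1%N]addn0 iotaDl -map_comp.
apply/seteqP; split=> x.
  move=> xw; exists (x 0%N) => //.
  by change (mkseq x (size w).+1 = x 0%N :: w); rewrite mE xw.
move=> [a _] xaw; have {}xaw : mkseq x (size w).+1 = a :: w by [].
by move: xaw; rewrite mE => -[].
Qed.

Lemma measurable_shift : measurable_fun setT (@Defs.shift t : borel_shift t -> borel_shift t).
Proof.
move=> _; apply: borel_sub_sigma_algebra; last first.
  move=> w; rewrite setTI shift_preimage_cylinder.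
  by apply: bigcup_measurable => a _; exact: measurable_cylinder.
split => /=.
- by rewrite preimage_set0 setI0; exact: measurable0.
- move=> A; rewrite !setTI setTD preimage_setC; exact: measurableC.
- move=> F mF; rewrite preimage_bigcup setTI; apply: bigcup_measurable => n _.
  by have := mF n; rewrite setTI.
Qed.

Lemma measurable_iter_shift n :
  measurable_fun setT (iter n (@Defs.shift t) : borel_shift t -> borel_shift t).
Proof.
elim: n => [|n IH]; first exact: measurable_id.
exact: (measurableT_comp measurable_shift IH).
Qed.

Lemma continuous_measurable_shift (R : realType) (g : X -> R) :
  continuous g -> measurable_fun setT (g : borel_shift t -> R).
Proof.
move=> cg; apply: (measurability _ (measurable_realfun.RGenOInfty.measurableE R)).
move=> _ [U [a ->] <-]; rewrite setTI; apply: sub_sigma_algebra.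
by move/continuousP: cg; apply; exact: interval_open.
Qed.

End borel.

(** * Entropy of finite labels *)

Section gibbs.
Context {R : realType}.

Lemma ln_le_subr1 (x : R) : 0 < x -> ln x <= x - 1.
Proof.
move=> x0; have := @le_ln1Dx R (x - 1).
by have -> : 1 + (x - 1) = x; [ring|apply; lra].
Qed.

(** Termwise, p ln (r / p) <= r - p, by ln u <= u - 1. It suffices that the total of r does not
    exceed that of p. *)
Lemma gibbs (I : Type) (s : seq I) (p r : I -> R) :
  (forall i, 0 <= p i) -> (forall i, 0 <= r i) -> (forall i, 0 < p i -> 0 < r i) ->
  \sum_(i <- s) r i <= \sum_(i <- s) p i ->
  \sum_(i <- s) p i * ln (r i) <= \sum_(i <- s) p i * ln (p i).
Proof.
move=> p0 r0 pr rp; rewrite -subr_ge0 -sumrB.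
apply: (@le_trans _ _ (\sum_(i <- s) (p i - r i))).
  by rewrite sumrB subr_ge0.
apply: ler_sum => i _; rewrite -mulrBr.
have [->|pi0] := eqVneq (p i) 0; first by rewrite mul0r sub0r oppr_le0.
have {}pi0 : 0 < p i by rewrite lt_neqAle eq_sym pi0 p0.
have ri0 := pr _ pi0.
have := ln_le_subr1 (divr_gt0 ri0 pi0); rewrite ln_div ?posrE// => h.
have : p i * (ln (r i) - ln (p i)) <= p i * (r i / p i - 1) by rewrite ler_pM2l.
have -> : p i * (r i / p i - 1) = r i - p i by field; rewrite gt_eqF.
rewrite !mulrBr; lra.
Qed.

Definition eta (q : R) := - (q * ln q).

Lemma eta_ge0 q : 0 <= q <= 1 -> 0 <= eta q.
Proof.
by move=> /andP[q0 q1]; rewrite /eta oppr_ge0 mulr_ge0_le0// ln_le0.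
Qed.

(** An explicit modulus of continuity of [eta] at 0, with s playing the part of the square root of
    q. It comes from splitting - q ln q as q ln (s^2 / q) + 2 q ln (1 / s). *)
Lemma eta_le q s : 0 <= q <= s ^+ 2 -> 0 < s <= 1 -> eta q <= 3 * s.
Proof.
move=> /andP[q0 qs] /andP[s0 s1].
have [->|qn0] := eqVneq q 0; first by rewrite /eta mul0r oppr0 mulr_ge0// ltW.
have {}q0 : 0 < q by rewrite lt_neqAle eq_sym qn0.
have s20 : 0 < s ^+ 2 by rewrite exprn_gt0.
have h1 : q * ln (s ^+ 2 / q) <= q * (s ^+ 2 / q - 1).
  by rewrite ler_pM2l// ln_le_subr1// divr_gt0.
have h2 : q * ln (s^-1) <= q * (s^-1 - 1).
  by rewrite ler_pM2l// ln_le_subr1// invr_gt0.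
have h3 : q * s^-1 <= s by rewrite ler_pdivrMr.
have e1 : q * (s ^+ 2 / q - 1) = s ^+ 2 - q by field.
rewrite e1 ln_div ?posrE// lnXn// in h1; rewrite lnV ?posrE// in h2.
have h4 : s ^+ 2 <= s by rewrite expr2 ler_piMl// ltW.
rewrite /eta; rewrite !mulrBr mulrnAr mulrN mulr1 in h1 h2; lra.
Qed.

Lemma eta_sum_le (I J : finType) (g : I -> J) (p : I -> R) : (forall i, 0 <= p i) ->
  \sum_j eta (\sum_(i | g i == j) p i) <= \sum_i eta (p i).
Proof.
move=> p0; rewrite [leRHS](partition_big g predT)//=; apply: ler_sum => j _.
rewrite /eta big_distrl/= -sumrN; apply: ler_sum => i gij.
rewrite lerN2; have [->|pi0] := eqVneq (p i) 0; first by rewrite !mul0r.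
have {}pi0 : 0 < p i by rewrite lt_neqAle eq_sym pi0 p0.
rewrite ler_pM2l// ler_ln ?posrE//; rewrite (bigD1 i)//= ?lerDl ?ltr_wpDr// sumr_ge0//.
Qed.

(** Strong subadditivity H(A,B,C) + H(C) <= H(A,C) + H(B,C): Gibbs' inequality against the law under
    which A and B are independent given C. *)
Lemma eta_submodular (A B C : finType) (p : A -> B -> C -> R) :
  (forall a b c, 0 <= p a b c) ->
  \sum_a \sum_b \sum_c eta (p a b c) + \sum_c eta (\sum_a \sum_b p a b c) <=
  \sum_a \sum_c eta (\sum_b p a b c) + \sum_b \sum_c eta (\sum_a p a b c).
Proof.
move=> p0.
pose pac a c := \sum_b p a b c; pose pbc b c := \sum_a p a b c.
pose pc c := \sum_a \sum_b p a b c.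
have pac0 a c : 0 <= pac a c by exact: sumr_ge0.
have pbc0 b c : 0 <= pbc b c by exact: sumr_ge0.
have pc0 c : 0 <= pc c by apply: sumr_ge0 => a _; exact: sumr_ge0.
have ppac a b c : p a b c <= pac a c by rewrite /pac (bigD1 b)//= lerDl sumr_ge0.
have ppbc a b c : p a b c <= pbc b c by rewrite /pbc (bigD1 a)//= lerDl sumr_ge0.
have ppc a c : pac a c <= pc c.
  by rewrite /pc (bigD1 a)//= lerDl sumr_ge0// => i _; exact: sumr_ge0.
pose P (x : A * B * C) := p x.1.1 x.1.2 x.2.
pose Q (x : A * B * C) := pac x.1.1 x.2 * pbc x.1.2 x.2 / pc x.2.
have sumE (F : A -> B -> C -> R) :
    \sum_(x : A * B * C) F x.1.1 x.1.2 x.2 = \sum_a \sum_b \sum_c F a b c.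
  rewrite pair_bigA/= pair_bigA/=; exact: eq_bigr.
have gib : \sum_x P x * ln (Q x) <= \sum_x P x * ln (P x).
  apply: gibbs.
  - by move=> x; exact: p0.
  - by move=> x; rewrite divr_ge0// mulr_ge0.
  - move=> x Px; have h1 := lt_le_trans Px (ppac _ _ _).
    have h2 := lt_le_trans Px (ppbc _ _ _); have h3 := lt_le_trans h1 (ppc _ _).
    by rewrite divr_gt0// mulr_gt0.
  rewrite (sumE (fun a b c => p a b c)) (sumE (fun a b c => pac a c * pbc b c / pc c)).
  have -> : \sum_a \sum_b \sum_c p a b c = \sum_c pc c.
    under eq_bigr do rewrite exchange_big/=.
    by rewrite exchange_big.
  under eq_bigr do rewrite exchange_big/=.
  rewrite exchange_big/=; apply: ler_sum => c _.
  under eq_bigr do rewrite -big_distrl -big_distrr/=.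
  rewrite -big_distrl -big_distrl/=.
  have -> : \sum_b pbc b c = pc c by rewrite /pc exchange_big.
  have -> : \sum_a pac a c = pc c by [].
  have [->|pcn0] := eqVneq (pc c) 0; first by rewrite !mul0r.
  by rewrite mulfK.
have lnQ x : P x * ln (Q x) =
    P x * ln (pac x.1.1 x.2) + P x * ln (pbc x.1.2 x.2) - P x * ln (pc x.2).
  have [->|Px] := eqVneq (P x) 0; first by rewrite !mul0r addr0 subr0.
  have {}Px : 0 < P x by rewrite lt_neqAle eq_sym Px p0.
  have h1 := lt_le_trans Px (ppac _ _ _).
  have h2 := lt_le_trans Px (ppbc _ _ _); have h3 := lt_le_trans h1 (ppc _ _).
  by rewrite /Q ln_div ?posrE ?mulr_gt0// lnM ?posrE// mulrBr mulrDr.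
rewrite (eq_bigr _ (fun x _ => lnQ x)) sumrB big_split/= in gib.
rewrite (sumE (fun a b c => p a b c * ln (pac a c)))
  (sumE (fun a b c => p a b c * ln (pbc b c)))
  (sumE (fun a b c => p a b c * ln (pc c)))
  (sumE (fun a b c => p a b c * ln (p a b c))) in gib.
have e1 : \sum_a \sum_b \sum_c p a b c * ln (pac a c) =
    - \sum_a \sum_c eta (pac a c).
  rewrite -sumrN; apply: eq_bigr => a _; rewrite exchange_big/= -sumrN.
  by apply: eq_bigr => c _; rewrite /eta opprK -big_distrl.
have e2 : \sum_a \sum_b \sum_c p a b c * ln (pbc b c) =
    - \sum_b \sum_c eta (pbc b c).
  rewrite exchange_big/= -sumrN; apply: eq_bigr => b _; rewrite exchange_big/= -sumrN.
  by apply: eq_bigr => c _; rewrite /eta opprK -big_distrl.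
have e3 : \sum_a \sum_b \sum_c p a b c * ln (pc c) = - \sum_c eta (pc c).
  under eq_bigr do rewrite exchange_big/=.
  rewrite exchange_big/= -sumrN; apply: eq_bigr => c _.
  under eq_bigr do rewrite -big_distrl/=.
  by rewrite -big_distrl /eta opprK.
have e4 : \sum_a \sum_b \sum_c p a b c * ln (p a b c) =
    - \sum_a \sum_b \sum_c eta (p a b c).
  rewrite -sumrN; apply: eq_bigr => a _; rewrite -sumrN; apply: eq_bigr => b _.
  by rewrite -sumrN; apply: eq_bigr => c _; rewrite /eta opprK.
rewrite e1 e2 e3 e4 in gib; rewrite -/(pac _ _) -/(pc _) -/(pbc _ _).
by move: gib; rewrite /pac /pbc /pc; lra.
Qed.

End gibbs.

Section random_labels.
Context {R : realType} {d : measure_display} {T : measurableType d}.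
Variable mu : probability T R.
Implicit Types (A B : set T).

Definition pr A : R := fine (mu A).

Lemma prE A : measurable A -> mu A = (pr A)%:E.
Proof. by move=> mA; rewrite /pr fineK// fin_num_measure. Qed.

Lemma pr_ge0 A : 0 <= pr A.
Proof. by rewrite /pr fine_ge0. Qed.

Lemma pr_le1 A : measurable A -> pr A <= 1.
Proof. by move=> mA; rewrite -lee_fin -prE// probability_le1. Qed.

Lemma pr_le A B : measurable A -> measurable B -> A `<=` B -> pr A <= pr B.
Proof. by move=> mA mB AB; rewrite -lee_fin -!prE// le_measure// inE. Qed.

Lemma prU_le A B : measurable A -> measurable B -> pr (A `|` B) <= pr A + pr B.
Proof.
move=> mA mB; rewrite -lee_fin EFinD -!prE//; first exact: measureU2.
exact: measurableU.
Qed.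

Definition measurable_label (I : finType) (X : T -> I) :=
  forall i, measurable (X @^-1` [set i]).

Lemma label_preimage (I : finType) (X : T -> I) (D : set I) :
  measurable_label X -> measurable (X @^-1` D).
Proof.
move=> mX; have -> : X @^-1` D = \bigcup_(i in D) (X @^-1` [set i]).
  by apply/seteqP; split=> [x Dx|x [i Di /= Xi]]; [exists (X x)|rewrite /preimage/= Xi].
by apply: fin_bigcup_measurable => // i _; exact: mX.
Qed.

Lemma label_comp (I J : finType) (X : T -> I) (g : I -> J) :
  measurable_label X -> measurable_label (g \o X).
Proof. by move=> mX j; rewrite comp_preimage; exact: label_preimage. Qed.

Lemma label_pair (I J : finType) (X : T -> I) (Y : T -> J) :
  measurable_label X -> measurable_label Y -> measurable_label (fun x => (X x, Y x)).
Proof.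
move=> mX mY [i j]; have -> : (fun x => (X x, Y x)) @^-1` [set (i, j)] =
    X @^-1` [set i] `&` Y @^-1` [set j].
  by apply/seteqP; split=> x /= [-> ->].
by apply: measurableI; [exact: mX|exact: mY].
Qed.

Lemma pr_partition (I : finType) (X : T -> I) A : measurable_label X ->
  measurable A -> pr A = \sum_i pr (A `&` X @^-1` [set i]).
Proof.
move=> mX mA; apply: EFin_inj; rewrite -prE// -sumEFin.
rewrite (eq_bigr (fun i => mu (A `&` X @^-1` [set i]))); last first.
  by move=> i _; rewrite prE//; apply: measurableI => //; exact: mX.
have {1}-> : A = \bigcup_(i in [set` predT]) (A `&` X @^-1` [set i]).
  by apply/seteqP; split=> [x Ax|x [i _ []//]]; exists (X x).
rewrite measure_fin_bigcup//.
- rewrite -(bigfs _ (r := index_enum I))// ?index_enum_uniq// => i _.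
  by rewrite mem_index_enum.
- by move=> i j _ _ [x [[_ <-] [_ <-]]].
- by move=> i _; apply: measurableI => //; exact: mX.
Qed.

Definition law (I : finType) (X : T -> I) (i : I) : R := pr (X @^-1` [set i]).

Lemma law_ge0 (I : finType) (X : T -> I) i : 0 <= law X i.
Proof. exact: pr_ge0. Qed.

Lemma sum_law (I : finType) (X : T -> I) : measurable_label X -> \sum_i law X i = 1.
Proof.
move=> mX; have := pr_partition mX measurableT.
rewrite {1}/pr probability_setT /= => ->.
by apply: eq_bigr => i _; rewrite setTI.
Qed.

Lemma law_comp (I J : finType) (X : T -> I) (g : I -> J) j : measurable_label X ->
  law (g \o X) j = \sum_(i | g i == j) law X i.
Proof.
move=> mX; rewrite /law (pr_partition mX); last exact: label_comp.
rewrite [RHS]big_mkcond/=; apply: eq_bigr => i _.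
case: eqP => [gij|gij].
  by congr pr; apply/seteqP; split=> [x []//|x /= Xi]; split=> //=; rewrite Xi.
have -> : (g \o X) @^-1` [set j] `&` X @^-1` [set i] = set0; last by rewrite /pr measure0.
by apply/seteqP; split=> // x [/= gX Xi]; apply: gij; rewrite -Xi.
Qed.

Definition label_entropy (I : finType) (X : T -> I) : R := \sum_i eta (law X i).
Local Notation H := label_entropy.

Lemma label_entropy_ge0 (I : finType) (X : T -> I) : measurable_label X -> 0 <= H X.
Proof.
by move=> mX; apply: sumr_ge0 => i _; rewrite eta_ge0// law_ge0 pr_le1.
Qed.

Lemma label_entropy_factor (I J : finType) (X : T -> I) (Y : T -> J) (g : J -> I) :
  measurable_label Y -> X =1 g \o Y -> H X <= H Y.
Proof.
move=> mY /funext ->; apply: le_trans (eta_sum_le g (law_ge0 Y)).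
by rewrite le_eqVlt; apply/orP; left; apply/eqP/eq_bigr => i _; rewrite law_comp.
Qed.

Lemma label_entropy_submodular (I J K : finType) (X : T -> I) (Y : T -> J) (Z : T -> K) :
  measurable_label X -> measurable_label Y -> measurable_label Z ->
  H (fun x => (X x, Y x, Z x)) + H Z <= H (fun x => (X x, Z x)) + H (fun x => (Y x, Z x)).
Proof.
move=> mX mY mZ; pose W x := (X x, Y x, Z x).
have mW : measurable_label W by exact: label_pair (label_pair mX mY) mZ.
pose p a b c := law W (a, b, c).
have := @eta_submodular R I J K p (fun a b c => law_ge0 W (a, b, c)).
have sumE (F : I * J * K -> R) : \sum_x F x = \sum_a \sum_b \sum_c F (a, b, c).
  rewrite pair_bigA/= pair_bigA/=; apply: eq_bigr; by move=> [[a b] c].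
have sumZ c : \sum_a \sum_b p a b c = law Z c.
  rewrite -[Z]/(snd \o W) law_comp// [RHS]big_mkcond sumE/=.
  apply: eq_bigr => a _; apply: eq_bigr => b _.
  by rewrite -big_mkcond/= big_pred1_eq.
have sumXZ a c : \sum_b p a b c = law (fun x => (X x, Z x)) (a, c).
  rewrite -[fun x => (X x, Z x)]/((fun w : I * J * K => (w.1.1, w.2)) \o W).
  rewrite law_comp// [RHS]big_mkcond sumE/= (bigD1 a)//= [X in _ + X]big1 ?addr0.
    apply: eq_bigr => b _; rewrite -big_mkcond/= (big_pred1 c)// => c'.
    by rewrite xpair_eqE eqxx.
  move=> i ia; rewrite big1// => b _; rewrite big1// => c' _.
  by rewrite xpair_eqE (negbTE ia).
have sumYZ b c : \sum_a p a b c = law (fun x => (Y x, Z x)) (b, c).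
  rewrite -[fun x => (Y x, Z x)]/((fun w : I * J * K => (w.1.2, w.2)) \o W).
  rewrite law_comp// [RHS]big_mkcond sumE/=; apply: eq_bigr => a _.
  rewrite (bigD1 b)//= [X in _ + X]big1 ?addr0.
    by rewrite -big_mkcond/= (big_pred1 c)// => c'; rewrite xpair_eqE eqxx.
  move=> i ib; rewrite big1// => c' _.
  by rewrite xpair_eqE (negbTE ib).
rewrite /H (sumE (fun x => eta (law W x))).
under [\sum_c eta (\sum_a _)]eq_bigr do rewrite sumZ.
under [\sum_a \sum_c eta (\sum_b _)]eq_bigr do under eq_bigr do rewrite sumXZ.
under [\sum_b \sum_c eta (\sum_a _)]eq_bigr do under eq_bigr do rewrite sumYZ.
rewrite [X in _ <= X + _]pair_bigA [X in _ <= _ + X]pair_bigA/=.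
congr (_ <= _ + _); apply: eq_bigr; by move=> [].
Qed.

Lemma label_entropy_pair (I J : finType) (X : T -> I) (Y : T -> J) :
  measurable_label X -> measurable_label Y -> H (fun x => (X x, Y x)) <= H X + H Y.
Proof.
(* A constant label, of entropy 0, turns strong subadditivity into plain subadditivity. *)
move=> mX mY; have mZ : measurable_label (fun _ : T => tt).
  by move=> [] ; rewrite (_ : _ @^-1` _ = setT)//; apply/seteqP.
have := label_entropy_submodular mX mY mZ.
have -> : H (fun=> tt) = 0.
  rewrite /H big1// => -[] _; have := sum_law mZ; rewrite (big_pred1 tt) => [|[]//].
  by move=> ->; rewrite /eta ln1 mulr0 oppr0.
rewrite addr0 => h.
apply: le_trans (le_trans h _).
  apply: (@label_entropy_factor _ _ _ _ (fun w => w.1)) => //.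
  exact: label_pair (label_pair mX mY) mZ.
by apply: lerD; apply: (@label_entropy_factor _ _ _ _ (fun i => (i, tt))).
Qed.

(* A Fano-type bound: H(X | Y) is small when X is nearly a function of Y. *)
Lemma label_entropy_close (I J : finType) (X : T -> I) (Y : T -> J) (g : J -> I) s :
  measurable_label X -> measurable_label Y -> 0 < s <= 1 ->
  pr [set x | X x <> g (Y x)] <= s ^+ 2 ->
  H (fun x => (X x, Y x)) <= H Y + (#|{: I * I}|)%:R * (3 * s).
Proof.
move=> mX mY s01 Ps; pose Z := g \o Y.
have mZ : measurable_label Z by exact: label_comp.
(* As Z is a function of Y, conditioning on Z leaves at least as much entropy in X as conditioning
   on Y, so it is enough to bound H(X,Z) - H(Z). *)
have sub := label_entropy_submodular mX mY mZ.
have h1 : H (fun x => (X x, Y x)) <= H (fun x => (X x, Y x, Z x)).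
  apply: (@label_entropy_factor _ _ _ _ (fun w => w.1)) => //.
  exact: label_pair (label_pair mX mY) mZ.
have h2 : H (fun x => (Y x, Z x)) <= H Y.
  by apply: (@label_entropy_factor _ _ _ _ (fun j => (j, g j))).
suff h3 : H (fun x => (X x, Z x)) <= H Z + (#|{: I * I}|)%:R * (3 * s) by lra.
have mXZ := label_pair mX mZ.
pose q (x : I * I) := law (fun x => (X x, Z x)) x.
have q0 x : 0 <= q x by exact: law_ge0.
have sumE (F : I * I -> R) : \sum_x F x = \sum_i \sum_j F (i, j).
  by rewrite pair_bigA/=; apply: eq_bigr => -[].
have qZ j : law Z j = \sum_i q (i, j).
  rewrite -[Z]/(snd \o (fun x => (X x, Z x))) law_comp// [LHS]big_mkcond sumE/=.
  by apply: eq_bigr => i _; rewrite -big_mkcond big_pred1_eq.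
have -> : H Z = \sum_x - (q x * ln (law Z x.2)).
  rewrite sumE exchange_big/=.
  by apply: eq_bigr => j _; rewrite sumrN -big_distrl/= -qZ.
rewrite /H mulr_natl -sumr_const -big_split/=; apply: ler_sum => -[i j] _ /=.
have qij1 : q (i, j) <= law Z j by rewrite qZ (bigD1 i)//= lerDl sumr_ge0.
have lZ1 : law Z j <= 1 by exact: pr_le1.
have [/andP[s0 s1] s2] : 0 < s <= 1 /\ s ^+ 2 <= s.
  by split=> //; case/andP: s01 => s0 s1; rewrite expr2 ler_piMl// ltW.
(* Each pair (i, j) contributes at most 3s: off the diagonal its mass is at most s^2, and on the
   diagonal the contribution is at most the missing mass P(Z = j) - q(j, j), again bounded by
   s^2. *)
have [->|ij] := eqVneq i j; last first.
  have qs : q (i, j) <= s ^+ 2.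
    apply: le_trans Ps; apply: pr_le => //.
      have -> : [set x | X x <> g (Y x)] = (fun x => (X x, Z x)) @^-1` [set w | w.1 <> w.2].
        by [].
      exact: label_preimage.
    by move=> x [/= -> Zj]; have -> : g (Y x) = j by []; exact/eqP.
  have : eta (q (i, j)) <= 3 * s by rewrite eta_le// q0.
  rewrite -/(q (i, j)) => h.
  have : q (i, j) * ln (law Z j) <= 0 by rewrite mulr_ge0_le0// ln_le0.
  lra.
rewrite -/(q (j, j)).
have [->|qn0] := eqVneq (q (j, j)) 0.
  by rewrite /eta !mul0r oppr0 add0r mulr_ge0// ltW.
have {}q0' : 0 < q (j, j) by rewrite lt_neqAle eq_sym qn0 q0.
have lZ0 : 0 < law Z j.
  by apply: lt_le_trans q0' _; rewrite qZ (bigD1 j)//= lerDl sumr_ge0.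
have h4 : q (j, j) * ln (law Z j / q (j, j)) <= q (j, j) * (law Z j / q (j, j) - 1).
  by rewrite ler_pM2l// ln_le_subr1// divr_gt0.
have e4 : q (j, j) * (law Z j / q (j, j) - 1) = law Z j - q (j, j).
  by field; rewrite gt_eqF.
rewrite e4 ln_div ?posrE// mulrBr in h4.
have h5 : law Z j - q (j, j) <= s ^+ 2.
  apply: le_trans Ps; rewrite lerBlDl.
  have -> : law Z j = pr (Z @^-1` [set j]) by [].
  apply: le_trans (prU_le _ _) => //; last first.
    have -> : [set x | X x <> g (Y x)] = (fun x => (X x, Z x)) @^-1` [set w | w.1 <> w.2].
      by [].
    exact: label_preimage.
  apply: pr_le => //.
    apply: measurableU => //.
    have -> : [set x | X x <> g (Y x)] = (fun x => (X x, Z x)) @^-1` [set w | w.1 <> w.2].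
      by [].
    exact: label_preimage.
  move=> x /= Zj; have [Xj|Xj] := eqVneq (X x) j; first by left; rewrite Xj Zj.
  by right; have -> : g (Y x) = j by []; exact/eqP.
by rewrite /eta; lra.
Qed.

End random_labels.

(** * Entropy rates of itineraries *)

Section dynamics.
Context {R : realType} {d : measure_display} {T : measurableType d}.
Variables (mu : probability T R) (S : T -> T).
Hypotheses (mS : measurable_fun setT S) (inv : Defs.invariant mu S).

Definition itinerary (I : finType) (X : T -> I) n (x : T) : {ffun 'I_n -> I} :=
  [ffun i : 'I_n => X (iter i S x)].
Local Notation H := (label_entropy mu).

Lemma join_entropyE k (xi : T -> 'I_k) n :
  join_entropy mu S xi n = H (itinerary xi n).
Proof.
apply: eq_bigr => w _; rewrite /eta /law /pr.
suff -> : [set x | forall i : 'I_n, xi (iter i S x) = w i] =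
    itinerary xi n @^-1` [set w] by [].
apply/seteqP; split=> x /= h; first by apply/ffunP => i; rewrite ffunE h.
by move=> i; rewrite -h ffunE.
Qed.

Lemma measurable_iter n : measurable_fun setT (iter n S).
Proof.
elim: n => [|n IH]; first exact: measurable_id.
exact: (measurableT_comp mS IH).
Qed.

Lemma label_iter (I : finType) (X : T -> I) n : measurable_label X ->
  measurable_label (X \o iter n S).
Proof.
by move=> mX i; have := measurable_iter n measurableT (mX i); rewrite setTI comp_preimage.
Qed.

Lemma label_itinerary (I : finType) (X : T -> I) n : measurable_label X ->
  measurable_label (itinerary X n).
Proof.
move=> mX w; have -> : itinerary X n @^-1` [set w] =
    \bigcap_(i in [set: 'I_n]) ((X \o iter i S) @^-1` [set w i]).
  apply/seteqP; split=> x /= h; first by move=> i _; rewrite /= -h ffunE.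
  by apply/ffunP => i; rewrite ffunE; exact: h.
apply: fin_bigcap_measurable => // i _; exact: label_iter.
Qed.

Lemma law_shift (I : finType) (X : T -> I) i : measurable_label X ->
  law mu (X \o S) i = law mu X i.
Proof. by move=> mX; rewrite /law /pr comp_preimage inv. Qed.

Lemma label_entropy_iter (I : finType) (X : T -> I) n : measurable_label X ->
  H (X \o iter n S) = H X.
Proof.
move=> mX; elim: n => // n IH; rewrite -IH.
have -> : X \o iter n.+1 S = (X \o iter n S) \o S by apply/funext => x; rewrite /= -iterSr.
by apply: eq_bigr => i _; rewrite law_shift//; exact: label_iter.
Qed.

Lemma itinerary_entropy_subadditive (I : finType) (X : T -> I) n m : measurable_label X ->
  H (itinerary X (n + m)) <= H (itinerary X n) + H (itinerary X m).
Proof.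
move=> mX; have mn := label_itinerary (n := n) mX; have mm := label_itinerary (n := m) mX.
have mm' := label_iter n mm.
rewrite -[H (itinerary X m)](label_entropy_iter n mm).
apply: le_trans (label_entropy_pair mu mn mm').
pose g (p : {ffun 'I_n -> I} * {ffun 'I_m -> I}) : {ffun 'I_(n + m) -> I} :=
  [ffun i : 'I_(n + m) => match fintype.split i with inl a => p.1 a | inr b => p.2 b end].
apply: (label_entropy_factor _ (g := g)); first exact: label_pair.
move=> x; apply/ffunP => i; rewrite !ffunE /=.
case: splitP => j ->; rewrite !ffunE//.
by rewrite /= addnC iterD.
Qed.

Definition label_entropy_rate (I : finType) (X : T -> I) : R :=
  limn (fun n => n%:R^-1 * H (itinerary X n)).
Local Notation h := label_entropy_rate.

Lemma cvg_label_entropy_rate (I : finType) (X : T -> I) : measurable_label X ->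
  n%:R^-1 * H (itinerary X n) @[n --> \oo] --> h X.
Proof.
move=> mX; pose u n := H (itinerary X n).
have u0 n : 0 <= u n by apply: label_entropy_ge0; exact: label_itinerary.
have [|l [ul lu]] := @fekete R u 1 isT.
  by move=> n m _ _; exact: itinerary_entropy_subadditive.
have : l \is a fin_num.
  rewrite fin_numElt; apply/andP; split.
    apply: (@lt_le_trans _ _ 0%E); first by rewrite ltNyr.
    have cl : cvgn (fun n => (u n / n%:R)%:E) by apply/cvg_ex; exists l.
    rewrite -(cvg_lim _ ul)//; apply: lime_ge => //.
    by apply: nearW => n; rewrite lee_fin divr_ge0.
  by apply: le_lt_trans (lu 1%N isT) _; rewrite ltry.
case: l ul lu => // l ul _ _.
have cl : n%:R^-1 * H (itinerary X n) @[n --> \oo] --> l.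
  move: ul => /fine_cvgP[_ ul].
  by apply: cvg_trans ul; apply: near_eq_cvg; apply: nearW => n /=; rewrite mulrC.
by rewrite /h; move/cvg_lim : (cl) => ->.
Qed.

Lemma partition_entropyE k (xi : T -> 'I_k) : partition_entropy mu S xi = h xi.
Proof.
by rewrite /partition_entropy /h; congr (limn _); apply/funext => n; rewrite join_entropyE.
Qed.

(** The conditional entropy of the X-itinerary given the Z-itinerary grows by at most H(X | Z) <= dl
    per step. In the proof, [s1] separates the new X-label from the old ones given all Z-labels,
    [s2] keeps only the new Z-label for the former, and [s3] only the old Z-labels for the
    latter. *)
Lemma joint_itinerary_entropy (I J : finType) (X : T -> I) (Z : T -> J) dl n :
  measurable_label X -> measurable_label Z ->
  H (fun x => (X x, Z x)) <= H Z + dl ->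
  H (fun x => (itinerary X n x, itinerary Z n x)) <= H (itinerary Z n) + n%:R * dl.
Proof.
move=> mX mZ XZ; elim: n => [|n IH].
  rewrite mul0r addr0.
  apply: (label_entropy_factor _ (g := fun v => (itinerary X 0 point, v))).
    exact: label_itinerary.
  by move=> x /=; congr (_, _); apply/ffunP => -[].
pose A := itinerary X n; pose B := X \o iter n S.
pose C := itinerary Z n; pose E := Z \o iter n S.
have mA : measurable_label A by exact: label_itinerary.
have mB : measurable_label B by exact: label_iter.
have mC : measurable_label C by exact: label_itinerary.
have mE : measurable_label E by exact: label_iter.
have mCE := label_pair mC mE.
have s1 := label_entropy_submodular mu mB mA mCE.
have s2 := label_entropy_submodular mu mB mC mE.
have s3 := label_entropy_submodular mu mA mE mC.
pose snoc (K : finType) (p : K * {ffun 'I_n -> K}) : {ffun 'I_n.+1 -> K} :=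
  [ffun i : 'I_n.+1 => if unlift ord_max i is Some j then p.2 j else p.1].
have snocE (K : finType) (Y : T -> K) x :
    itinerary Y n.+1 x = snoc K (Y (iter n S x), itinerary Y n x).
  apply/ffunP => i; rewrite !ffunE; case: unliftP => [j ->|-> //].
  by rewrite ffunE /= /bump leqNgt ltn_ord.
have e1 : H (fun x => (itinerary X n.+1 x, itinerary Z n.+1 x)) <=
    H (fun x => (B x, A x, (C x, E x))).
  apply: (label_entropy_factor _
    (g := fun w => (snoc I (w.1.1, w.1.2), snoc J (w.2.2, w.2.1)))).
    exact: label_pair (label_pair mB mA) mCE.
  by move=> x; rewrite /= !snocE.
have e2 : H (fun x => (E x, C x)) <= H (itinerary Z n.+1).
  apply: (label_entropy_factor _ (g := fun w : {ffun 'I_n.+1 -> J} =>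
    (w ord_max, [ffun i : 'I_n => w (widen_ord (leqnSn n) i)]))).
    exact: label_itinerary.
  move=> x /=; rewrite ffunE; congr (_, _).
  by apply/ffunP => i; rewrite !ffunE.
have e3 : H (fun x => (B x, (C x, E x))) <= H (fun x => (B x, C x, E x)).
  apply: (label_entropy_factor _ (g := fun w => (w.1.1, (w.1.2, w.2)))) => //.
  exact: label_pair (label_pair mB mC) mE.
have e4 : H (fun x => (A x, (C x, E x))) <= H (fun x => (A x, E x, C x)).
  apply: (label_entropy_factor _ (g := fun w => (w.1.1, (w.2, w.1.2)))) => //.
  exact: label_pair (label_pair mA mE) mC.
have e5 : H (fun x => (B x, E x)) = H (fun x => (X x, Z x)).
  exact: (label_entropy_iter n (label_pair mX mZ)).
have e6 : H E = H Z by exact: label_entropy_iter.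
have IH' : H (fun x => (A x, C x)) <= H C + n%:R * dl by [].
rewrite -natr1 mulrDl mul1r; lra.
Qed.

(** The n-itinerary of the N-blocks of Y is a function of the (n + N)-itinerary of Y. The excess is
    at most the entropy of one N-block, which vanishes after division by n. *)
Lemma label_entropy_rate_le (I J : finType) (X : T -> I) (Y : T -> J) N dl :
  measurable_label X -> measurable_label Y ->
  H (fun x => (X x, itinerary Y N x)) <= H (itinerary Y N) + dl ->
  h X <= h Y + dl.
Proof.
move=> mX mY le; have mZ := label_itinerary (n := N) mY.
have cX := cvg_label_entropy_rate mX; have cY := cvg_label_entropy_rate mY.
have c2 : n%:R^-1 * H (itinerary Y n) + H (itinerary Y N) / n%:R + dl
    @[n --> \oo] --> h Y + 0 + dl.
  apply: cvgD; last exact: cvg_cst.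
  by apply: cvgD => //; exact: cvg_div_natr.
rewrite addr0 in c2.
apply: (ler_cvg_to cX c2); exists 1%N => // n /= n0.
have nn0 : 0 < n%:R :> R by rewrite ltr0n.
have -> : n%:R^-1 * H (itinerary Y n) + H (itinerary Y N) / n%:R + dl =
    n%:R^-1 * (H (itinerary Y n) + H (itinerary Y N) + n%:R * dl).
  by field; rewrite gt_eqF.
rewrite ler_pM2l ?invr_gt0//.
apply: le_trans (_ : H (fun x => (itinerary X n x, itinerary (itinerary Y N) n x)) <= _).
  apply: (label_entropy_factor _ (g := fst)) => //.
  by apply: label_pair; exact: label_itinerary.
apply: le_trans (joint_itinerary_entropy n mX mZ le) _; rewrite lerD2r.
apply: le_trans (itinerary_entropy_subadditive n N mY).
have ltS (i : 'I_n) (j : 'I_N) : (i + j < n + N)%N by have := ltn_ord i; have := ltn_ord j; lia.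
apply: (label_entropy_factor _ (g := fun w : {ffun 'I_(n + N) -> J} =>
  [ffun i : 'I_n => [ffun j : 'I_N => w (Ordinal (ltS i j))]])).
  exact: label_itinerary.
move=> x; apply/ffunP => i; rewrite !ffunE; apply/ffunP => j; rewrite !ffunE /=.
by rewrite addnC iterD.
Qed.

End dynamics.

(** * Generation by truncated symbols *)

Section kolmogorov_sinai.
Context {R : realType} {t : transition_matrix}.
Local Notation X := (borel_shift t).
Local Notation sigma := (@Defs.shift t : X -> X).
Variable mu : probability X R.
Hypothesis inv : Defs.invariant mu sigma.

(** Entropy is defined by finite partitions and the alphabet is infinite, so all symbols from L on
    share one label. *)
Definition truncated_symbol L (x : X) : 'I_L.+1 := inord (minn (Defs.coord x 0) L).

Lemma measurable_symbol a : measurable [set x : X | Defs.coord x 0 = a].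
Proof.
have -> : [set x : X | Defs.coord x 0 = a] = cylinder [:: a].
  by apply/seteqP; split=> x; rewrite /cylinder/=; [move=> e; congr [:: _]|case].
exact: measurable_cylinder.
Qed.

Lemma label_truncated_symbol L : measurable_label (truncated_symbol L).
Proof.
move=> i; have -> : truncated_symbol L @^-1` [set i] =
    \bigcup_(a in [set a | inord (minn a L) = i]) [set x : X | Defs.coord x 0 = a].
  by apply/seteqP; split=> [x xi|x [a ai /= xa]]; [exists (Defs.coord x 0)|rewrite /= /truncated_symbol xa].
by apply: bigcup_measurable => a _; exact: measurable_symbol.
Qed.

(** The length and the truncation level are the same m, so a single parameter refines both and the
    partitions increase with m. *)
Definition truncated_word m : X -> {ffun 'I_m -> 'I_m.+1} :=
  itinerary sigma (@truncated_symbol m) m.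

Lemma label_truncated_word m : measurable_label (truncated_word m).
Proof.
by apply: label_itinerary; [exact: measurable_shift|exact: label_truncated_symbol].
Qed.

Lemma truncated_wordP m (x y : X) : truncated_word m x = truncated_word m y <->
  forall i, (i < m)%N -> minn (Defs.coord x i) m = minn (Defs.coord y i) m.
Proof.
split=> [/ffunP e i im|h].
  have := e (Ordinal im); rewrite !ffunE /truncated_symbol !coord_iter_shift addn0.
  by move=> /(congr1 (@nat_of_ord _)); rewrite !inordK// ltnS geq_minr.
apply/ffunP => i; rewrite !ffunE /truncated_symbol !coord_iter_shift !addn0.
by rewrite h.
Qed.

(** These are the unions of atoms of the finite partition given by [truncated_word m]. *)
Definition determined m (E : set X) := forall x y,
  truncated_word m x = truncated_word m y -> E x -> E y.

Lemma determined_le m n E : (m <= n)%N -> determined m E -> determined n E.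
Proof.
move=> mn dE x y /truncated_wordP xy; apply: dE; apply/truncated_wordP => i im.
have := xy i (leq_trans im mn); have := xy i (leq_trans im mn); lia.
Qed.

Lemma determined_measurable m E : determined m E -> measurable E.
Proof.
move=> dE; have -> : E = truncated_word m @^-1` (truncated_word m @` E).
  apply/seteqP; split=> [x Ex|x [y Ey yx]]; first by exists x.
  exact: dE yx Ey.
exact: label_preimage (@label_truncated_word m).
Qed.

Lemma determined_cylinder w : exists m, determined m (cylinder w).
Proof.
(* Above the largest symbol of w, truncation cannot confuse a symbol of w with another one. *)
exists (maxn (size w) (\max_(a <- w) a).+1) => x y /truncated_wordP xy.
rewrite /cylinder/= => xw; rewrite -[RHS]xw; apply/eq_mkseqP => i iw.
have := xy i (leq_trans iw (leq_maxl _ _)).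
have : (Defs.coord x i <= \max_(a <- w) a)%N.
  apply: (@leq_bigmax_seq _ w predT (fun a => a)) => //.
  by rewrite -xw; apply/mapP; exists i; rewrite // mem_iota.
lia.
Qed.

Lemma determined_bigcup n m (E : nat -> set X) : (forall i, (i < n)%N -> determined m (E i)) ->
  determined m (\bigcup_(i < n) E i).
Proof. by move=> dE x y xy [i /= ni Ex]; exists i => //; exact: dE ni _ _ xy Ex. Qed.

Local Notation pr := (pr mu).

Lemma pr_bigcup_le (F : nat -> set X) n : (forall i, measurable (F i)) ->
  pr (\bigcup_(i < n) F i) <= \sum_(i < n) pr (F i).
Proof.
move=> mF; elim: n => [|n IH].
  by rewrite big_ord0 (_ : \bigcup_(_ in _) _ = set0) ?/pr ?measure0//;
    apply/seteqP; split=> // x [].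
rewrite big_ord_recr/=.
have -> : \bigcup_(i < n.+1) F i = \bigcup_(i < n) F i `|` F n.
  apply/seteqP; split=> x.
    move=> [i /=]; rewrite ltnS leq_eqVlt => /orP[/eqP -> Fx|ni Fx]; first by right.
    by left; exists i.
  case=> [[i /= ni Fx]|Fx]; last by exists n => /=.
  by exists i => //=; exact: ltnW.
apply: le_trans (prU_le _ _ (mF n)) _; last by rewrite lerD2r.
exact: fin_bigcup_measurable.
Qed.

Definition approximable (A : set X) := measurable A /\ forall e, 0 < e ->
  exists m E, determined m E /\ pr ((A `\` E) `|` (E `\` A)) <= e.

(** A countable union is first cut down to finitely many sets by continuity from below. Their
    approximations are then all determined at the largest of the levels involved. *)
Lemma approximable_sigma_algebra : sigma_algebra setT approximable.
Proof.
split.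
- split=> // e e0; exists 0%N, set0; split=> //.
  by rewrite setD0 setU0 /pr measure0 ltW.
- move=> A [mA hA]; rewrite setTD; split; first exact: measurableC.
  move=> e e0; have [m [E [dE Ee]]] := hA e e0; exists m, (~` E); split.
    by move=> x y xy nEx Ey; apply: nEx; apply: dE Ey; rewrite xy.
  rewrite (_ : _ `|` _ = (A `\` E) `|` (E `\` A))//.
  by rewrite !setDE !setCK setUC (setIC _ A) (setIC _ E).
move=> A hA; have mA n : measurable (A n) by case: (hA n).
have mU : measurable (\bigcup_n A n) by exact: bigcup_measurable.
split=> // e e0.
pose B n := \bigcup_(i < n) A i.
have mB n : measurable (B n) by exact: fin_bigcup_measurable.
have [N NB] : exists N, pr (\bigcup_n A n `\` B N) <= e / 2.
  have c : mu (B n) @[n --> \oo] --> mu (\bigcup_n A n).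
    have -> : \bigcup_n A n = \bigcup_n B n.
      apply/seteqP; split=> x; first by move=> [n _ Anx]; exists n.+1 => //; exists n => //=.
      by move=> [n _ [i _ Aix]]; exists i.
    apply: nondecreasing_cvg_mu => //; first exact: bigcup_measurable.
    by move=> n m nm; apply/subsetPset => x [i /= ni Ax]; exists i => //=; exact: leq_trans nm.
  have cp : pr (B n) @[n --> \oo] --> pr (\bigcup_n A n).
    by apply: fine_cvg; rewrite prE// in c.
  move/cvgrPdist_le : cp => /(_ (e / 2)) [|N _ NP]; first by rewrite divr_gt0.
  exists N; have := NP N (leqnn N).
  have BU : B N `<=` \bigcup_n A n by move=> x [i _ Ax]; exists i.
  rewrite /pr/= measureD// ?fin_num_measure//; last first.
    by rewrite ltey_eq fin_num_measure.
  rewrite (setIidr BU) fineB ?fin_num_measure//.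
  exact: le_trans (ler_norm _).
have N0 : 0 < N.+1%:R :> R by rewrite ltr0n.
have /choice[m /choice[E EP]] : forall i, exists m E,
    determined m E /\ pr ((A i `\` E) `|` (E `\` A i)) <= e / 2 / N.+1%:R.
  by move=> i; have [_ h] := hA i; apply: h; rewrite !divr_gt0.
pose M := \max_(i < N) m i.
have dE i : (i < N)%N -> determined M (E i).
  move=> iN; apply: determined_le (proj1 (EP i)).
  exact: (@leq_bigmax _ (fun i : 'I_N => m i) (Ordinal iN)).
have mE i : measurable (E i) by exact: determined_measurable (proj1 (EP i)).
exists M, (\bigcup_(i < N) E i); split; first exact: determined_bigcup.
pose F i := (A i `\` E i) `|` (E i `\` A i).
have mF i : measurable (F i) by apply: measurableU; exact: measurableD.
have mUE : measurable (\bigcup_(i < N) E i) by exact: fin_bigcup_measurable.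
apply: (@le_trans _ _ (pr ((\bigcup_n A n `\` B N) `|` \bigcup_(i < N) F i))).
  apply: pr_le.
  - by apply: measurableU; exact: measurableD.
  - by apply: measurableU; [exact: measurableD|exact: fin_bigcup_measurable].
  move=> x [[[n _ Ax] nE]|[[i /= iN Ex] nA]].
    case: (pselect (B N x)) => [[i /= iN Aix]|nB]; last by left; split=> //; exists n.
    right; exists i => //; left; split=> // Ex; apply: nE; by exists i.
  right; exists i => //; right; split=> // Ax; apply: nA; by exists i.
apply: le_trans (prU_le _ _ _) _.
- exact: measurableD.
- exact: fin_bigcup_measurable.
have : \sum_(i < N) pr (F i) <= e / 2.
  apply: (@le_trans _ _ (\sum_(i < N) e / 2 / N.+1%:R)).
    by apply: ler_sum => i _; case: (EP i).
  rewrite sumr_const card_ord -[_ *+ N]mulr_natr.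
  rewrite [leRHS](_ : _ = e / 2 / N.+1%:R * N.+1%:R); last by rewrite divfK// gt_eqF.
  by rewrite ler_pM2l ?divr_gt0// ler_nat.
have := @pr_bigcup_le F N mF; lra.
Qed.

Lemma approximable_measurable (A : set X) : measurable A -> approximable A.
Proof.
apply: (borel_sub_sigma_algebra approximable_sigma_algebra) => w.
split=> [|e e0]; first exact: measurable_cylinder.
have [m dm] := determined_cylinder w; exists m, (cylinder w); split=> //.
by rewrite setDv setU0 /pr measure0 ltW.
Qed.

(** Each atom of xi is approximated by a set determined by truncated words. Off a set of measure at
    most s^2, xi is then a function g of the truncated word, and [label_entropy_close] bounds the
    conditional entropy. *)
Lemma kolmogorov_sinai k (xi : X -> 'I_k) dl : measurable_label xi -> 0 < dl ->
  exists L, label_entropy_rate mu sigma xi <=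
    label_entropy_rate mu sigma (truncated_symbol L) + dl.
Proof.
move=> mxi dl0.
(* Chosen so that the error k^2 (3 s) of [label_entropy_close] is at most dl when s <= dl / K; the
   summand 1 keeps K positive. *)
pose K : R := #|{: 'I_k * 'I_k}|%:R * 3 + 1.
have K0 : 0 < K by rewrite ltr_wpDl.
pose s := Num.min 1 (dl / K).
have s0 : 0 < s by rewrite lt_min ltr01 divr_gt0.
have s1 : s <= 1 by rewrite ge_min lexx.
have sK : #|{: 'I_k * 'I_k}|%:R * (3 * s) <= dl.
  apply: (@le_trans _ _ (K * s)).
    by rewrite mulrA ler_pM2r// /K lerDl.
  by rewrite mulrC -ler_pdivlMr// ge_min lexx orbT.
have k0 : (0 < k)%N by case: (k) (xi point) => // -[].
have kR : 0 < k%:R :> R by rewrite ltr0n.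
have /choice[m /choice[E EP]] : forall j : 'I_k,
    exists m E, determined m E /\ pr ((xi @^-1` [set j] `\` E) `|` (E `\` xi @^-1` [set j])) <= s ^+ 2 / k%:R.
  by move=> j; apply: (approximable_measurable (mxi j)).2; rewrite divr_gt0// exprn_gt0.
pose L := \max_(i < k) m i.
have dE i : determined L (E i).
  apply: determined_le (proj1 (EP i)).
  exact: (@leq_bigmax _ (fun i : 'I_k => m i) i).
have mE i : measurable (E i) by exact: determined_measurable (proj1 (EP i)).
pose eta := truncated_word L.
(* A point outside all the error sets F j lies in exactly one E j, the one for its own label, so the
   choice made by g is forced there. *)
pose g w : 'I_k := odflt (xi point) [pick j | `[<exists x, eta x = w /\ E j x>]].
pose F j := (xi @^-1` [set j] `\` E j) `|` (E j `\` xi @^-1` [set j]).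
have mF i : measurable (F i) by apply: measurableU; exact: measurableD.
have mbad : measurable [set x | xi x <> g (eta x)].
  have -> : [set x | xi x <> g (eta x)] = (fun x => (xi x, eta x)) @^-1` [set w | w.1 <> g w.2].
    by [].
  apply: label_preimage; apply: label_pair => //; exact: label_truncated_word.
have bad : pr [set x | xi x <> g (eta x)] <= s ^+ 2.
  pose F' i := if insub i is Some j then F j else set0.
  have mF' i : measurable (F' i) by rewrite /F'; case: insubP.
  apply: (@le_trans _ _ (pr (\bigcup_(i < k) F' i))).
    apply: pr_le => //; first exact: fin_bigcup_measurable.
    move=> x; apply: contra_notP => nF.
    have Ej j : E j x <-> xi x = j.
      have nFj : ~ F j x.
        by move=> Fj; apply: nF; exists j; rewrite /= ?ltn_ord// /F' valK.
      move: nFj; rewrite /F /setU /setD /=; case: (pselect (E j x)); case: (pselect (xi x = j)); tauto.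
    rewrite /g; case: pickP => [j /asboolP[y [yx Ey]]|/(_ (xi x))].
      by apply/Ej; exact: dE yx Ey.
    by move=> /asboolP[]; exists x; split=> //; exact/Ej.
  apply: le_trans (pr_bigcup_le k mF') _.
  apply: (@le_trans _ _ (\sum_(i < k) s ^+ 2 / k%:R)).
    by apply: ler_sum => i _; rewrite /F' valK; case: (EP i).
  by rewrite sumr_const card_ord -[_ *+ k]mulr_natr divfK// gt_eqF.
exists L; apply: (label_entropy_rate_le measurable_shift inv mxi (@label_truncated_symbol L) (N := L)).
have := label_entropy_close mxi (@label_truncated_word L) _ bad.
rewrite s0 s1 => /(_ isT) /le_trans; apply.
by rewrite lerD2l.
Qed.

End kolmogorov_sinai.

(** * Upper bound of the variational principle *)

Section probability_integrals.
Context {R : realType} {d : measure_display} {T : measurableType d}.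
Variable mu : probability T R.
Local Open Scope ereal_scope.

Lemma integral_constant (b : R) : \int[mu]_x b%:E = b%:E.
Proof.
by have := integral_cst mu measurableT b%:E; rewrite /cst /= => ->;
  rewrite probability_setT mule1.
Qed.

Variables (h : T -> R) (b : R).
Hypotheses (mh : measurable_fun setT h) (hb : forall x, (h x <= b)%R).

Let g : T -> \bar R := fun x => (h x)%:E.

Let mg : measurable_fun setT g.
Proof. exact/measurable_EFinP. Qed.

Lemma bounded_above_integral_pos : \int[mu]_x g^\+ x < +oo.
Proof.
apply: (@le_lt_trans _ _ (\int[mu]_x (Num.max b 0)%:E)); last first.
  by rewrite integral_constant ltry.
apply: ge0_le_integral => //.
- exact: measurable_funepos.
- by move=> x _; rewrite funeposE /g -EFin_max lee_fin ge_max !le_max hb lexx !orbT.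
Qed.

(** This holds even if the integral is -oo: when b - h has infinite integral, so has the negative
    part of h, because b - h <= max(b, 0) + h^-. *)
Lemma bounded_above_integral : \int[mu]_x g x = b%:E - \int[mu]_x (b - h x)%:E.
Proof.
have mbh : measurable_fun setT (fun x => (b - h x)%:E).
  by apply/measurable_EFinP; apply: measurable_funB.
have bh0 x : 0 <= (b - h x)%:E by rewrite lee_fin subr_ge0.
have [fin|] := ltP (\int[mu]_x (b - h x)%:E) +oo.
  have ibh : mu.-integrable setT (EFin \o (fun x => b - h x)%R).
    apply/integrableP; split => //.
    rewrite (eq_integral (fun x => (b - h x)%:E))// => x _.
    by rewrite /= ger0_norm// subr_ge0.
  have := @integralB_EFin _ _ _ mu setT (cst b) (fun x => b - h x)%R measurableT
    (finite_measure_integrable_cst mu b measurableT) ibh.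
  rewrite /= integral_constant => <-; apply: eq_integral => x _.
  by rewrite -EFinB opprB addrC subrK.
rewrite leye_eq => /eqP inf; rewrite inf addeNy.
rewrite integralE; have pfin := bounded_above_integral_pos.
suff -> : \int[mu]_x g^\- x = +oo by rewrite addeNy.
have bb : \int[mu]_x (Num.max b 0)%:E = (Num.max b 0)%:E by rewrite integral_constant.
have : \int[mu]_x (b - h x)%:E <= \int[mu]_x ((Num.max b 0)%:E + g^\- x).
  apply: ge0_le_integral => //.
  - by apply: emeasurable_funD => //; exact: measurable_funeneg.
  - move=> x _; rewrite funenegE /g -EFinN -EFin_max -EFinD lee_fin.
    by apply: lerD; rewrite le_max lexx.
rewrite ge0_integralD//; last 2 first.
- by move=> x _; rewrite lee_fin le_max lexx orbT.
- exact: measurable_funeneg.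
rewrite inf bb leye_eq => /eqP.
by case: (\int[mu]_x g^\- x).
Qed.

End probability_integrals.

Section simple_integral.
Context {R : realType} {d : measure_display} {T : measurableType d}.
Variables (mu : probability T R) (I : finType) (X : T -> I) (g : I -> R).
Hypothesis mX : measurable_label X.
Local Open Scope ereal_scope.

Let gE x : (g (X x))%:E = \sum_i (g i)%:E * (\1_(X @^-1` [set i]) x)%:E.
Proof.
rewrite (bigD1 (X x))//= indicE mem_set//= mule1 big1 ?adde0// => i iX.
by rewrite indicE memNset ?mule0//= => e; rewrite e eqxx in iX.
Qed.

Lemma integrable_label : mu.-integrable setT (fun x => (g (X x))%:E).
Proof.
apply: (eq_integrable _ _ _ (fun x _ => esym (gE x))) => //.
apply: integrable_sum => // i _; apply: integrableZl => //.
exact: integrable_indic.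
Qed.

Lemma integral_label : \int[mu]_x (g (X x))%:E = (\sum_i law mu X i * g i)%:E.
Proof.
under eq_integral do rewrite gE.
rewrite integral_sum//; last first.
  by move=> i; apply: integrableZl => //; exact: integrable_indic.
rewrite -sumEFin; apply: eq_bigr => i _.
rewrite integralZl//; last exact: integrable_indic.
rewrite integral_indic// setIT; transitivity ((g i)%:E * (law mu X i)%:E).
  by congr (_ * _); exact: prE.
by rewrite -EFinM mulrC.
Qed.

End simple_integral.

(** * Integrals and limits of log f_n *)

Section mean_log.
Context {R : realType} {t : transition_matrix}.
Local Notation X := (borel_shift t).
Local Notation sigma := (@Defs.shift t : X -> X).
Variables (f : nat -> markov_shift t -> R) (C B : R).
Hypotheses (fp : positive_seq f) (fc : forall n, (0 < n)%N -> continuous (f n))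
  (C0 : 0 < C) (fC : submultiplicative f C) (fB : forall x, f 1%N x <= B).
Variable mu : probability X R.
Hypothesis inv : Defs.invariant mu sigma.

Lemma measurable_ln_seq n : (0 < n)%N -> measurable_fun setT (fun x : X => ln (f n x)).
Proof.
move=> n0; apply: (measurableT_comp (@measurable_ln R)).
exact: continuous_measurable_shift (fc n0).
Qed.

Let B0 : 0 < B. Proof. exact: lt_le_trans (fp point (isT : (0 < 1)%N)) (fB point). Qed.
Let L := ln (B * C).

(** C f_n is submultiplicative along orbits and C f_1 <= B C, hence C f_n <= (B C)^n. *)
Lemma ln_seq_le n x : (0 < n)%N -> ln (f n x) <= n%:R * L - ln C.
Proof.
move=> n0; suff : f n x * C <= (B * C) ^+ n.
  rewrite -ler_ln ?posrE ?mulr_gt0 ?exprn_gt0 ?mulr_gt0 ?fp//.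
  by rewrite lnM ?posrE ?fp// lnXn ?mulr_gt0// -/L -[L *+ n]mulr_natl; lra.
case: n n0 => // n _; elim: n x => [|n IH] x; first by rewrite expr1 ler_pM2r.
apply: (@le_trans _ _ (C * f n.+1 x * f 1%N (iter n.+1 (@Defs.shift t) x) * C)).
  by rewrite ler_pM2r// -[n.+2]addn1 fC.
have -> : C * f n.+1 x * f 1%N (iter n.+1 (@Defs.shift t) x) * C =
  (f 1%N (iter n.+1 (@Defs.shift t) x) * C) * (f n.+1 x * C) by ring.
rewrite exprS; apply: ler_pM; [| |by rewrite ler_pM2r|exact: IH].
- by rewrite ltW// mulr_gt0// fp.
- by rewrite ltW// mulr_gt0// fp.
Qed.

(* Nonnegative and superadditive along orbits, so that its integrals always make
   sense in [0, +oo] and Fekete's lemma applies to them. *)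
Definition deficit n (x : X) : R := n%:R * L - ln C - ln (f n x).
Local Notation G := deficit.
Definition deficit_integral n : \bar R := (\int[mu]_x (G n x)%:E)%E.
Local Notation A := deficit_integral.

Lemma deficit_ge0 n x : (0 < n)%N -> 0 <= G n x.
Proof. by move=> n0; rewrite subr_ge0 ln_seq_le. Qed.

Lemma measurable_deficit n : (0 < n)%N -> measurable_fun setT (G n).
Proof.
by move=> n0; apply: measurable_funB => //; exact: measurable_ln_seq.
Qed.

Lemma deficit_integral_ge0 n : (0 < n)%N -> (0 <= A n)%E.
Proof. by move=> n0; apply: integral_ge0 => x _; rewrite lee_fin deficit_ge0. Qed.

Lemma integral_iter_shift (h : X -> R) n : measurable_fun setT h -> (forall x, 0 <= h x) ->
  (\int[mu]_x (h (iter n (@Defs.shift t) x))%:E = \int[mu]_x (h x)%:E)%E.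
Proof.
move=> mh h0; elim: n => // n IH; rewrite -[RHS]IH.
pose k (x : X) : \bar R := (h (iter n (@Defs.shift t) x))%:E.
have mk : measurable_fun setT k.
  apply/measurable_EFinP; apply: (measurableT_comp mh); exact: measurable_iter_shift.
have := @ge0_integral_pushforward _ _ X X R _ (@measurable_shift t) mu setT k measurableT mk.
rewrite (eq_measure_integral mu); last first.
- by move=> ? U mU _; exact: inv.
- exact: measurable_shift.
move=> -> //; last by move=> x _; rewrite lee_fin.
by rewrite preimage_setT; apply: eq_integral => x _; rewrite /k /= -iterSr.
Qed.

Lemma deficit_integral_superadditive n m : (0 < n)%N -> (0 < m)%N ->
  (A n + A m <= A (n + m)%N)%E.
Proof.
move=> n0 m0.
have mGm := measurable_deficit m0; have mGn := measurable_deficit n0.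
rewrite /A -[X in (_ + X)%E](integral_iter_shift n mGm); last by move=> x; exact: deficit_ge0.
have mi : measurable_fun setT (fun x : X => (G m (iter n (@Defs.shift t) x))%:E).
  by apply/measurable_EFinP; apply: (measurableT_comp mGm); exact: measurable_iter_shift.
have mGn' : measurable_fun setT (fun x => (G n x)%:E) by exact/measurable_EFinP.
have Gn0 (x : X) : (0 <= (G n x)%:E)%E by rewrite lee_fin deficit_ge0.
have Gm0 (x : X) : (0 <= (G m (iter n (@Defs.shift t) x))%:E)%E by rewrite lee_fin deficit_ge0.
rewrite -(ge0_integralD mu measurableT (fun x _ => Gn0 x) mGn' (fun x _ => Gm0 x) mi).
apply: ge0_le_integral => //.
- by move=> x _; rewrite adde_ge0.
- exact: emeasurable_funD.
- by apply/measurable_EFinP; apply: measurable_deficit; rewrite addn_gt0 n0.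
move=> x _; rewrite -EFinD lee_fin /G.
have := fC x n0 m0.
rewrite -ler_ln ?posrE ?mulr_gt0 ?fp ?addn_gt0 ?n0//.
by rewrite !lnM ?posrE ?mulr_gt0 ?fp// natrD; lra.
Qed.

Lemma mean_logE n : (0 < n)%N ->
  mean_log f mu n = ((n%:R^-1)%:E * ((n%:R * L - ln C)%:E - A n))%E.
Proof.
move=> n0; congr (_ * _)%E.
have mln := measurable_ln_seq n0.
exact: (bounded_above_integral mu mln (fun x => ln_seq_le x n0)).
Qed.

Lemma integrals_defined_bounded : integrals_defined f mu.
Proof.
move=> n n0; left; have mln := measurable_ln_seq n0.
exact: (bounded_above_integral_pos mu mln (fun x => ln_seq_le x n0)).
Qed.

(** If one deficit has infinite integral, superadditivity makes all later ones infinite and the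
    limit is -oo. Otherwise Fekete's lemma applies to minus the integrals. The last clause gives
    back integrability of all log f_n from a limit above -oo. *)
Lemma mean_log_cvg : exists l : \bar R, (mean_log f mu @ \oo --> l)%E /\
  ((-oo < l)%E -> l \is a fin_num /\ forall n, (0 < n)%N -> A n \is a fin_num).
Proof.
have [[k [k0 Ak]]|fin] := pselect (exists k, (0 < k)%N /\ A k = +oo%E).
  exists -oo%E; split; last by rewrite ltxx.
  apply: cvg_near_cst; exists k.+1 => // n /= kn; have n0 : (0 < n)%N by lia.
  have An : A n = +oo%E.
    have nk0 : (0 < n - k)%N by lia.
    have := deficit_integral_superadditive k0 nk0; rewrite subnKC; last by lia.
    rewrite Ak addye; first by rewrite leye_eq => /eqP.
    by rewrite gt_eqF// (lt_le_trans _ (deficit_integral_ge0 nk0))// ltNyr.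
  by rewrite mean_logE// An addeNy gt0_muleNy// lte_fin invr_gt0 ltr0n.
have Afin n : (0 < n)%N -> A n \is a fin_num.
  move=> n0; rewrite ge0_fin_numE ?deficit_integral_ge0// ltey.
  by apply/eqP => An; apply: fin; exists n.
pose a n := - fine (A n).
have [|l [al la]] := @fekete R a 1 isT.
  move=> n m n0 m0; rewrite /a -opprD lerN2 -lee_fin EFinD !fineK ?Afin//; last by rewrite addn_gt0 n0.
  exact: deficit_integral_superadditive.
have cL : (L - ln C / n%:R)%:E @[n --> \oo] --> (L - 0)%:E.
  apply: cvg_EFin; first exact: nearW.
  by apply: cvgB; [exact: cvg_cst|exact: cvg_div_natr].
have cl : (mean_log f mu @ \oo --> L%:E + l)%E.
  have := cvgeD _ cL al; rewrite subr0 fin_num_adde_defr// => /(_ _ isT) h.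
  apply: cvg_trans h; apply: near_eq_cvg; exists 1%N => // n /= n0.
  rewrite mean_logE// -[A n]fineK ?Afin// -EFinB -EFinM -EFinD; congr (_%:E).
  by rewrite /a; field; rewrite pnatr_eq0 -lt0n.
exists (L%:E + l)%E; split=> // lgt; split=> //.
move: lgt; case: (l) la => [r|la|//].
  by move=> _ _; rewrite -EFinD.
by have := la 1%N isT; rewrite leye_eq.
Qed.

End mean_log.

(** * Entropy plus integral is at most the pressure *)

Section variational_inequality.
Context {R : realType} {t : transition_matrix}.
Local Notation X := (borel_shift t).
Local Notation sigma := (@Defs.shift t : X -> X).
Variables (f : nat -> markov_shift t -> R) (M C B : R).
Hypotheses (fp : positive_seq f) (fc : forall n, (0 < n)%N -> continuous (f n))
  (M1 : 1 <= M) (fM : distortion f M)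
  (C0 : 0 < C) (fC : submultiplicative f C) (fB : forall x, f 1%N x <= B).
Variable mu : probability X R.
Hypothesis inv : Defs.invariant mu sigma.
Local Notation H := (label_entropy mu).

Lemma itinerary_truncated_agree L n (x y : X) : agree n x y ->
  itinerary sigma (@truncated_symbol t L) n x = itinerary sigma (@truncated_symbol t L) n y.
Proof.
move=> xy; apply/ffunP => i; rewrite !ffunE /truncated_symbol !coord_iter_shift addn0.
by rewrite xy.
Qed.

(** One truncated itinerary may stand for infinitely many words. Giving it the sum r of their
    suprema yields f_n <= r along the itinerary and a total of exactly Z_n, so Gibbs' inequality
    applies on a finite set with r / Z_n. *)
Lemma entropy_plus_integral_le L n : (0 < n)%N ->
  mu.-integrable setT (log_fun f n) ->
  ((H (itinerary sigma (@truncated_symbol t L) n))%:E + \int[mu]_x log_fun f n x <=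
   lne (partition_function f n))%E.
Proof.
move=> n0 int; set a := itinerary _ _ n.
have ma : measurable_label a.
  by apply: label_itinerary; [exact: measurable_shift|exact: label_truncated_symbol].
have [fin|] := ltP (partition_function f n) +oo%E; last first.
  by rewrite leye_eq => /eqP ->; rewrite leey.
have Z0 := partition_gt0 fp n0.
pose z := fine (partition_function f n).
have zE : partition_function f n = z%:E.
  by rewrite /z fineK// ge0_fin_numE// ltW.
have z0 : 0 < z by rewrite -lte_fin -zE.
pose S v := sup_on [set: markov_shift t] f n v.
have S0 v : words [set: markov_shift t] n v -> (0 <= S v)%E.
  move=> /wordsP[x _ ->]; apply: le_trans (le_sup_on f n _) => //.
  by rewrite lee_fin ltW// fp.
(* Each word is assigned to the truncated itinerary of its chosen point; all points of its cylinder
   have the same one. *)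
pose W w := (\esum_(v in words [set: markov_shift t] n)
  (if a (point_in v) == w then S v else 0))%E.
have W0 w : (0 <= W w)%E by apply: esum_ge0 => v vW; case: ifP => // _; exact: S0.
have sumW : (\sum_w W w = z%:E)%E.
  rewrite -esum_sum; last by move=> v w vW _; case: ifP => // _; exact: S0.
  rewrite -zE; apply: eq_esum => v vW.
  by rewrite -big_mkcond/= (big_pred1 (a (point_in v)))// => w; rewrite eq_sym.
have Wfin w : W w \is a fin_num.
  rewrite ge0_fin_numE//; apply: le_lt_trans (ltry z).
  by rewrite -sumW (bigD1 w)//= leeDl// sume_ge0.
pose r w := fine (W w).
have rE w : W w = (r w)%:E by rewrite /r fineK.
have r0 w : 0 <= r w by rewrite -lee_fin -rE.
have sumr : \sum_w r w = z.
  by apply: EFin_inj; rewrite -sumW -sumEFin; apply: eq_bigr => w _; rewrite rE.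
have fr x : f n x <= r (a x).
  rewrite -lee_fin -rE; apply: esum_ge; exists [set mkseq (x : markov_shift t) n].
    by split=> // _ ->; apply/wordsP; exists x.
  rewrite fsbig_set1 ifT; first exact: (@le_sup_on _ _ setT f n x I).
  by apply/eqP; apply: itinerary_truncated_agree; exact: agree_point_in.
have rpos x : 0 < r (a x) by apply: lt_le_trans (fr x); exact: fp.
have int_le : (\int[mu]_x log_fun f n x <= (\sum_w law mu a w * ln (r w))%:E)%E.
  rewrite -(integral_label mu (fun w => ln (r w)) ma).
  apply: le_integral => //; first exact: (integrable_label mu (fun w => ln (r w)) ma).
  by move=> x _; rewrite lee_fin ler_ln ?posrE ?fp.
apply: le_trans (leeD2l _ int_le) _.
rewrite zE lne_EFin// -EFinD lee_fin.
have sp := sum_law mu ma.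
have := @gibbs R _ (index_enum _) (law mu a) (fun w => r w / z) (law_ge0 mu a)
  (fun w => divr_ge0 (r0 w) (ltW z0)) _ _.
have lr w : 0 < law mu a w -> 0 < r w.
  move=> lw; have : a @^-1` [set w] !=set0.
    apply/set0P/eqP => e; move: lw; rewrite /law e /pr measure0 ltxx//.
  by move=> [x <-].
have h1 w : 0 < law mu a w -> 0 < r w / z by move=> /lr rw; rewrite divr_gt0.
have h2 : \sum_w r w / z <= \sum_w law mu a w.
  by rewrite -big_distrl/= sumr divff ?gt_eqF// sp.
move=> /(_ h1 h2).
have -> : \sum_w law mu a w * ln (r w / z) = \sum_w law mu a w * ln (r w) - ln z.
  rewrite -[ln z]mul1r -sp big_distrl/= -sumrB; apply: eq_bigr => w _.
  have [->|lw] := eqVneq (law mu a w) 0; first by rewrite !mul0r subr0.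
  have {}lw : 0 < law mu a w by rewrite lt_neqAle eq_sym lw law_ge0.
  by rewrite ln_div ?posrE ?lr// mulrBr.
have -> : H a = - \sum_w law mu a w * ln (law mu a w) by rewrite /label_entropy -sumrN.
lra.
Qed.

(** The finite-time inequality passes to the limit for each truncation level, and [kolmogorov_sinai]
    compares every finite partition with these. *)
Lemma variational_inequality l : (mean_log f mu @ \oo --> l)%E -> (-oo < l)%E ->
  (entropy mu sigma + l <= pressure f)%E.
Proof.
move=> ml lgt.
have [l' [ml' fin]] := mean_log_cvg fp fc C0 fC fB inv.
have ll' : l = l' by rewrite -(cvg_lim _ ml)// (cvg_lim _ ml').
have [lfin Afin] : l \is a fin_num /\ forall n, (0 < n)%N ->
    deficit_integral f C B mu n \is a fin_num by rewrite ll'; apply: fin; rewrite -ll'.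
(* log f_n is a constant minus the deficit, whose integral is finite because l > -oo. *)
have intf n : (0 < n)%N -> mu.-integrable setT (log_fun f n).
  move=> n0; have mdef : measurable_fun setT (deficit f C B n) by exact: measurable_deficit.
  have idef : mu.-integrable setT (EFin \o deficit f C B n).
    apply/integrableP; split; first exact/measurable_EFinP.
    rewrite (eq_integral (fun x => (deficit f C B n x)%:E)).
      by have := Afin n n0; rewrite ge0_fin_numE// deficit_integral_ge0.
    by move=> x _; rewrite /= ger0_norm// deficit_ge0.
  have := integrableB measurableT
    (finite_measure_integrable_cst mu (n%:R * ln (B * C) - ln C) measurableT) idef.
  apply: eq_integrable => // x _; rewrite /= -EFinB /deficit /log_fun; congr (_%:E); ring.
have key L : ((label_entropy_rate mu sigma (@truncated_symbol t L))%:E + l <= pressure f)%E.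
  have cH := cvg_label_entropy_rate measurable_shift inv (@label_truncated_symbol t L).
  have cHe : (n%:R^-1 * H (itinerary sigma (@truncated_symbol t L) n))%:E @[n --> \oo] -->
      (label_entropy_rate mu sigma (@truncated_symbol t L))%:E.
    by apply: cvg_EFin => //; exact: nearW.
  have := cvgeD _ cHe ml; rewrite fin_num_adde_defl// => /(_ _ isT) c.
  have [_ <-] := cvg_limn_einf_sup c.
  apply: (@le_limn_esup _ _ _ 1) => n n0.
  have nn0 : 0 < n%:R^-1 :> R by rewrite invr_gt0 ltr0n.
  rewrite /log_rate /mean_log EFinM -muleDr ?fin_num_adde_defr//.
  by apply: lee_wpmul2l; [rewrite lee_fin ltW|apply: entropy_plus_integral_le => //; exact: intf].
rewrite -leeBrDr//; apply: ge_ereal_sup => _ [k [xi [mxi ->]]].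
rewrite leeBrDr//; apply/lee_addgt0Pr => e e0.
rewrite partition_entropyE.
have [L hL] := kolmogorov_sinai inv mxi e0.
apply: (@le_trans _ _ ((label_entropy_rate mu sigma (@truncated_symbol t L) + e)%:E + l)%E).
  by rewrite leeD2r// lee_fin.
by rewrite EFinD addeAC leeD2r.
Qed.

End variational_inequality.

(** * Lower bound of the variational principle *)

Section allwords.
Implicit Types (A w : seq nat).

Fixpoint allwords A n : seq (seq nat) :=
  if n is n'.+1 then [seq a :: w | a <- A, w <- allwords A n'] else [:: [::]].

Lemma mem_allwords A n w : (w \in allwords A n) = (size w == n) && all (mem A) w.
Proof.
elim: n w => [|n IH] [|a w] //=.
- by apply/negP => /allpairsP[[b v] [_ _]].
rewrite eqSS; apply/allpairsP/andP => [[[b v] /= [bA]]|[sw /andP[aA wA]]].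
  by rewrite IH => /andP[sv vA] [-> ->]; rewrite sv vA andbT.
by exists (a, w); rewrite IH sw wA.
Qed.

Lemma allwords_uniq A n : uniq A -> uniq (allwords A n).
Proof.
move=> uA; elim: n => // n IH /=; apply: allpairs_uniq => //.
by move=> [a v] [b u] _ _ [-> ->].
Qed.

Lemma size_allwords A n : size (allwords A n) = (size A ^ n)%N.
Proof. by elim: n => // n IH /=; rewrite size_allpairs IH expnS. Qed.

Variable V : nmodType.
Implicit Types (F : seq nat -> V).

Lemma sum_allwordsS A n F :
  \sum_(w <- allwords A n.+1) F w = \sum_(a <- A) \sum_(w <- allwords A n) F (a :: w).
Proof. by rewrite /= big_allpairs_dep. Qed.

Lemma sum_allwords_cat A n m F :
  \sum_(w <- allwords A (n + m)) F w =
  \sum_(u <- allwords A n) \sum_(v <- allwords A m) F (u ++ v).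
Proof.
elim: n F => [|n IH] F; first by rewrite add0n big_seq1.
rewrite addSn !sum_allwordsS; apply: eq_bigr => a _.
by rewrite (IH (fun w => F (a :: w))).
Qed.

Lemma sum_allwords1 A F : \sum_(w <- allwords A 1) F w = \sum_(a <- A) F [:: a].
Proof. by rewrite sum_allwordsS; apply: eq_bigr => a _; rewrite big_seq1. Qed.

Lemma sum_allwords_rcons A n F :
  \sum_(w <- allwords A n.+1) F w = \sum_(w <- allwords A n) \sum_(a <- A) F (rcons w a).
Proof.
rewrite -addn1 sum_allwords_cat; apply: eq_bigr => w _; rewrite sum_allwords1.
by apply: eq_bigr => a _; rewrite cats1.
Qed.

End allwords.
Arguments allwords A n : simpl never.

(** * Growth of the weights over a finite alphabet *)

Section finite_alphabet.
Context {R : realType} {t : transition_matrix}.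
Local Notation X := (markov_shift t).
Implicit Types (x y z : X) (A w : seq nat).
Variables (f : nat -> X -> R) (M : R).
Hypotheses (fp : positive_seq f) (M1 : 1 <= M) (fM : distortion f M).

Let M0 : 0 < M. Proof. exact: lt_le_trans M1. Qed.

Definition point_over A w : X := xget point (cylinder w `&` over A).

(** Words that do not occur get weight 0, so sums run over all words over [A] and split freely along
    concatenations. *)
Definition weight A n w : R :=
  if `[< words (@over t A) n w >] then f n (point_over A w) else 0.

Definition total_weight A n : R := \sum_(w <- allwords A n) weight A n w.

Lemma point_overP A n w : words (@over t A) n w ->
  @over t A (point_over A w) /\ mkseq (point_over A w) n = w.
Proof.
move=> [<- [x [xw Ax]]]; rewrite /point_over; case: xgetP => [y _ [yw Ay]//|].
by move=> /(_ x) /=; case; split.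
Qed.

Lemma words_mkseq A x n : over A x -> words (@over t A) n (mkseq x n).
Proof. by move=> Ax; apply/wordsP; exists x. Qed.

Lemma mkseq_allwords A x n : over A x -> mkseq x n \in allwords A n.
Proof.
move=> Ax; rewrite mem_allwords size_mkseq eqxx; apply/allP => a /mapP[i _ ->].
exact: Ax.
Qed.

Lemma agree_point_over A n x : over A x -> agree n (point_over A (mkseq x n)) x.
Proof. by move=> Ax; apply/eq_mkseqP; case: (point_overP (words_mkseq n Ax)). Qed.

Lemma weight_ge0 A n w : (0 < n)%N -> 0 <= weight A n w.
Proof. by move=> n0; rewrite /weight; case: ifP => // _; rewrite ltW// fp. Qed.

Lemma weight_mkseq A n x : (0 < n)%N -> over A x -> f n x <= M * weight A n (mkseq x n).
Proof.
move=> n0 Ax; rewrite /weight ifT; last by apply/asboolP; exact: words_mkseq.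
by apply: fM => //; apply: agree_sym; exact: agree_point_over.
Qed.

Lemma over_iter_shift A x n : over A x -> over A (iter n (@Defs.shift t) x).
Proof. by move=> Ax i; rewrite coord_iter_shift; exact: Ax. Qed.

(** A pair (u, v) and a length k occupy fixed positions in a word of length n + m + k, so different
    pairs are charged to different glued words. *)
Lemma total_weight_gluing A (K : seq nat) D n m : 0 < D -> gluing (over A) f K D ->
  (0 < n)%N -> (0 < m)%N ->
  total_weight A n * total_weight A m <=
  M / D * \sum_(k <- K) total_weight A (n + m + k).
Proof.
move=> D0 glue n0 m0; rewrite /total_weight.
have -> : \sum_(k <- K) \sum_(w <- allwords A (n + m + k)) weight A (n + m + k) w =
    \sum_(k <- K) \sum_(u <- allwords A n) \sum_(v <- allwords A m)
      \sum_(w <- allwords A k) weight A (n + m + k) (u ++ w ++ v).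
  apply: eq_bigr => k _; have -> : (n + m + k = n + (k + m))%N by lia.
  rewrite sum_allwords_cat; apply: eq_bigr => u _.
  by rewrite sum_allwords_cat exchange_big.
rewrite exchange_big/= big_distrl big_distrr/=; apply: ler_sum => u _.
rewrite exchange_big/= !big_distrr/=; apply: ler_sum => v _.
have W0 k w : 0 <= weight A (n + m + k) w by rewrite weight_ge0// !addn_gt0 n0.
have S0 k : 0 <= \sum_(w <- allwords A k) weight A (n + m + k) (u ++ w ++ v).
  exact: sumr_ge0.
have MD0 : 0 < M / D by rewrite divr_gt0.
rewrite {1}/weight; case: asboolP => [uW|_]; last first.
  by rewrite mul0r; apply: mulr_ge0; [exact: ltW|exact: sumr_ge0].
rewrite {1}/weight; case: asboolP => [vW|_]; last first.
  by rewrite mulr0; apply: mulr_ge0; [exact: ltW|exact: sumr_ge0].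
have [Au uE] := point_overP uW; have [Av vE] := point_overP vW.
have [k kK [z [Az zu zv zf]]] := glue n m _ _ n0 m0 Au Av.
pose w := mkseq (iter n (@Defs.shift t) z) k.
have wA : w \in allwords A k by apply: mkseq_allwords; exact: over_iter_shift.
have zE : mkseq z (n + m + k) = u ++ w ++ v.
  have -> : (n + m + k = n + (k + m))%N by lia.
  rewrite /mkseq iotaD map_cat iotaD map_cat; congr (_ ++ (_ ++ _)).
  - by rewrite -uE; exact/eq_mkseqP.
  - rewrite /w /mkseq -[(0 + n)%N]addn0 iotaDl -map_comp; apply: eq_map => i /=.
    by rewrite coord_iter_shift.
  - rewrite -vE; have /eq_mkseqP <- := zv.
    rewrite /mkseq -[(0 + n + k)%N]addn0 iotaDl -map_comp; apply: eq_map => i /=.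
    by rewrite coord_iter_shift addn0.
have h1 : f n (point_over A u) * f m (point_over A v) <= M / D * weight A (n + m + k) (u ++ w ++ v).
  rewrite mulrAC ler_pdivlMr// mulrC mulrA; apply: le_trans zf _; rewrite -zE.
  by apply: weight_mkseq => //; rewrite !addn_gt0 n0.
apply: le_trans h1 _; rewrite ler_pM2l// (big_rem k)//= -[leLHS]addr0.
apply: lerD; last exact: sumr_ge0.
by rewrite (big_rem w)//= lerDl sumr_ge0.
Qed.

(** The constant c = (M / D) (p + 1) is the loss of one gluing, the p + 1 counting the possible
    lengths. A bound with surplus c therefore reproduces itself: the product of two of them leaves
    one factor c after the loss. *)
Lemma total_weight_growth A p D n c s : 0 < D -> gluing (over A) f (iota 0 p.+1) D ->
  (0 < n)%N -> c = M / D * p.+1%:R ->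
  c * expR s <= total_weight A n ->
  forall j, exists N, [/\ (0 < N)%N, (j.+1 * n <= N <= j.+1 * (n + p))%N &
    c * expR (j.+1%:R * s) <= total_weight A N].
Proof.
move=> D0 glue n0 cE base.
have c0 : 0 < c by rewrite cE mulr_gt0// divr_gt0.
elim=> [|j [N [N0 /andP[N1 N2] IH]]].
  by exists n; rewrite !mul1n mul1r leqnn leq_addr.
have prod : c * expR s * (c * expR (j.+1%:R * s)) <=
    M / D * \sum_(k <- iota 0 p.+1) total_weight A (n + N + k).
  apply: le_trans (total_weight_gluing D0 glue n0 N0).
  by apply: ler_pM => //; rewrite mulr_ge0 ?expR_ge0// ltW.
have [k kp le] : exists2 k, k \in iota 0 p.+1 &
    c * expR (j.+2%:R * s) <= total_weight A (n + N + k).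
  apply/not_exists2P => H.
  have : \sum_(k <- iota 0 p.+1) total_weight A (n + N + k) <
      \sum_(k <- iota 0 p.+1) c * expR (j.+2%:R * s).
    rewrite big_seq [ltRHS]big_seq; apply: ltr_sum.
      by apply/hasP; exists 0%N.
    by move=> k kp; have [//|/negP] := H k; rewrite -ltNge.
  have MD0 : 0 < M / D by rewrite divr_gt0.
  rewrite -(ltr_pM2l MD0) => /(le_lt_trans prod).
  rewrite big_const_seq count_predT iter_addr_0 size_iota -[_ *+ p.+1]mulr_natr.
  have -> : M / D * (c * expR (j.+2%:R * s) * p.+1%:R) = c * (c * expR (j.+2%:R * s)).
    by rewrite {3}cE; ring.
  have -> : j.+2%:R * s = s + j.+1%:R * s by rewrite -[j.+2]add1n natrD mulrDl mul1r.
  rewrite expRD => h.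
  have : c * expR s * (c * expR (j.+1%:R * s)) = c * (c * (expR s * expR (j.+1%:R * s))) by ring.
  by move=> e; rewrite e ltxx in h.
exists (n + N + k)%N; split=> //; first by rewrite !addn_gt0 n0.
by move: kp; rewrite mem_iota; lia.
Qed.

End finite_alphabet.

Section growing_alphabet.
Context {R : realType} {t : transition_matrix}.
Local Notation X := (markov_shift t).
Variables (f : nat -> X -> R) (M : R).
Hypotheses (fp : positive_seq f) (M1 : 1 <= M) (fM : distortion f M).

Let M0 : 0 < M. Proof. exact: lt_le_trans M1. Qed.

Lemma words_over_subset A n w : (0 < n)%N ->
  (forall a, a \in A -> exists2 b, b \in A & t a b) ->
  {subset w <= A} -> words [set: X] n w -> words (@over t A) n w.
Proof.
move=> n0 succA wA /wordsP[x _ wE]; apply/wordsP.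
have [|y Ay yx] := over_extend n0 succA (x := x).
  by move=> i ni; apply: wA; rewrite wE; apply/mapP; exists i; rewrite ?mem_iota.
by exists y => //; rewrite wE; apply/eq_mkseqP; exact: agree_sym.
Qed.

Lemma sum_sup_on_le_total_weight A n (s : seq (seq nat)) : (0 < n)%N -> uniq A ->
  (forall a, a \in A -> exists2 b, b \in A & t a b) -> uniq s ->
  (forall w, w \in s -> words [set: X] n w) -> {subset flatten s <= A} ->
  (\sum_(w <- s) sup_on [set: X] f n w <= (M * total_weight f A n)%:E)%E.
Proof.
move=> n0 uA succA us sW sA.
have wA w : w \in s -> {subset w <= A}.
  by move=> ws a aw; apply: sA; apply/flattenP; exists w.
have sWA w : w \in s -> words (@over t A) n w.
  by move=> ws; apply: words_over_subset => //; [exact: wA|exact: sW].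
apply: (@le_trans _ _ (\sum_(w <- s) (M * weight f A n w)%:E)%E).
  rewrite big_seq [leRHS]big_seq; apply: lee_sum => w ws.
  rewrite /weight ifT; last by apply/asboolP; exact: sWA.
  have [_ {1}<-] := point_overP (sWA _ ws); exact: sup_on_le.
rewrite sumEFin lee_fin -big_distrr ler_pM2l//.
apply: ler_sum_uniq_subset => //; first exact: allwords_uniq.
  move=> w ws; rewrite mem_allwords; have [-> _] := sW _ ws.
  by rewrite eqxx; apply/allP => a aw; exact: wA ws _ aw.
by move=> w; exact: weight_ge0.
Qed.

(** Finitely many words already carry enough of one large Z_n, and the alphabet is chosen to contain
    their symbols. Repeated gluing inside it then yields arbitrarily large good times. *)
Lemma exists_growing_alphabet p D c : 0 < D ->
  (forall s : seq nat, exists A, [/\ uniq A, {subset s <= A},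
        forall a, a \in A -> exists2 b, b \in A & t a b &
        gluing (over A) f (iota 0 p.+1) D]) ->
  (c%:E < pressure f)%E ->
  exists A, exists2 k, 0 < k & [/\ uniq A,
    forall a, a \in A -> exists2 b, b \in A & t a b &
    forall N0, exists N, [/\ (N0 <= N)%N, (0 < N)%N &
      k * expR (N%:R * c) <= total_weight f A N]].
Proof.
move=> D0 H /ereal_between[c' [cc' c'P]]; rewrite lte_fin in cc'.
pose k := M / D * p.+1%:R.
have k0 : 0 < k by rewrite mulr_gt0// divr_gt0.
(* The factors provide strictness (2), the passage from suprema to weights (M), the surplus (k), and
   the term |c| p added to the exponent below. *)
pose c1 : R := 2 * M * k * expR (`|c| * p%:R).
have c10 : 0 < c1.
  by apply: mulr_gt0; [do 2! apply: mulr_gt0 => //|exact: expR_gt0].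
have [n0 n0P] := expR_rate_gap 0 c10 cc'.
have [n nge lt] := lt_limn_esup_frequently c'P n0.+1.
have n1 : (0 < n)%N by lia.
(* After j + 1 blocks the length N lies between (j + 1) n and (j + 1) (n + p). The term |c| p
   ensures N c <= (j + 1) s whatever the sign of c. *)
pose s := n%:R * c + `|c| * p%:R.
have base : ((M * (k * expR s))%:E < partition_function f n)%E.
  have := ltW lt; rewrite le_log_rate// => le; apply: lt_le_trans le.
  have := n0P n 0%N (ltnW nge) isT; rewrite addn0 => le.
  rewrite lte_fin; apply: lt_le_trans le.
  have -> : c1 * expR (n%:R * c) = 2 * (M * (k * expR s)) by rewrite /c1 /s expRD; ring.
  rewrite mulr_natl mulr2n ltrDl; apply: mulr_gt0 => //.
  by apply: mulr_gt0 => //; exact: expR_gt0.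
have [ws [uws wsW lts]] := lt_esum_seq base.
have [A [uA sA succA gA]] := H (flatten ws).
have := lt_le_trans lts (sum_sup_on_le_total_weight n1 uA succA uws wsW sA).
rewrite lte_fin ltr_pM2l// => /ltW tw.
exists A, k => //; split=> // N0.
have [N [N1 /andP[Nl Nu] le]] := total_weight_growth fp M1 fM D0 gA n1 erefl tw N0.
exists N; split=> //.
  by apply: leq_trans Nl; rewrite (leq_trans (leqnSn _))// leq_pmulr.
apply: le_trans le; rewrite ler_pM2l// ler_expR /s.
have [cge|clt] := leP 0 c.
  have : N%:R * c <= (N0.+1 * (n + p))%:R * c by rewrite ler_wpM2r// ler_nat.
  by rewrite natrM natrD (ger0_norm cge) => /le_trans; apply; rewrite le_eqVlt; apply/orP; left;
    apply/eqP; ring.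
have : N%:R * c <= (N0.+1 * n)%:R * c by apply: ler_wnM2r; [exact: ltW|rewrite ler_nat].
move=> /le_trans; apply; rewrite natrM -mulrA ler_pM2l// lerDl mulr_ge0//.
Qed.

End growing_alphabet.

(** * Window frequencies and Markov comparison *)

Section empirical.
Context {R : realType}.
Variables (A : seq nat) (N : nat) (T : eqType) (V : seq T) (x : T -> nat -> nat)
  (p : T -> R).
Hypotheses (uA : uniq A) (N0 : (0 < N)%N) (uV : uniq V) (p0 : forall v, 0 < p v)
  (p1 : \sum_(v <- V) p v = 1) (xA : forall v i, x v i \in A)
  (xinj : {in V &, injective (fun v => mkseq (x v) N)}).

Definition window (y : nat -> nat) i q := mkseq (fun j => y (i + j)%N) q.

Lemma window_allwords v i q : window (x v) i q \in allwords A q.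
Proof.
rewrite mem_allwords size_mkseq eqxx; apply/allP => a /mapP[j _ ->]; exact: xA.
Qed.

(** Windows start before N but may run past it, since each x v is an infinite sequence. This makes
    consistency on the right exact and leaves a boundary error only on the left. *)
Definition freq w : R :=
  \sum_(v <- V) p v * (N%:R^-1 * \sum_(i < N) (window (x v) i (size w) == w)%:R).

Let NR0 : 0 < N%:R :> R. Proof. by rewrite ltr0n. Qed.
Let NI0 : 0 < N%:R^-1 :> R. Proof. by rewrite invr_gt0. Qed.

Lemma freq_ge0 w : 0 <= freq w.
Proof.
apply: sumr_ge0 => v _; apply: mulr_ge0; first exact: ltW.
by apply: mulr_ge0; [exact: ltW|exact: sumr_ge0].
Qed.

Lemma sum_freq q (g : seq nat -> R) :
  \sum_(w <- allwords A q) freq w * g w =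
  \sum_(v <- V) p v * (N%:R^-1 * \sum_(i < N) g (window (x v) i q)).
Proof.
under eq_bigr do rewrite /freq big_distrl/=.
rewrite exchange_big/=; apply: eq_bigr => v _.
under eq_bigr do rewrite -!mulrA.
rewrite -!big_distrr/=; congr (_ * (_ * _)).
under eq_bigr do rewrite big_distrl/=.
rewrite exchange_big/=; apply: eq_bigr => i _.
have wA := window_allwords v i q.
rewrite (bigD1_seq _ wA (allwords_uniq q uA))/= size_mkseq eqxx mul1r.
rewrite big_seq_cond big1 ?addr0// => w /andP[wA' ww].
move: wA'; rewrite mem_allwords => /andP[/eqP -> _].
by rewrite eq_sym (negbTE ww) mul0r.
Qed.

Lemma freq_nil : freq [::] = 1.
Proof.
have := sum_freq 0 (fun=> 1); rewrite big_seq1 mulr1 => ->.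
rewrite -[RHS]p1; apply: eq_bigr => v _.
by rewrite sumr_const card_ord mulVf ?mulr1 ?gt_eqF.
Qed.

Lemma freq_le1 w : freq w <= 1.
Proof.
rewrite -p1; apply: ler_sum => v _; rewrite -[leRHS]mulr1 ler_pM2l//.
rewrite mulrC ler_pdivrMr// mul1r -[in leRHS](card_ord N) -sum1_card natr_sum.
by apply: ler_sum => i _; case: eqP.
Qed.

Lemma window_rcons y i q : window y i q.+1 = rcons (window y i q) (y (i + q)%N).
Proof. by rewrite /window mkseqS. Qed.

Lemma window_cons y i q : window y i q.+1 = y i :: window y i.+1 q.
Proof.
rewrite /window /mkseq /= addn0 -[1%N]addn0 iotaDl -map_comp; congr (_ :: _).
by apply: eq_map => j /=; rewrite addSn addnS.
Qed.

Let sum_indic (a : nat) (b : bool) : a \in A -> \sum_(c <- A) (b && (a == c))%:R = b%:R :> R.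
Proof.
move=> aA; rewrite (bigD1_seq a aA uA)/= eqxx andbT big1 ?addr0// => c ca.
by rewrite eq_sym (negbTE ca) andbF.
Qed.

Lemma sum_freq_rcons w : \sum_(a <- A) freq (rcons w a) = freq w.
Proof.
rewrite exchange_big/=; apply: eq_bigr => v _.
rewrite -!big_distrr/=; congr (_ * (_ * _)).
rewrite exchange_big/=; apply: eq_bigr => i _.
under eq_bigr do rewrite size_rcons window_rcons eqseq_rcons.
by rewrite sum_indic.
Qed.

(** Summing over the first letter moves the starting positions from i to i + 1; the difference
    telescopes to the two end windows, each counted with weight 1 / N. *)
Lemma sum_freq_cons w : `|\sum_(a <- A) freq (a :: w) - freq w| <= N%:R^-1.
Proof.
have -> : \sum_(a <- A) freq (a :: w) =
    \sum_(v <- V) p v * (N%:R^-1 * \sum_(i < N) (window (x v) i.+1 (size w) == w)%:R).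
  rewrite exchange_big/=; apply: eq_bigr => v _.
  rewrite -!big_distrr/=; congr (_ * (_ * _)).
  rewrite exchange_big/=; apply: eq_bigr => i _.
  under eq_bigr do rewrite window_cons eqseq_cons andbC.
  by rewrite sum_indic.
rewrite /freq -sumrB; apply: le_trans (ler_norm_sum _ _ _) _.
apply: (@le_trans _ _ (\sum_(v <- V) p v * N%:R^-1)); last by rewrite -big_distrl/= p1 mul1r.
apply: ler_sum => v _; rewrite -!mulrBr normrM gtr0_norm// ler_pM2l//.
rewrite normrM gtr0_norm// -[leRHS]mulr1 ler_pM2l//.
have : (\sum_(i < N) (window (x v) i.+1 (size w) == w)%:R - \sum_(i < N) (window (x v) i (size w) == w)%:R =
    (window (x v) N (size w) == w)%:R - (window (x v) 0 (size w) == w)%:R :> R).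
  rewrite -sumrB -(big_mkord predT (fun i => (window (x v) i.+1 (size w) == w)%:R -
    (window (x v) i (size w) == w)%:R)).
  by rewrite (telescope_sumr (fun i => (window (x v) i (size w) == w)%:R : R)).
by move=> ->; do 2 case: eqP => _; rewrite ?subrr ?subr0 ?sub0r ?normrN ?normr0 ?normr1.
Qed.

Lemma freq_gt0_window w : 0 < freq w -> exists v i, window (x v) i (size w) = w.
Proof.
move=> fw; apply: contrapT => H; move: fw; rewrite /freq big1 ?ltxx// => v _.
rewrite big1 ?mulr0// => i _; case: eqP => // e.
by case: H; exists v, i.
Qed.

Lemma freq_window_gt0 v i q : v \in V -> (i < N)%N -> 0 < freq (window (x v) i q).
Proof.
move=> vV iN; rewrite /freq (bigD1_seq v)//= size_mkseq ltr_pwDl//; last first.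
  apply: sumr_ge0 => u _; apply: mulr_ge0; first exact: ltW.
  by apply: mulr_ge0; [exact: ltW|exact: sumr_ge0].
rewrite !mulr_gt0// (bigD1 (Ordinal iN))//= eqxx ltr_pwDl//; exact: sumr_ge0.
Qed.

Definition block_entropy (m : seq nat -> R) q := \sum_(w <- allwords A q) eta (m w).

(* The probability, given the first q letters, of the next n letters of u under the
   Markov chain of order q with the transition probabilities read off [freq]. *)
Let markov_weight q n u :=
  \prod_(i < n) (freq (take q.+1 (drop i u)) / freq (take q (drop i u))).

(** The first q letters carry no probability, which accounts for |A|^q. Each further letter has
    transition probabilities of sum 1, or 0 after a block of frequency 0. *)
Let sum_markov_weight q n :
  \sum_(u <- allwords A (q + n)) markov_weight q n u <= (size A)%:R ^+ q.
Proof.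
elim: n => [|n IH].
  rewrite addn0 /markov_weight; under eq_bigr do rewrite big_ord0.
  by rewrite big_const_seq count_predT iter_addr_0 size_allwords -natrX.
apply: le_trans IH; rewrite addnS sum_allwords_rcons.
rewrite big_seq [leRHS]big_seq; apply: ler_sum => u.
rewrite mem_allwords => /andP[/eqP su _].
have stp a : markov_weight q n.+1 (rcons u a) =
    markov_weight q n u * (freq (rcons (drop n u) a) / freq (drop n u)).
  rewrite /markov_weight big_ord_recr/=; congr (_ * (_ / _)).
  - apply: eq_bigr => i _; rewrite drop_rcons; last by rewrite su; have := ltn_ord i; lia.
    rewrite -cats1 !takel_cat//; rewrite size_drop su; have := ltn_ord i; lia.
  - rewrite drop_rcons ?su ?leq_addl// take_oversize// size_rcons size_drop su; lia.
  - rewrite drop_rcons ?su ?leq_addl// -cats1 take_cat size_drop su addnK ltnn subnn take0 cats0//.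
under eq_bigr do rewrite stp.
rewrite -big_distrr -big_distrl/= sum_freq_rcons.
have mw0 : 0 <= markov_weight q n u.
  by apply: prodr_ge0 => i _; rewrite divr_ge0 ?freq_ge0.
rewrite -[leRHS]mulr1 ler_wpM2l//.
by have [->|fn0] := eqVneq (freq (drop n u)) 0; rewrite ?mul0r ?ler01 ?divff.
Qed.

(** Gibbs' inequality of p against the Markov law started from the uniform law on the first q
    letters. The p-average of the logarithms of the transition probabilities is N (H_q - H_{q+1})
    for the block entropies of the frequencies. *)
Lemma empirical_entropy_le q : (0 < size A)%N ->
  - (\sum_(v <- V) p v * ln (p v)) <=
  q%:R * ln (size A)%:R + N%:R * (block_entropy freq q.+1 - block_entropy freq q).
Proof.
move=> A0; have AR0 : 0 < (size A)%:R :> R by rewrite ltr0n.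
(* With q + N letters, each of the N starting positions has a complete window of length q + 1. *)
pose prefix v := mkseq (x v) (q + N).
pose Q v := markov_weight q N (prefix v) / (size A)%:R ^+ q.
have QE v : Q v = \prod_(i < N) (freq (window (x v) i q.+1) / freq (window (x v) i q)) /
    (size A)%:R ^+ q.
  congr (_ / _); apply: eq_bigr => i _.
  have E k : (k <= q.+1)%N -> take k (drop i (prefix v)) = window (x v) i k.
    move=> kq; rewrite /prefix /mkseq -map_drop -map_take drop_iota take_iota.
    have -> : minn k (q + N - i) = k by have := ltn_ord i; lia.
    by rewrite add0n /window /mkseq -[X in iota X]addn0 iotaDl -map_comp.
  by rewrite !E.
(* The value 1 outside V only provides the positivity that [gibbs] asks of every index. *)
pose Q' v := if v \in V then Q v else 1.
have QV v : v \in V -> 0 < Q v.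
  move=> vV; rewrite QE divr_gt0 ?exprn_gt0//; apply: prodr_gt0 => i _.
  by rewrite divr_gt0// freq_window_gt0.
have Q'0 v : 0 < Q' v by rewrite /Q'; case: ifP => // /QV.
have sumQ : \sum_(v <- V) Q' v <= \sum_(v <- V) p v.
  rewrite p1 (_ : \sum_(v <- V) Q' v = \sum_(v <- V) Q v); last first.
    by apply: eq_big_seq => v vV; rewrite /Q' vV.
  rewrite -big_distrl/= ler_pdivrMr ?exprn_gt0// mul1r.
  apply: le_trans (sum_markov_weight q N).
  rewrite -(big_map prefix predT (markov_weight q N)).
  apply: ler_sum_uniq_subset; last 2 first.
  - move=> _ /mapP[v _ ->]; rewrite mem_allwords size_mkseq eqxx.
    by apply/allP => a /mapP[j _ ->]; exact: xA.
  - by move=> u; apply: prodr_ge0 => i _; rewrite divr_ge0 ?freq_ge0.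
  - rewrite map_inj_in_uniq// => u v uV' vV' e; apply: xinj => //.
    have := congr1 (take N) e; rewrite /prefix /mkseq -!map_take take_iota.
    by have -> : minn N (q + N) = N by lia.
  - exact: allwords_uniq.
have := @gibbs R _ V p Q' (fun v => ltW (p0 v)) (fun v => ltW (Q'0 v))
  (fun v _ => Q'0 v) sumQ.
have -> : \sum_(v <- V) p v * ln (Q' v) =
    - (q%:R * ln (size A)%:R) - N%:R * (block_entropy freq q.+1 - block_entropy freq q).
  have lnQ v : v \in V -> p v * ln (Q' v) =
      N%:R * (p v * (N%:R^-1 * \sum_(i < N) ln (freq (window (x v) i q.+1)))) -
      N%:R * (p v * (N%:R^-1 * \sum_(i < N) ln (freq (window (x v) i q)))) -
      p v * (q%:R * ln (size A)%:R).
    move=> vV; rewrite /Q' vV QE.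
    have P0 : 0 < \prod_(i < N) (freq (window (x v) i q.+1) / freq (window (x v) i q)).
      by apply: prodr_gt0 => i _; rewrite divr_gt0// freq_window_gt0.
    rewrite ln_div ?posrE ?exprn_gt0// lnXn//.
    have -> : ln (\prod_(i < N) (freq (window (x v) i q.+1) / freq (window (x v) i q))) =
        \sum_(i < N) ln (freq (window (x v) i q.+1)) - \sum_(i < N) ln (freq (window (x v) i q)).
      rewrite -sumrB; apply: expR_inj; rewrite lnK ?posrE// expR_sum.
      apply: eq_bigr => i _; rewrite expRD expRN !lnK ?posrE ?freq_window_gt0//.
    by rewrite -[ln (size A)%:R *+ q]mulr_natl; field; rewrite gt_eqF.
  rewrite (eq_big_seq _ lnQ) !sumrB -!big_distrr/= -big_distrl/= p1 mul1r.
  have bE k : block_entropy freq k =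
      - \sum_(v <- V) p v * (N%:R^-1 * \sum_(i < N) ln (freq (window (x v) i k))).
    by rewrite -(sum_freq k (fun w => ln (freq w))) /block_entropy -sumrN.
  rewrite !bE; ring.
lra.
Qed.

End empirical.

Lemma exists_pushforward_probability (R : realType) d1 d2 (T1 : measurableType d1)
    (T2 : measurableType d2) (m : {measure set T1 -> \bar R}) (g : T1 -> T2) :
  measurable_fun [set: T1] g -> m setT = 1%E ->
  exists P : probability T2 R, forall A, P A = m (g @^-1` A).
Proof.
move=> mg m1.
pose M : {measure set T2 -> \bar R} :=
  measure_function_pushforward__canonical__measure_function_Measure m mg.
have M1 : M setT = 1%E by [].
pose P : probability T2 R := HB.pack (M : set T2 -> \bar R) (Measure.class M)
  (@Measure_isProbability.Build _ _ _ M M1).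
by exists P.
Qed.

(** * A measure with prescribed cylinder weights *)

Section interval_coding.
Context {R : realType}.
Variables (A : seq nat) (m : seq nat -> R).
Hypotheses (uA : uniq A) (m0 : forall w, 0 <= m w) (m_nil : m [::] = 1)
  (m_rcons : forall w, \sum_(a <- A) m (rcons w a) = m w).

(* [0, 1[ is divided into consecutive intervals of lengths m [:: a], each of which is
   divided again, and so on; the measure is the image of Lebesgue measure under the
   map sending s to the sequence of intervals containing it. *)
Fixpoint pick_symbol (B : seq nat) w (r : R) : nat * R :=
  if B is b :: B' then
    if r < m (rcons w b) then (b, r) else pick_symbol B' w (r - m (rcons w b))
  else (0%N, r).

Fixpoint symbol_offset (B : seq nat) w a : R :=
  if B is b :: B' then
    if a == b then 0 else m (rcons w b) + symbol_offset B' w a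
  else 0.

Lemma symbol_offset_ge0 B w a : 0 <= symbol_offset B w a.
Proof. by elim: B => //= b B IH; case: ifP => // _; rewrite addr_ge0. Qed.

Lemma symbol_offset_le B w a : a \in B ->
  symbol_offset B w a + m (rcons w a) <= \sum_(b <- B) m (rcons w b).
Proof.
elim: B => //= b B IH; rewrite inE big_cons.
case: eqVneq => [-> _|ab /= /IH h]; first by rewrite add0r lerDl sumr_ge0.
by rewrite -addrA lerD2l.
Qed.

Lemma pick_symbol_offset B w a r : a \in B -> 0 <= r < m (rcons w a) ->
  pick_symbol B w (symbol_offset B w a + r) = (a, r).
Proof.
elim: B => //= b B IH; rewrite inE.
case: eqVneq => [-> _ /andP[_ rm]|ab /= aB rr]; first by rewrite add0r rm.
rewrite ltNge -addrA lerDl addr_ge0 ?symbol_offset_ge0//=; last by case/andP: rr.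
by rewrite [X in pick_symbol _ _ X](_ : _ = symbol_offset B w a + r) ?IH//; ring.
Qed.

Lemma pick_symbolP B w r : uniq B -> 0 <= r < \sum_(b <- B) m (rcons w b) ->
  let: (a, r') := pick_symbol B w r in
  [/\ a \in B, 0 <= r' < m (rcons w a) & r = symbol_offset B w a + r'].
Proof.
elim: B r => [|b B IH] r /=; first by rewrite big_nil => _ /andP[/le_lt_trans h /h]; rewrite ltxx.
move=> /andP[bB uB]; rewrite big_cons => /andP[r0 rm]; case: ltP => [rb|br].
  by rewrite inE eqxx add0r r0 rb.
have := IH (r - m (rcons w b)) uB; rewrite subr_ge0 br ltrBlDl rm => /(_ isT).
case: pick_symbol => a r' [aB r'm e]; split=> //; first by rewrite inE aB orbT.
case: eqVneq => [ab|ab]; first by rewrite ab in aB; rewrite aB in bB.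
by rewrite -addrA -e addrC subrK.
Qed.

(** The state is the word read so far together with the distance of the coded number from the left
    end of the interval of that word. *)
Definition coding_step (s : seq nat * R) : seq nat * R :=
  let: (a, r) := pick_symbol A s.1 s.2 in (rcons s.1 a, r).

Definition coding n (s : R) := iter n coding_step ([::], s).

Definition left_end w : R :=
  \sum_(i < size w) symbol_offset A (take i w) (nth 0%N w i).

Lemma left_end_rcons w a : left_end (rcons w a) = left_end w + symbol_offset A w a.
Proof.
rewrite /left_end size_rcons big_ord_recr/= nth_rcons ltnn eqxx.
rewrite -cats1 take_size_cat//; congr (_ + _); apply: eq_bigr => i _.
by rewrite takel_cat 1?ltnW// nth_cat ltn_ord.
Qed.

Lemma codingP n s : 0 <= s < 1 ->
  [/\ (coding n s).1 \in allwords A n,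
      0 <= (coding n s).2 < m (coding n s).1 & s = left_end (coding n s).1 + (coding n s).2].
Proof.
move=> s01; elim: n => [|n [wA rm e]].
  by split=> //=; rewrite ?m_nil// /left_end big_ord0 add0r.
rewrite /coding iterS -/(coding n s) /coding_step.
move: wA rm e; case: (coding n s) => w r /= wA; rewrite -{1}m_rcons => rm e.
have := pick_symbolP uA rm; case: pick_symbol => a r' /= [aA r'm re].
split=> //; last by rewrite left_end_rcons -addrA -re.
by move: wA; rewrite !mem_allwords size_rcons all_rcons eqSS /= aA.
Qed.

Lemma coding_left_end w r : all (mem A) w -> 0 <= r < m w ->
  coding (size w) (left_end w + r) = (w, r).
Proof.
elim/last_ind: w r => [|w a IH] r; first by rewrite /left_end big_ord0 add0r.
rewrite all_rcons => /andP[/= aA wA] rr; have /andP[r0 rm] := rr.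
have := @symbol_offset_le A w a aA; rewrite m_rcons => le.
rewrite size_rcons /coding iterS -/(coding _ _) left_end_rcons -addrA IH//.
  by rewrite /coding_step pick_symbol_offset.
by rewrite addr_ge0 ?symbol_offset_ge0//=; lra.
Qed.

Lemma left_end_itv w : all (mem A) w -> 0 <= left_end w /\ left_end w + m w <= 1.
Proof.
elim/last_ind: w => [|w a IH]; first by rewrite /left_end big_ord0 m_nil add0r.
rewrite all_rcons => /andP[/= aA /IH[h1 h2]].
have := @symbol_offset_le A w a aA; rewrite m_rcons left_end_rcons => le.
by split; [rewrite addr_ge0// symbol_offset_ge0|lra].
Qed.

Lemma coding_eqP n w s : w \in allwords A n -> 0 <= s < 1 ->
  ((coding n s).1 == w) = (left_end w <= s < left_end w + m w).
Proof.
rewrite mem_allwords => /andP[/eqP sw wA] s01; apply/eqP/idP => [<-|/andP[h1 h2]].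
  by have [_ /andP[h1 h2] e] := codingP n s01; apply/andP; split; lra.
have := @coding_left_end w (s - left_end w) wA.
have -> : left_end w + (s - left_end w) = s by ring.
by rewrite sw subr_ge0 h1 ltrBlDl h2 => /(_ isT) ->.
Qed.

Lemma take_coding n s : 0 <= s < 1 -> take n (coding n.+1 s).1 = (coding n s).1.
Proof.
move=> s01; have [+ _ _] := codingP n s01; rewrite mem_allwords => /andP[/eqP sz _].
rewrite /coding iterS -/(coding n s) /coding_step; case: pick_symbol => a r /=.
by rewrite -cats1 takel_cat ?sz// -{1}sz take_size.
Qed.

Context {t : transition_matrix}.
Local Notation X := (markov_shift t).
Hypothesis m_words : forall w, 0 < m w -> words [set: X] (size w) w.

Lemma exists_coded_point s : 0 <= s < 1 ->
  exists x : X, forall n, mkseq x n = (coding n s).1.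
Proof.
move=> s01; pose g i := nth 0%N (coding i.+1 s).1 i.
have sz n : size (coding n s).1 = n.
  by have [+ _ _] := codingP n s01; rewrite mem_allwords => /andP[/eqP].
have gE n : mkseq g n = (coding n s).1.
  elim: n => [|n IH]; first by [].
  have e := take_nth 0%N (_ : n < size (coding n.+1 s).1)%N.
  rewrite mkseqS IH -(take_coding n s01) /g -e ?sz// -{1}(sz n.+1) take_size//.
have gt i : t (g i) (g i.+1).
  (* The interval reached contains a point, so its word has positive weight and is allowable; this
     gives the transition at i. *)
  have [_ /andP[r0 rm] _] := codingP i.+2 s01.
  have /m_words := le_lt_trans r0 rm; rewrite sz => /wordsP[x _ e].
  rewrite -gE in e.
  have gx j : (j < i.+2)%N -> g j = x j.
    by move=> ji; rewrite -(nth_mkseq 0%N g ji) e nth_mkseq.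
  by rewrite !gx//; exact: admissibleP.
by exists (mkpoint g gt) => n; rewrite -gE.
Qed.

(** The value off [0, 1[ only makes the map total: Lebesgue measure is restricted to [0, 1[ before
    being pushed forward. *)
Definition coded_point (s : R) : X :=
  if 0 <= s < 1 then xget (point : X) [set x : X | forall n, mkseq x n = (coding n s).1]
  else (point : X).

Lemma coded_pointE s n : 0 <= s < 1 -> mkseq (coded_point s) n = (coding n s).1.
Proof.
move=> s01; rewrite /coded_point s01; case: xgetP => [x _ -> //|].
by have [x xP] := exists_coded_point s01 => /(_ x).
Qed.

Lemma coded_point_preimage w : coded_point @^-1` cylinder w `&` `[0, 1[%classic =
  if w \in allwords A (size w) then `[left_end w, left_end w + m w[%classic else set0.
Proof.
apply/seteqP; split=> s /=.
  rewrite in_itv/= => -[]; rewrite /cylinder/= => + s01; rewrite coded_pointE// => e.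
  have [+ _ _] := codingP (size w) s01; rewrite e => wA; rewrite wA /=.
  by rewrite in_itv/= -(coding_eqP wA s01) e.
case: ifP => // wA; rewrite /= in_itv/= => sw.
have s01 : 0 <= s < 1.
  move: wA; rewrite mem_allwords => /andP[_ /left_end_itv[h1 h2]].
  by case/andP: sw => h3 h4; apply/andP; split; lra.
split; last by rewrite in_itv.
rewrite /cylinder/= coded_pointE//; apply/eqP.
by rewrite (coding_eqP wA s01).
Qed.

Lemma measurable_coded_point :
  measurable_fun [set: R] (coded_point : R -> borel_shift t).
Proof.
move=> _; apply: borel_sub_sigma_algebra; last first.
  move=> w; rewrite setTI.
  have -> : coded_point @^-1` cylinder w = (coded_point @^-1` cylinder w `&` `[0, 1[%classic) `|`
      (~` `[0, 1[%classic `&` (if `[<@cylinder t w (point : X)>] then setT else set0)).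
    apply/seteqP; split=> s /=.
      move=> sw; have [s01|s01] := boolP (0 <= s < 1).
        by left; split=> //; rewrite in_itv.
      right; split; first by rewrite in_itv/=; apply/negP.
      by move: sw; rewrite /coded_point (negbTE s01); case: asboolP.
    move=> [[]//|[/negP]]; rewrite in_itv/= => s01.
    by rewrite /coded_point (negbTE s01); case: asboolP.
  apply: measurableU; first by rewrite coded_point_preimage; case: ifP.
  apply: measurableI; first exact: measurableC.
  by case: ifP.
split => /=.
- by rewrite preimage_set0 setI0; exact: measurable0.
- move=> U; rewrite !setTI setTD preimage_setC; exact: measurableC.
- move=> F mF; rewrite preimage_bigcup setTI; apply: bigcup_measurable => n _.
  by have := mF n; rewrite setTI.
Qed.

Lemma exists_cylinder_measure : exists mu : probability (borel_shift t) R,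
  forall w, all (mem A) w -> mu (cylinder w) = (m w)%:E.
Proof.
pose D : set R := `[0, 1[%classic.
have mD : measurable D by exact: measurable_itv.
pose lam : {measure set (measurableTypeR R) -> \bar R} := mrestr (@lebesgue_measure R) mD.
have lam1 : lam setT = 1%E.
  by rewrite /lam /= /mrestr setTI lebesgue_measure_itv/= lte01 sube0.
have [mu muE] := @exists_pushforward_probability R _ _ (measurableTypeR R) (borel_shift t)
  lam coded_point measurable_coded_point lam1.
exists mu => w wA; rewrite muE /lam /= /mrestr coded_point_preimage ifT; last first.
  by rewrite mem_allwords eqxx.
rewrite lebesgue_measure_itv/= lte_fin ltrDl -EFinB addrAC subrr add0r.
case: ltP => // mw; congr (_%:E); apply/eqP; rewrite eq_le mw andbT; exact: m0.
Qed.

End interval_coding.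

(** The moving sum U of q consecutive values telescopes: U (n + 1) - U n = g (n + q) - g n is at
    most g q at the n-th iterate, which avoids splitting N into residue classes. The error collects
    q G from U 1, G from the term i = 0, q G from completing to N and q G from restoring the last q
    summands. *)
Lemma subadditive_average (R : realType) (X : Type) (S : X -> X) (Y : set X)
    (g : nat -> X -> R) q (G : R) : (0 < q)%N ->
  (forall x, Y x -> Y (S x)) ->
  (forall n m x, (0 < n)%N -> (0 < m)%N -> Y x -> g (n + m)%N x <= g n x + g m (iter n S x)) ->
  (forall k x, (0 < k <= q)%N -> Y x -> `|g k x| <= G) ->
  forall N x, (q < N)%N -> Y x ->
  q%:R * g N x <= \sum_(i < N) g q (iter i S x) + (3 * q + 1)%:R * G.
Proof.
move=> q0 YS gsub gG N x qN Yx.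
have Yit i : Y (iter i S x) by elim: i => //= i; exact: YS.
have sG i : `|g q (iter i S x)| <= G by apply: gG; rewrite ?q0 ?leqnn.
pose U n := \sum_(j < q) g (n + j)%N x.
have Ustep n : (0 < n)%N -> U n.+1 <= U n + g q (iter n S x).
  move=> n0; rewrite -lerBlDl /U -sumrB.
  rewrite -(big_mkord predT (fun j => g (n.+1 + j)%N x - g (n + j)%N x)).
  under eq_bigr do rewrite addSnnS.
  rewrite (telescope_sumr (fun j => g (n + j)%N x))// addn0.
  by have := gsub n q x n0 q0 Yx; lra.
have U1 : U 1%N <= q%:R * G.
  have -> : q%:R * G = \sum_(j < q) G by rewrite sumr_const card_ord mulr_natl.
  apply: ler_sum => j _; apply: le_trans (ler_norm _) (gG _ _ _ _) => //.
  by rewrite add1n ltnS leq0n ltn_ord.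
have Ule n : U n.+1 <= \sum_(i < n.+1) g q (iter i S x) + q%:R * G + G.
  elim: n => [|n IH].
    by have := sG 0%N; rewrite big_ord1 ler_norml => /andP[h _]; lra.
  by rewrite big_ord_recr/=; have := Ustep n.+1 isT; lra.
have [n NE] : exists n, N = (n.+1 + q)%N by exists (N - q.+1)%N; lia.
have h1 : q%:R * g N x <= U n.+1 + q%:R * G.
  have e (c : R) : q%:R * c = \sum_(j < q) c by rewrite sumr_const card_ord mulr_natl.
  rewrite !e -big_split/=; apply: ler_sum => j _.
  have jq := ltn_ord j; have -> : N = (n.+1 + j + (q - j))%N by lia.
  apply: le_trans (gsub _ _ x _ _ Yx) _; [by lia|by lia|rewrite lerD2l].
  by apply: le_trans (ler_norm _) (gG _ _ _ _) => //; lia.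
have h2 : \sum_(i < n.+1) g q (iter i S x) <= \sum_(i < N) g q (iter i S x) + q%:R * G.
  rewrite NE big_split_ord/= -addrA lerDl.
  have -> : q%:R * G = \sum_(j < q) G by rewrite sumr_const card_ord mulr_natl.
  rewrite -big_split/=; apply: sumr_ge0 => j _.
  by have := sG (n.+1 + j)%N; rewrite ler_norml => /andP[h _]; lra.
by have := Ule n; rewrite natrD natrM; lra.
Qed.

(** * Limits along ultrafilters *)

Section ultralimit.
Context {R : realType}.

(* Convergence along an ultrafilter replaces the extraction of diagonal
   subsequences. *)
Lemma exists_ultrafilter (P : nat -> Prop) :
  (forall N0, exists2 N, (N0 <= N)%N & P N) ->
  exists U : set_system nat, [/\ UltraFilter U, U P & forall n, U [set N | (n <= N)%N]].
Proof.
move=> HP; pose F := filter_from [set: nat] (fun n => [set N | (n <= N)%N /\ P N]).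
have FF : ProperFilter F.
  apply: filter_from_proper; last by move=> n _; have [N nN PN] := HP n; exists N.
  apply: filter_from_filter; first by exists 0%N.
  move=> i j _ _; exists (maxn i j) => // N [/=]; rewrite geq_max => /andP[iN jN] PN.
  by split.
have [U [UU FU]] := ultraFilterLemma FF.
exists U; split=> // [|n].
  by apply: FU; exists 0%N => // N [].
by apply: FU; exists n => // N [].
Qed.

Lemma ultra_limit (U : set_system nat) (u : nat -> R) : UltraFilter U ->
  U [set N | 0 <= u N <= 1] -> exists2 l : R, 0 <= l <= 1 & u @ U --> l.
Proof.
move=> UU u01; have PU : ProperFilter U by exact: ultra_proper.
have := @segment_compact R 0 1 (u @ U) _ _.
move=> /(_ _)[|l [l01 cl]].
  by rewrite /= nbhs_simpl; apply: filterS u01 => N /=; rewrite in_itv.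
exists l; first by move: l01; rewrite /= in_itv.
move=> B Bl; rewrite nbhs_simpl/=.
have [//|nB] := in_ultra_setVsetC (u @^-1` B) UU.
have [y [[N nBN <-] By]] : (u @` (~` (u @^-1` B))) `&` B !=set0.
  apply: cl => //; rewrite nbhs_simpl/=; apply: filterS nB => N nBN /=.
  by exists N.
by case: nBN.
Qed.

Lemma cvg_eta (U : set_system nat) (u : nat -> R) (l : R) : ProperFilter U ->
  U [set N | 0 <= u N <= 1] -> 0 <= l -> u @ U --> l -> eta (u N) @[N --> U] --> eta l.
Proof.
move=> PU u01; rewrite le_eqVlt => /orP[/eqP <-|l0] ul; last first.
  apply: cvgN; apply: cvgM => //; apply: continuous_cvg => //.
  exact: continuous_ln.
(* At l = 0 the logarithm is not continuous, so the explicit bound [eta_le] is used. *)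
rewrite /eta mul0r oppr0; apply/cvgrPdist_le => e e0.
pose s := Num.min 1 (e / 3).
have s0 : 0 < s by rewrite lt_min ltr01 divr_gt0.
have s1 : s <= 1 by rewrite ge_min lexx.
have se : 3 * s <= e by rewrite mulrC -ler_pdivlMr// ge_min lexx orbT.
have s20 : 0 < s ^+ 2 by rewrite exprn_gt0.
move/cvgrPdist_le : ul => /(_ _ s20) us.
apply: (filterS2 _ _ u01 us) => N /andP[uN0 uN1] /=.
rewrite sub0r normrN ger0_norm// => us2.
rewrite -/(eta (u N)) sub0r normrN ger0_norm; last by rewrite eta_ge0// uN0.
apply: le_trans se; apply: eta_le; last by rewrite s0.
by rewrite uN0.
Qed.

End ultralimit.

(** * Empirical laws at times of large total weight *)

Section empirical_weights.
Context {R : realType} {t : transition_matrix}.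
Local Notation X := (markov_shift t).
Implicit Types (x y : X) (w : seq nat).
Variables (f : nat -> X -> R) (M C : R).
Hypotheses (fp : positive_seq f) (M1 : 1 <= M) (fM : distortion f M)
  (C0 : 0 < C) (fC : submultiplicative f C).
Variables (A : seq nat) (k c : R) (x0 : X).
Hypotheses (uA : uniq A) (k0 : 0 < k) (Ax0 : over A x0).

Let M0 : 0 < M. Proof. exact: lt_le_trans M1. Qed.

(** The fallback [x0] puts the representative of every word in [over A], so later sums over all
    words need no case distinction. *)
Definition representative w : X :=
  if `[< words (@over t A) (size w) w >] then point_over A w else x0.
Local Notation pts := representative.

Lemma representative_over w : over A (pts w).
Proof. by rewrite /pts; case: asboolP => // /point_overP[]. Qed.

Lemma representativeK n w : words (@over t A) n w -> mkseq (pts w) n = w.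
Proof.
move=> wW; have sw : size w = n by case: wW.
rewrite /pts sw asboolT//; by case: (point_overP wW).
Qed.

Lemma agree_representative n x : over A x -> agree n (pts (mkseq x n)) x.
Proof. by move=> Ax; apply/eq_mkseqP; rewrite representativeK//; exact: words_mkseq. Qed.

Lemma size_alphabet_gt0 : (0 < size A)%N.
Proof. by have := Ax0 0%N; case: (A). Qed.

Definition over_words N : seq (seq nat) :=
  [seq w <- allwords A N | `[< words (@over t A) N w >]].

Lemma mem_over_words N w : w \in over_words N -> words (@over t A) N w.
Proof. by rewrite mem_filter => /andP[/asboolP]. Qed.

Definition empirical_prob N w : R := f N (pts w) / total_weight f A N.

Lemma total_weightE N : total_weight f A N = \sum_(w <- over_words N) f N (pts w).
Proof.
rewrite /total_weight big_filter [RHS]big_mkcond/=; apply: eq_bigr => w _.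
rewrite /weight; case: asboolP => // wW; have sw : size w = N by case: wW.
by rewrite /pts sw asboolT.
Qed.

Definition empirical_freq N : seq nat -> R :=
  freq N (over_words N) (fun w => Defs.coord (pts w)) (empirical_prob N).
Local Notation fr := empirical_freq.

Section good_time.
Variable N : nat.
Hypotheses (N0 : (0 < N)%N) (good : k * expR (N%:R * c) <= total_weight f A N).

Let z0 : 0 < total_weight f A N.
Proof. by apply: lt_le_trans good; rewrite mulr_gt0// expR_gt0. Qed.

Lemma empirical_prob_gt0 w : 0 < empirical_prob N w.
Proof. by rewrite divr_gt0// fp. Qed.

Lemma sum_empirical_prob : \sum_(w <- over_words N) empirical_prob N w = 1.
Proof. by rewrite -big_distrl/= -total_weightE divff// gt_eqF. Qed.

Lemma over_words_uniq : uniq (over_words N).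
Proof. by rewrite filter_uniq// allwords_uniq. Qed.

Lemma over_words_inj :
  {in over_words N &, injective (fun w => mkseq (Defs.coord (pts w)) N)}.
Proof.
move=> u v /mem_over_words uW /mem_over_words vW.
by rewrite (representativeK uW) (representativeK vW).
Qed.

Lemma windowE x i q : window (Defs.coord x) i q = mkseq (iter i (@Defs.shift t) x) q.
Proof. by apply: eq_map => j; rewrite coord_iter_shift. Qed.

Lemma ln_distortion n x y : (0 < n)%N -> agree n x y -> ln (f n x) <= ln (f n y) + ln M.
Proof.
move=> n0 /(fM n0) h; rewrite addrC -lnM ?posrE ?fp// ler_ln ?posrE ?mulr_gt0 ?fp//.
Qed.

(** There are finitely many words of length at most q over [A], so bounded distortion bounds log f_j
    on [over A] uniformly in j <= q. *)
Definition log_bound q : R := \sum_(j < q.+1)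
  (ln M + `|ln C| + \sum_(w <- allwords A j) `|ln (f j (pts w))|).

Lemma log_boundP q j x : (0 < j <= q)%N -> over A x -> `|ln (f j x) + ln C| <= log_bound q.
Proof.
move=> /andP[j0 jq] Ax.
have lnM0 : 0 <= ln M by exact: ln_ge0.
have S0 i : 0 <= \sum_(w <- allwords A i) `|ln (f i (pts w))| by exact: sumr_ge0.
have jq' : (j < q.+1)%N by [].
rewrite /log_bound (bigD1 (Ordinal jq'))//= -[leLHS]addr0.
apply: lerD; last by apply: sumr_ge0 => i _; rewrite !addr_ge0.
pose w := mkseq x j.
have wA : w \in allwords A j by exact: mkseq_allwords.
have h : `|ln (f j (pts w))| <= \sum_(w <- allwords A j) `|ln (f j (pts w))|.
  by rewrite (big_rem w)//= lerDl sumr_ge0.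
apply: le_trans (ler_normD _ _) _; rewrite addrAC lerD2r.
apply: (@le_trans _ _ (ln M + `|ln (f j (pts w))|)); last by rewrite lerD2l.
have a1 : agree j (pts w) x by exact: agree_representative.
have := ln_distortion j0 a1; have := ln_distortion j0 (agree_sym a1).
rewrite ler_norml => h1 h2; have := ler_norm (ln (f j (pts w))).
have := ler_norm (- ln (f j (pts w))); rewrite normrN -/w in h1 h2 * => h3 h4.
by apply/andP; split; lra.
Qed.

Lemma empirical_log_le q v : (0 < q)%N -> (q < N)%N ->
  q%:R * (ln (f N (pts v)) + ln C) <=
  \sum_(i < N) ln (f q (pts (window (Defs.coord (pts v)) i q))) +
  N%:R * (ln M + ln C) + (3 * q + 1)%:R * log_bound q.
Proof.
(* Adding ln C makes the sequence exactly subadditive. Passing from a shifted point to the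
   representative of its window costs ln M at each of the N positions. *)
move=> q0 qN; pose g n x := ln (f n x) + ln C.
have := @subadditive_average R X (@Defs.shift t) (over A) g q (log_bound q) q0 _ _ _ N (pts v) qN
  (representative_over v).
move=> /(_ _ _ _)/le_trans; apply.
- by move=> x Ax; exact: (over_iter_shift 1 Ax).
- move=> n m x n0 m0 Ax; have := fC x n0 m0.
  rewrite -ler_ln ?posrE ?mulr_gt0 ?fp ?addn_gt0 ?n0//.
  by rewrite !lnM ?posrE ?mulr_gt0 ?fp// /g; lra.
- by move=> j x j0 Ax; exact: log_boundP.
rewrite lerD2r.
have -> : N%:R * (ln M + ln C) = \sum_(i < N) (ln M + ln C).
  by rewrite sumr_const card_ord mulr_natl.
rewrite -big_split/=; apply: ler_sum => i _; rewrite /g addrA lerD2r windowE.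
apply: ln_distortion => //; apply: agree_sym; apply: agree_representative.
exact: over_iter_shift (representative_over v).
Qed.

(** For a law proportional to f_N, ln Z_N is exactly entropy plus mean of log f_N. The entropy is
    bounded through windows of length j + 1 and the mean through windows of length q; these lengths
    are independent, and all errors depending on them are divided by N. *)
Lemma empirical_inequality q j : (0 < q)%N -> (q < N)%N ->
  c <= block_entropy A (fr N) j.+1 - block_entropy A (fr N) j +
       q%:R^-1 * (\sum_(w <- allwords A q) fr N w * ln (f q (pts w)) + ln M + ln C) +
       (j%:R * ln (size A)%:R + (3 * q + 1)%:R * log_bound q / q%:R - ln C - ln k) / N%:R.
Proof.
move=> q0 qN.
have NR : 0 < N%:R :> R by rewrite ltr0n.
have qR : 0 < q%:R :> R by rewrite ltr0n.
pose x w : nat -> nat := Defs.coord (pts w).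
have xA v i : x v i \in A by exact: representative_over.
pose p := empirical_prob N.
have ent := empirical_entropy_le uA N0 over_words_uniq empirical_prob_gt0
  sum_empirical_prob xA over_words_inj j size_alphabet_gt0.
rewrite -/(fr N) in ent.
have lz : ln k + N%:R * c <= ln (total_weight f A N).
  rewrite -[N%:R * c]expRK -lnM ?posrE ?expR_gt0// ler_ln ?posrE// mulr_gt0// expR_gt0//.
have zE : ln (total_weight f A N) =
    - \sum_(v <- over_words N) p v * ln (p v) +
    \sum_(v <- over_words N) p v * ln (f N (pts v)).
  rewrite -sumrN -big_split/= -[LHS]mul1r -sum_empirical_prob big_distrl/=.
  apply: eq_bigr => v _; rewrite {3}/p /empirical_prob ln_div ?posrE ?fp//.
  by rewrite -/(empirical_prob N v) -/p; ring.
have sf : \sum_(w <- allwords A q) fr N w * ln (f q (pts w)) =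
    \sum_(v <- over_words N) p v * (N%:R^-1 * \sum_(i < N) ln (f q (pts (window (x v) i q)))).
  exact: (sum_freq _ _ _ uA xA q (fun w => ln (f q (pts w)))).
have main : q%:R * \sum_(v <- over_words N) p v * ln (f N (pts v)) <=
    N%:R * (\sum_(w <- allwords A q) fr N w * ln (f q (pts w)) + ln M + ln C) +
    (3 * q + 1)%:R * log_bound q - q%:R * ln C.
  rewrite sf.
  have -> : N%:R * (\sum_(v <- over_words N)
        p v * (N%:R^-1 * \sum_(i < N) ln (f q (pts (window (x v) i q)))) + ln M + ln C) +
      (3 * q + 1)%:R * log_bound q - q%:R * ln C =
      \sum_(v <- over_words N) p v * (\sum_(i < N) ln (f q (pts (window (x v) i q))) +
        N%:R * (ln M + ln C) + (3 * q + 1)%:R * log_bound q - q%:R * ln C).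
    have e1 (F : seq nat -> R) : \sum_(v <- over_words N) p v * (N%:R^-1 * F v) =
        N%:R^-1 * \sum_(v <- over_words N) p v * F v.
      by rewrite big_distrr/=; apply: eq_bigr => v _; ring.
    have e2 (F : seq nat -> R) (a b d : R) :
        \sum_(v <- over_words N) p v * (F v + a + b - d) =
        \sum_(v <- over_words N) p v * F v + (a + b - d).
      rewrite -[a + b - d]mul1r -[in RHS]sum_empirical_prob big_distrl/= -big_split/=.
      by apply: eq_bigr => v _; rewrite /p; ring.
    by rewrite e1 e2; field; rewrite gt_eqF.
  rewrite big_distrr/=; apply: ler_sum => v _; rewrite mulrCA ler_pM2l; last exact: empirical_prob_gt0.
  by have := empirical_log_le v q0 qN; rewrite mulrDr; lra.
have main' : \sum_(v <- over_words N) p v * ln (f N (pts v)) <=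
    N%:R * (q%:R^-1 * (\sum_(w <- allwords A q) fr N w * ln (f q (pts w)) + ln M + ln C)) +
    (3 * q + 1)%:R * log_bound q / q%:R - ln C.
  rewrite -(ler_pM2l qR); apply: le_trans main _; rewrite le_eqVlt; apply/orP; left.
  by apply/eqP; field; rewrite gt_eqF.
rewrite -(ler_pM2l NR) !mulrDr [X in _ <= _ + X]mulrC divfK ?gt_eqF//.
by move: ent main' lz zE; rewrite -/p; lra.
Qed.

End good_time.
End empirical_weights.

Lemma cvg_bigsum (R : realType) (U : set_system nat) (I : Type) (r : seq I)
    (F : I -> nat -> R) (l : I -> R) : Filter U ->
  (forall i, F i @ U --> l i) ->
  \sum_(i <- r) F i N @[N --> U] --> \sum_(i <- r) l i.
Proof.
move=> FU Fl; elim: r => [|i r ih].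
  by rewrite big_nil; under eq_fun do rewrite big_nil; exact: cvg_cst.
by rewrite big_cons; under eq_fun do rewrite big_cons; exact: cvgD.
Qed.

Section limit_weights.
Context {R : realType} {t : transition_matrix}.
Local Notation X := (markov_shift t).
Variables (f : nat -> X -> R) (M C : R).
Hypotheses (fp : positive_seq f) (M1 : 1 <= M) (fM : distortion f M)
  (C0 : 0 < C) (fC : submultiplicative f C).
Variables (A : seq nat) (k c : R) (x0 : X).
Hypotheses (uA : uniq A) (k0 : 0 < k) (Ax0 : over A x0).
Hypothesis growing : forall N0, exists N, [/\ (N0 <= N)%N, (0 < N)%N &
  k * expR (N%:R * c) <= total_weight f A N].
Local Notation pts := (representative A x0).
Local Notation fr := (empirical_freq f A x0).

(** For fixed q and j only finitely many frequencies occur and the error is O(1 / N), so one limit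
    serves all q and j at once. The 1 / N defect of left consistency vanishes, and shift invariance
    of the weights becomes exact. *)
Lemma exists_limit_weights : exists m : seq nat -> R,
  [/\ (forall w, 0 <= m w) /\ m [::] = 1,
      forall w, \sum_(a <- A) m (rcons w a) = m w,
      forall w, \sum_(a <- A) m (a :: w) = m w,
      forall w, 0 < m w -> words [set: X] (size w) w /\ all (mem A) w &
      forall q j, (0 < q)%N -> c <= block_entropy A m j.+1 - block_entropy A m j +
        q%:R^-1 * (\sum_(w <- allwords A q) m w * ln (f q (pts w)) + ln M + ln C)].
Proof.
pose P N := (0 < N)%N /\ k * expR (N%:R * c) <= total_weight f A N.
have [U [UU UP Uge]] : exists U : set_system nat,
    [/\ UltraFilter U, U P & forall n, U [set N | (n <= N)%N]].
  by apply: exists_ultrafilter => N0; have [N [? ? ?]] := growing N0; exists N.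
have PU : ProperFilter U by exact: ultra_proper.
have xA v i : Defs.coord (pts v) i \in A by exact: representative_over.
have p0 N : P N -> forall w, 0 < empirical_prob f A x0 N w.
  by move=> [N0 good] w; exact: (empirical_prob_gt0 fp x0 k0 N0 good).
have p1 N : P N -> \sum_(w <- @over_words t A N) empirical_prob f A x0 N w = 1.
  by move=> [N0 good]; exact: (sum_empirical_prob x0 k0 good).
have fr01 N w : P N -> 0 <= fr N w <= 1.
  move=> PN; have [N0 _] := PN; apply/andP; split.
    exact: (freq_ge0 _ _ N0 (p0 _ PN)).
  exact: (freq_le1 _ N0 (p0 _ PN) (p1 _ PN)).
have /choice[m mP] : forall w, exists l : R, 0 <= l <= 1 /\ fr N w @[N --> U] --> l.
  move=> w; have [|l l01 ul] := ultra_limit (u := fun N => fr N w) UU.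
    by apply: filterS UP => N PN; exact: fr01.
  by exists l.
have ml w : fr N w @[N --> U] --> m w by case: (mP w).
have m0 w : 0 <= m w by case: (mP w) => /andP[].
have msum (g : nat -> seq nat) (s : seq nat) : 
    \sum_(a <- s) fr N (g a) @[N --> U] --> \sum_(a <- s) m (g a).
  by apply: cvg_bigsum => a; exact: ml.
have uniq_lim (u v : nat -> R) (a b : R) : u @ U --> a -> v @ U --> b ->
    (forall N, P N -> u N = v N) -> a = b.
  move=> ua vb uv; apply/eqP; rewrite eq_le; apply/andP; split.
    by apply: (ler_cvg_to ua vb); apply: filterS UP => N PN; rewrite uv.
  by apply: (ler_cvg_to vb ua); apply: filterS UP => N PN; rewrite uv.
have Ninv : N%:R^-1 @[N --> U] --> (0 : R).
  apply/cvgrPdist_le => e e0; have [n nP] := exists_nat_ge e^-1.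
  apply: filterS (Uge n.+1) => N /= nN; have NR : 0 < N%:R :> R by rewrite ltr0n; lia.
  by rewrite sub0r normrN gtr0_norm ?invr_gt0// -[leRHS]invrK lef_pV2 ?posrE ?invr_gt0// nP// ltnW.
exists m; split.
- split=> //; apply: (uniq_lim _ _ _ _ (ml [::]) (cvg_cst (1 : R))) => N PN.
  by have [N0 _] := PN; exact: (freq_nil uA N0 (p1 _ PN) xA).
- move=> w; apply: (uniq_lim _ _ _ _ (msum (rcons w) A) (ml w)) => N PN.
  exact: (sum_freq_rcons _ _ _ uA xA).
- move=> w; apply/eqP; rewrite -subr_eq0 -normr_eq0 eq_le normr_ge0 andbT.
  have h1 : `|\sum_(a <- A) fr N (a :: w) - fr N w| @[N --> U] -->
      `|\sum_(a <- A) m (a :: w) - m w|.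
    by apply: cvg_norm; apply: cvgB => //; exact: (msum (fun a => a :: w)).
  apply: (ler_cvg_to h1 Ninv); apply: filterS UP => N PN.
  by have [N0 _] := PN; exact: (sum_freq_cons uA N0 (p0 _ PN) (p1 _ PN) xA).
(* A positive limit makes the frequency positive at some good time, so the word occurs in a point of
   the subsystem. *)
- move=> w mw; have : U [set N | 0 < fr N w].
    have := ml w; move/cvgrPdist_lt => /(_ _ mw); apply: filterS => N /=.
    by have := ler_norm (m w - fr N w); lra.
  move=> /(filterI UP)/filter_ex[N [PN /= frw]].
  have [v [i vi]] := freq_gt0_window frw.
  split.
    rewrite windowE in vi; apply/wordsP; exists (iter i (@Defs.shift t) (pts v)) => //.
  by rewrite -vi; apply/allP => a /mapP[j _ ->]; exact: xA.
move=> q j q0; set E := j%:R * ln (size A)%:R + (3 * q + 1)%:R * log_bound f M C A x0 q / q%:R - ln C - ln k.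
have BE i : block_entropy A (fr N) i @[N --> U] --> block_entropy A m i.
  apply: cvg_bigsum => w; apply: cvg_eta => //; first by apply: filterS UP => N PN; exact: fr01.
have c1 : (block_entropy A (fr N) j.+1 - block_entropy A (fr N) j +
       q%:R^-1 * (\sum_(w <- allwords A q) fr N w * ln (f q (pts w)) + ln M + ln C) +
       E * N%:R^-1) @[N --> U] -->
   (block_entropy A m j.+1 - block_entropy A m j +
       q%:R^-1 * (\sum_(w <- allwords A q) m w * ln (f q (pts w)) + ln M + ln C) + E * 0).
  apply: cvgD; last by apply: cvgM => //; exact: cvg_cst.
  apply: cvgD; first by apply: cvgB.
  apply: cvgM; first exact: cvg_cst.
  apply: cvgD; last exact: cvg_cst.
  apply: cvgD; last exact: cvg_cst.
  by apply: cvg_bigsum => w; apply: cvgM => //; exact: cvg_cst.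
rewrite mulr0 addr0 in c1; apply: (ler_cvg_to (cvg_cst c) c1).
apply: (filterS2 _ _ UP (Uge q.+1)) => N [N0 good] qN.
exact: (empirical_inequality fp M1 fM C0 fC uA k0 Ax0 N0 good).
Qed.

End limit_weights.

(** * Support and invariance of the limit measure *)

Section weighted_cylinders.
Context {R : realType} {t : transition_matrix}.
Local Notation X := (markov_shift t).
Local Notation BX := (borel_shift t).
Local Notation sigma := (@Defs.shift t : BX -> BX).
Variables (A : seq nat) (m : seq nat -> R) (mu : probability BX R).
Hypotheses (uA : uniq A) (m_nil : m [::] = 1)
  (m_rcons : forall w, \sum_(a <- A) m (rcons w a) = m w)
  (m_cons : forall w, \sum_(a <- A) m (a :: w) = m w)
  (mu_cylinder : forall w, all (mem A) w -> mu (cylinder w) = (m w)%:E).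

Lemma sum_weights n : \sum_(w <- allwords A n) m w = 1.
Proof.
elim: n => [|n IH]; first by rewrite big_seq1.
by rewrite sum_allwords_rcons -IH; apply: eq_bigr => w _; exact: m_rcons.
Qed.

Lemma measure_bigcup_words (I : choiceType) (s : seq I) (g : I -> seq nat) : uniq s ->
  {in s &, forall i j, (@cylinder t (g i) `&` cylinder (g j)) !=set0 -> i = j} ->
  (mu (\bigcup_(i in [set` s]) cylinder (g i)) = \sum_(i <- s) mu (cylinder (g i)))%E.
Proof.
move=> us tg; rewrite measure_fin_bigcup//.
- by rewrite -fsbig_seq.
- by move=> i _; exact: measurable_cylinder.
Qed.

Let prefix_over n : set BX := \bigcup_(w in [set` allwords A n]) cylinder w.

Let prefix_overP n x : prefix_over n x <-> mkseq (Defs.coord x) n \in allwords A n.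
Proof.
split=> [[w /= wA xw]|xA]; last first.
  by exists (mkseq (Defs.coord x) n) => //; exact: cylinder_mkseq.
have [/eqP <- _] := andP (etrans (esym (mem_allwords A n w)) wA).
have {}xw : mkseq (Defs.coord x) (size w) = w := xw.
by move: wA; rewrite xw !mem_allwords => /andP[_ ->]; rewrite eqxx.
Qed.

Let measurable_prefix_over n : measurable (prefix_over n).
Proof.
apply: fin_bigcup_measurable => //.
by move=> w _; exact: measurable_cylinder.
Qed.

Let measure_prefix_over n : mu (prefix_over n) = 1%E.
Proof.
rewrite /prefix_over (measure_bigcup_words (g := id))//.
- rewrite -(sum_weights n) -sumEFin big_seq [in RHS]big_seq; apply: eq_bigr => w.
  by rewrite mem_allwords => /andP[_ /mu_cylinder].
- exact: allwords_uniq.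
- move=> u v; rewrite !mem_allwords => /andP[/eqP su _] /andP[/eqP sv _] [x [/= xu xv]].
  by rewrite -xu -xv /cylinder/= su sv.
Qed.

Let overE : @over t A = \bigcap_n prefix_over n.
Proof.
apply/seteqP; split=> x.
  by move=> Ax n _; apply/prefix_overP; exact: mkseq_allwords.
move=> xU n; have /prefix_overP := xU n.+1 I; rewrite mem_allwords => /andP[_ /allP]; apply.
by apply/mapP; exists n => //; rewrite mem_iota add0n ltnS leqnn.
Qed.

Lemma measurable_over : measurable (@over t A : set BX).
Proof. by rewrite overE; apply: bigcapT_measurable => n; exact: measurable_prefix_over. Qed.

Lemma negligible_over : mu.-negligible (~` @over t A).
Proof.
rewrite overE setC_bigcap; apply: negligible_bigcup => n.
apply/negligibleP; first exact: measurableC.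
by have := probability_setC mu (measurable_prefix_over n); rewrite measure_prefix_over subee.
Qed.

Lemma measure_eq_over (B1 B2 : set BX) : measurable B1 -> measurable B2 ->
  (forall x, over A x -> B1 x <-> B2 x) -> mu B1 = mu B2.
Proof.
move=> mB1 mB2 h; have mO := measurable_over.
have n0 : mu (~` @over t A) = 0%E.
  by apply/negligibleP; [exact: measurableC|exact: negligible_over].
have main (B : set BX) : measurable B -> mu B = mu (B `&` @over t A).
  move=> mB; have D0 : mu (B `\` @over t A) = 0%E.
    by apply: subset_measure0 n0; [exact: measurableD|exact: measurableC|move=> x []].
  by transitivity (mu (B `\` @over t A) + mu (B `&` @over t A))%E;
    [exact: measureDI|rewrite D0 add0e].
rewrite main// [RHS]main//; congr (mu _).
by apply/seteqP; split=> x [Bx Ax]; split=> //; apply/(h x Ax).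
Qed.

(** Equality on cylinders suffices. If w has a letter outside [A], both sides vanish because the
    measure is carried by [over A]; otherwise the claim is left consistency of the weights. *)
Lemma weighted_cylinders_invariant : Defs.invariant mu sigma.
Proof.
have mS : measurable_fun setT sigma := measurable_shift.
suff cyl w : mu (sigma @^-1` cylinder w) = mu (cylinder w).
  have [nu nuE] := exists_pushforward_probability mS (probability_setT mu).
  move=> B mB; rewrite -nuE; apply: borel_measure_unique => // [|w].
    by apply: (@le_lt_trans _ _ 1%E); [exact: probability_le1|rewrite ltry].
  exact: etrans (nuE _) (cyl w).
have mw : measurable (cylinder w : set BX) := measurable_cylinder w.
have mSw : measurable (sigma @^-1` cylinder w) by rewrite -[_ @^-1` _]setTI; exact: mS.
case: (boolP (all (mem A) w)) => wA; last first.
  rewrite (@measure_eq_over _ set0)// ?measure0; last first.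
    move=> x Ax; split=> //= xw; case/negP: wA; rewrite -xw; apply/allP => a /mapP[i _ ->].
    by rewrite coord_shift; exact: Ax.
  rewrite (@measure_eq_over _ set0)// ?measure0// => x Ax; split=> //= xw.
  by case/negP: wA; rewrite -xw; apply/allP => a /mapP[i _ ->]; exact: Ax.
pose V : set BX := \bigcup_(a in [set` A]) cylinder (a :: w).
have mV : measurable V.
  apply: fin_bigcup_measurable => //.
  by move=> a _; exact: measurable_cylinder.
rewrite (@measure_eq_over _ V)//; last first.
  move=> x Ax; rewrite shift_preimage_cylinder; split=> -[a /= aA xa]; last by exists a.
  by exists a => //=; move: (Ax 0%N); case: xa => ->.
rewrite /V (measure_bigcup_words (g := fun a => a :: w))//; last first.
  by move=> a b _ _ [x [[<- _] [<- _]]].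
rewrite mu_cylinder// -m_cons -sumEFin big_seq [in RHS]big_seq; apply: eq_bigr => a aA.
by rewrite mu_cylinder//= wA andbT.
Qed.

End weighted_cylinders.

(** * Entropy and integrals for the limit measure *)

Section weighted_itineraries.
Context {R : realType} {t : transition_matrix}.
Local Notation X := (markov_shift t).
Local Notation BX := (borel_shift t).
Local Notation sigma := (@Defs.shift t : BX -> BX).
Variables (A : seq nat) (m : seq nat -> R) (mu : probability BX R).
Hypotheses (uA : uniq A) (m_nil : m [::] = 1)
  (m_rcons : forall w, \sum_(a <- A) m (rcons w a) = m w)
  (mu_cylinder : forall w, all (mem A) w -> mu (cylinder w) = (m w)%:E).

(** The index of a symbol outside [A] is size A, hence one label more than there are symbols in
    [A]. *)
Definition alphabet_label (x : BX) : 'I_(size A).+1 := inord (index (Defs.coord x 0) A).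
Local Notation xi := alphabet_label.

Definition word_code q (w : seq nat) : {ffun 'I_q -> 'I_(size A).+1} :=
  [ffun i : 'I_q => inord (index (nth 0%N w i) A)].

Definition word_decode q (i : {ffun 'I_q -> 'I_(size A).+1}) : seq nat :=
  [seq nth 0%N A (i j) | j <- enum 'I_q].

Lemma word_codeK q w : w \in allwords A q -> word_decode (word_code q w) = w.
Proof.
rewrite mem_allwords => /andP[/eqP sw /allP wA].
apply: (@eq_from_nth _ 0%N) => [|j]; rewrite size_map size_enum_ord ?sw// => jq.
rewrite (nth_map (Ordinal jq)) ?size_enum_ord// ffunE.
have -> : nth (Ordinal jq) (enum 'I_q) j = Ordinal jq by apply: val_inj; rewrite /= nth_enum_ord.
have jA : nth 0%N w j \in A by apply: wA; rewrite mem_nth// sw.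
by rewrite /= inordK ?nth_index// ltnS ltnW// index_mem.
Qed.

Lemma label_alphabet : measurable_label xi.
Proof.
move=> i; have -> : xi @^-1` [set i] =
    \bigcup_(a in [set a | inord (index a A) = i]) [set x : BX | Defs.coord x 0 = a].
  by apply/seteqP; split=> [x x_i|x [a ai /= xa]]; [exists (Defs.coord x 0)|rewrite /= /xi xa].
by apply: bigcup_measurable => a _; exact: measurable_symbol.
Qed.

Lemma itinerary_word_code q x : itinerary sigma xi q x = word_code q (mkseq (Defs.coord x) q).
Proof.
by apply/ffunP => i; rewrite !ffunE /xi coord_iter_shift addn0 nth_mkseq.
Qed.

Let label_words q : measurable_label (itinerary sigma xi q).
Proof. by apply: label_itinerary; [exact: measurable_shift|exact: label_alphabet]. Qed.

Lemma law_word_code q w : w \in allwords A q -> law mu (itinerary sigma xi q) (word_code q w) = m w.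
Proof.
move=> wA; have [/eqP sw aw] := andP (etrans (esym (mem_allwords A q w)) wA).
apply: EFin_inj; rewrite -mu_cylinder// /law -prE; last exact: label_words.
apply: (measure_eq_over uA m_nil m_rcons mu_cylinder) => [||x Ax].
- exact: label_words.
- exact: measurable_cylinder.
rewrite /preimage/= itinerary_word_code /cylinder/= sw; split=> [e|->//].
by rewrite -(word_codeK wA) -e word_codeK// mkseq_allwords.
Qed.

Lemma law_not_word_code q i : i \notin [seq word_code q w | w <- allwords A q] ->
  law mu (itinerary sigma xi q) i = 0.
Proof.
move=> iW; apply: EFin_inj; rewrite /law -prE; last exact: label_words.
rewrite -[RHS](measure0 mu).
apply: (measure_eq_over uA m_nil m_rcons mu_cylinder) => //.
  exact: label_words.
move=> x Ax; split=> //; rewrite /preimage/= itinerary_word_code => e; case/negP: iW.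
by apply/mapP; exists (mkseq (Defs.coord x) q) => //; exact: mkseq_allwords.
Qed.

Lemma sum_law_words q (F : {ffun 'I_q -> 'I_(size A).+1} -> R -> R) :
  (forall i, F i 0 = 0) ->
  \sum_i F i (law mu (itinerary sigma xi q) i) =
  \sum_(w <- allwords A q) F (word_code q w) (m w).
Proof.
move=> F0; pose s := [seq word_code q w | w <- allwords A q].
have us : uniq s.
  rewrite map_inj_in_uniq ?allwords_uniq// => u v uW vW e.
  by rewrite -(word_codeK uW) e word_codeK.
rewrite (bigID (mem s))/= addrC big1 ?add0r; last first.
  by move=> i iS; rewrite law_not_word_code.
rewrite -big_uniq// big_map big_seq [RHS]big_seq; apply: eq_bigr => w wW.
by rewrite law_word_code.
Qed.

Lemma label_entropy_words q :
  label_entropy mu (itinerary sigma xi q) = block_entropy A m q.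
Proof. by rewrite /label_entropy (sum_law_words (F := fun=> @eta R))// => _; rewrite /eta mul0r oppr0. Qed.

Section integral.
Variables (x0 : X) (f : nat -> X -> R) (M : R).
Hypotheses (Ax0 : over A x0) (fp : positive_seq f) (M1 : 1 <= M) (fM : distortion f M)
  (fc : forall n, (0 < n)%N -> continuous (f n)).
Local Open Scope ereal_scope.

(** Outside [over A] nothing bounds log f_q. It is replaced there by the simple function h read off
    the itinerary: the resulting g stays within ln M of h everywhere and equals log f_q almost
    everywhere. *)
Lemma integral_log_weights q : (0 < q)%N -> mu.-integrable setT (log_fun f q) /\
  (\sum_(w <- allwords A q) m w * ln (f q (representative A x0 w)) - ln M)%:E <=
  \int[mu]_x log_fun f q x.
Proof.
move=> q0; pose W x := itinerary sigma xi q x.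
pose h (x : BX) := ln (f q (representative A x0 (word_decode (W x)))).
pose g (x : BX) := if x \in (@over t A : set BX) then ln (f q x) else h x.
have mO : measurable (@over t A : set BX) := measurable_over A.
have ih : mu.-integrable setT (fun x => (h x)%:E).
  exact: (integrable_label mu (fun i => ln (f q (representative A x0 (word_decode i)))) (@label_words q)).
have hE : \int[mu]_x (h x)%:E = (\sum_(w <- allwords A q) m w * ln (f q (representative A x0 w)))%:E.
  rewrite (integral_label mu (fun i => ln (f q (representative A x0 (word_decode i)))) (@label_words q)).
  rewrite (sum_law_words (F := fun i r => r * ln (f q (representative A x0 (word_decode i))))%R); last first.
    by move=> i; rewrite mul0r.
  by congr (_%:E); rewrite big_seq [RHS]big_seq; apply: eq_bigr => w /word_codeK ->.
have gh x : (`|g x - h x| <= ln M)%R.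
  have lnM0 : (0 <= ln M)%R by exact: ln_ge0.
  rewrite /g; case: ifP => [/set_mem Ax|_]; last by rewrite subrr normr0.
  rewrite /h /W itinerary_word_code word_codeK ?mkseq_allwords//.
  have a := agree_representative x0 (n := q) Ax.
  have := ln_distortion fp M1 fM q0 a; have := ln_distortion fp M1 fM q0 (agree_sym a).
  by rewrite ler_norml; lra.
have mf := measurable_ln_seq fc q0.
have mh : measurable_fun setT h by apply/measurable_EFinP; exact: (measurable_int mu ih).
have mg : measurable_fun setT g.
  apply: measurable_fun_ifT => //.
  apply: (@measurable_fun_bool _ _ _ _ true); rewrite setTI.
  by rewrite (_ : _ @^-1` _ = @over t A)//; apply/seteqP; split=> x /= => [/set_mem|/mem_set].
have ihM : mu.-integrable setT (fun x => (h x - ln M)%:E).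
  by have := integrableB measurableT ih (finite_measure_integrable_cst mu (ln M) measurableT).
have ig : mu.-integrable setT (fun x => (g x)%:E).
  have ihN : mu.-integrable setT (fun x => (`|h x| + ln M)%:E).
    by have := integrableD measurableT (integrable_abse ih) (finite_measure_integrable_cst mu (ln M) measurableT).
  apply: le_integrable ihN => //; first exact/measurable_EFinP.
  move=> x _ /=; rewrite lee_fin [leRHS]ger0_norm ?addr_ge0 ?ln_ge0//.
  have := gh x; have := ler_normD (g x - h x)%R (h x); rewrite subrK; lra.
have fg : ae_eq mu setT (fun x => (g x)%:E) (log_fun f q).
  have := negligible_over uA m_nil m_rcons mu_cylinder.
  apply: negligibleS => x /= /not_implyP[_ /eqP ne] Ax; case/negP: ne.
  by rewrite /g mem_set.
have mlf : measurable_fun setT (log_fun f q) by exact/measurable_EFinP.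
have mgE : measurable_fun setT (fun x => (g x)%:E) by exact/measurable_EFinP.
split.
  have /integrableP[_ gf] := ig; apply/integrableP; split=> //.
  apply: le_lt_trans gf; rewrite le_eqVlt; apply/orP; left; apply/eqP.
  apply: ae_eq_integral => //; [exact: measurableT_comp|exact: measurableT_comp|].
  apply: filterS fg => x e Tx; by rewrite e.
have <- : \int[mu]_x (g x)%:E = \int[mu]_x log_fun f q x by exact: ae_eq_integral fg.
have -> : (\sum_(w <- allwords A q) m w * ln (f q (representative A x0 w)) - ln M)%:E =
    \int[mu]_x (h x - ln M)%:E.
  rewrite EFinB -hE -(integral_constant mu (ln M)).
  by rewrite -integralB//; exact: finite_measure_integrable_cst.
apply: le_integral => // x _; rewrite lee_fin.
by have := gh x; rewrite ler_norml; lra.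
Qed.

End integral.
End weighted_itineraries.

(** * Measures nearly attaining the pressure *)

Section lower_bound.
Context {R : realType} {t : transition_matrix}.
Local Notation X := (markov_shift t).
Local Notation BX := (borel_shift t).
Local Notation sigma := (@Defs.shift t : BX -> BX).
Variables (f : nat -> X -> R) (M C : R) (p : nat) (D : R).
Hypotheses (fp : positive_seq f) (fc : forall n, (0 < n)%N -> continuous (f n))
  (M1 : 1 <= M) (fM : distortion f M) (C0 : 0 < C) (fC : submultiplicative f C)
  (D0 : 0 < D).
Hypothesis alphabets : forall s : seq nat, exists A : seq nat,
  [/\ uniq A, {subset s <= A}, forall a, a \in A -> exists2 b, b \in A & t a b
    & gluing (over A) f (iota 0 p.+1) D].

Lemma exists_almost_equilibrium (c : R) : (c%:E < pressure f)%E ->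
  exists mu : probability BX R, [/\ Defs.invariant mu sigma, integrals_defined f mu,
    (-oo < limn_esup (mean_log f mu))%E &
    (c%:E <= entropy mu sigma + limn_esup (mean_log f mu))%E].
Proof.
move=> cP; have [A [k k0 [uA _ growing]]] := exists_growing_alphabet fp M1 fM D0 alphabets cP.
have [x0 Ax0] : exists x0, @over t A x0.
  have [N [_ _ good]] := growing 0%N; apply: contrapT => none.
  have : 0 < total_weight f A N by apply: lt_le_trans good; rewrite mulr_gt0// expR_gt0.
  rewrite /total_weight big1 ?ltxx// => w _; rewrite /weight; case: asboolP => //.
  by move=> [_ [x [_ Ax]]]; case: none; exists x.
have [m [[m0 m_nil] m_rcons m_cons m_word mc]] :=
  exists_limit_weights fp M1 fM C0 fC uA k0 Ax0 growing.
have m_words w : 0 < m w -> words [set: X] (size w) w by case/m_word.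
have [mu mu_cylinder] := exists_cylinder_measure uA m0 m_nil m_rcons m_words.
have inv := weighted_cylinders_invariant uA m_nil m_rcons m_cons mu_cylinder.
have intf q (q0 : (0 < q)%N) :=
  integral_log_weights uA m_nil m_rcons mu_cylinder x0 fp M1 fM fc q0.
pose S q := \sum_(w <- allwords A q) m w * ln (f q (representative A x0 w)).
pose h := label_entropy_rate mu sigma (@alphabet_label t A).
have ch q : (0 < q)%N -> c <= h + q%:R^-1 * (S q + ln M + ln C).
  move=> q0; set K := q%:R^-1 * _.
  (* Summing over the orders j < n telescopes the conditional entropies to the block entropy H_n, as
     H_0 = 0; division by n then produces the entropy rate h. *)
  have sumQ n : n%:R * c <= block_entropy A m n + n%:R * K.
    have := @ler_sum R _ (index_enum 'I_n) predT (fun=> c) _ (fun j _ => mc q j q0).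
    rewrite sumr_const card_ord -[c *+ n]mulr_natl => /le_trans; apply.
    rewrite big_split/= sumr_const card_ord -[_ *+ n]mulr_natl lerD2r.
    rewrite -(big_mkord predT (fun j => block_entropy A m j.+1 - block_entropy A m j)).
    rewrite telescope_sumr// /block_entropy big_seq1 m_nil /eta ln1 mulr0 oppr0 subr0.
    exact: lexx.
  have cv : (n%:R^-1 * label_entropy mu (itinerary sigma (@alphabet_label t A) n) + K)
      @[n --> \oo] --> h + K.
    apply: cvgD; last exact: cvg_cst.
    by apply: cvg_label_entropy_rate => //; [exact: measurable_shift|exact: label_alphabet].
  apply: (ler_cvg_to (cvg_cst c) cv); near=> n.
  have n0 : 0 < n%:R :> R by rewrite ltr0n; near: n; exact: nbhs_infty_gt.
  rewrite -(ler_pM2l n0) mulrDr mulVKf ?gt_eqF// (label_entropy_words uA m_nil m_rcons mu_cylinder).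
  exact: sumQ.
have lim_ge : ((c - h)%:E <= limn_esup (mean_log f mu))%E.
  (* One ln M and the ln C come from [ch], the other ln M from comparing the integral with S q;
     their share vanishes as q grows. *)
  pose v q : \bar R := (c - h - (2 * ln M + ln C) / q%:R)%:E.
  have vl : v @ \oo --> (c - h)%:E.
    apply: cvg_EFin; first exact: nearW.
    by rewrite -[X in _ --> X]subr0; apply: cvgB; [exact: cvg_cst|exact: cvg_div_natr].
  have <- : limn_esup v = (c - h)%:E.
    by rewrite is_cvg_limn_esupE; [exact/cvg_lim|apply/cvg_ex; exists (c - h)%:E].
  apply: (@le_limn_esup _ _ _ 1) => q q0.
  have [iq] := intf q q0; rewrite /mean_log -/(S q).
  have := integrable_fin_num measurableT iq.
  case: (\int[mu]_x _)%E => // r _; rewrite -EFinM !lee_fin => Sr.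
  have q1 : 0 < q%:R^-1 :> R by rewrite invr_gt0 ltr0n.
  have := ch q q0; have := ler_wpM2l (ltW q1) Sr; rewrite !mulrDr mulrN; lra.
exists mu; split=> //.
- move=> q q0; left; have [iq _] := intf q q0.
  have /(integrable_funepos measurableT)/integrableP[_] := iq.
  apply: le_lt_trans; rewrite le_eqVlt; apply/orP; left; apply/eqP.
  by apply: eq_integral => x _; rewrite gee0_abs// funepos_ge0.
- exact: lt_le_trans (ltNyr _) lim_ge.
have hle : (h%:E <= entropy mu sigma)%E.
  apply: ereal_sup_ubound; exists (size A).+1, (@alphabet_label t A); split.
    exact: label_alphabet.
  by rewrite partition_entropyE.
have -> : c%:E = (h%:E + (c - h)%:E)%E by rewrite -EFinD addrC subrK.
exact: leeD.
Unshelve. all: by end_near. Qed.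

End lower_bound.

Theorem theorem4p2 (R : realType) (t : transition_matrix)
    (f : nat -> markov_shift t -> R)
    (irrX : irreducible_shift t)
    (f_seq : positive_continuous f)
    (f_bowen : bowen f)
    (f_sub : subadditive_up_to_constant f)
    (f_uqm : uniformly_quasi_multiplicative f) :
  ((pressure f < +oo)%E ->
     (gurevich_eq_pressure f /\ variational_principle_lim f) /\
     (strong_specification f ->
        forall a : nat,
          log_rate (periodic_partition_function f a) n @[n --> \oo]
            --> gurevich_pressure f a)) /\
  (pressure f = +oo%E ->
     (gurevich_eq_pressure f /\ variational_principle_limsup f) /\
     ((ereal_sup [set (f 1%N x)%:E | x in [set: markov_shift t]] < +oo)%E ->
        gurevich_eq_pressure f /\ variational_principle_lim f)).
Proof.
have fp : positive_seq f by move=> n x n0; have [_] := f_seq n n0; exact.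
have fc n : (0 < n)%N -> continuous (f n) by move=> /f_seq[].
have [M M1 fM] := bowen_distortion fp f_bowen.
have [C' C'0 fC'] := f_sub.
have C0 : 0 < expR C' by exact: expR_gt0.
have fC : submultiplicative f (expR C') by move=> n m x n0 m0; exact: fC'.
have [p [D D0 alphabets]] := uniform_gluing fp M1 fM f_uqm.
have glue := gluing_over_full fp M1 fM D0 alphabets.
have D'0 : 0 < D / M ^+ 2 by rewrite divr_gt0// exprn_gt0// (lt_le_trans ltr01).
have geq : gurevich_eq_pressure f := gurevich_pressureE fp M1 fM C0 fC D'0 glue.
have lower c := exists_almost_equilibrium fp fc M1 fM C0 fC D0 alphabets (c := c).
(* A bound on f_1 is what the limit version requires: [bounded_first] supplies it when the pressure
   is finite, and the assumption on sup f_1 when it is infinite. *)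
have lim_principle B : (forall x, f 1%N x <= B) -> variational_principle_lim f.
  move=> fB; have lim (mu : probability (borel_shift t) R) :
      Defs.invariant mu (@Defs.shift t : borel_shift t -> borel_shift t) -> cvgn (mean_log f mu).
    by move=> /(mean_log_cvg fp fc C0 fC fB)[l [ml _]]; apply/cvg_ex; exists l.
  split=> [mu inv|].
    by split; [exact: (integrals_defined_bounded fp fc C0 fC fB)|exact: lim].
  apply/eqP; rewrite eq_le; apply/andP; split.
    rewrite leNgt; apply/negP => /ereal_between[r [sr /lower[mu [inv _ l0 rl]]]].
    move: sr; apply/negP; rewrite -leNgt; apply: le_trans rl _.
    rewrite (is_cvg_limn_esupE (lim _ inv)) in l0 *.
    by apply: ereal_sup_ubound; exists mu.
  apply: ub_ereal_sup => _ [mu [inv l0 ->]].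
  exact: (variational_inequality fp fc C0 fC fB inv (lim _ inv)).
split=> [Pfin|Pinf]; split.
- split=> //; have [B fB] := bounded_first fp M1 C0 D'0 glue Pfin; exact: lim_principle fB.
- move=> [k [E [k0 E0 spec]]] a.
  have E1 : 0 < E / M by rewrite divr_gt0// (lt_le_trans ltr01).
  apply: (cvg_log_rate_periodic fp M1 fM C0 fC E1 _ Pfin (p := k)).
  move=> n m x y n0 m0 _ _; exists k; first by rewrite inE.
  have word (z : markov_shift t) i : words [set: markov_shift t] i (mkseq z i).
    by apply/wordsP; exists z.
  have [w con] := spec n m _ _ n0 m0 (word x n) (word y m).
  exact: (connects_gluing fp M1 fM E0 n0 m0 I I con).
(* For infinite pressure the upper bound is trivial, and measures exceeding every real c give the
   lower one. *)
- split=> //; apply/eqP; rewrite eq_le; apply/andP; split; last by rewrite Pinf leey.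
  rewrite leNgt; apply/negP => /ereal_between[r [sr /lower[mu [inv def l0 rl]]]].
  move: sr; apply/negP; rewrite -leNgt; apply: le_trans rl _.
  by apply: ereal_sup_ubound; exists mu.
- move=> sup1; split=> //.
  have fle x : ((f 1%N x)%:E <= ereal_sup [set (f 1%N x)%:E | x in [set: markov_shift t]])%E.
    by apply: ereal_sup_ubound; exists x.
  case: (ereal_sup _) sup1 fle => [B|//|] _ fle; last by have := fle point.
  by apply: (lim_principle B) => x; rewrite -lee_fin.
Qed.
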